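(* Let $X=(X_t)_{t\ge0}$ be a real-valued Lévy process. Let $k\ge 3$ be an integer such that $\mathbb{E}|X_1|^k<\infty$, and let $X_1$ satisfy Cramér's condition and $\mathbb{E}X_1=0$. Then, as $t\to\infty$, $$\mathbb{P}(X_t<xV_{X_t})=\Phi(x)+\sum_{\nu=1}^{k-2}Q_\nu^{X_1}(x)t^{-\nu/2}+o\left(t^{-\frac{k-2}{2}}\right)=\Phi(x)+\sum_{\nu=1}^{k-2}Q_\nu^{X_t}(x)+o\left(t^{-\frac{k-2}{2}}\right),$$ uniformly in $x\in\mathbb{R}$.
   Context: $\mathbb{N}=\{1,2,\dots\}$ and $\Phi$ is the cumulative distribution function of the standard normal distribution. For a real random variable $Y$, $v_Y(s)=\mathbb{E}e^{isY}$ is its characteristic function. Cramér's condition for $Y$: $\limsup_{|s|\to\infty}|v_Y(s)|<1$. Cumulants: for $k\in\mathbb{N}$ with $\mathbb{E}|Y|^k<\infty$, $\gamma_k^Y=\frac{1}{i^k}\left[\frac{d^k}{ds^k}\log v_Y(s)\right]_{s=0}$ (with the continuous branch of $\log v_Y$ near $0$ vanishing at $0$). $V_Y\ge 0$ is defined by $V_Y^2=\mathbb{E}Y^2$. Hermite polynomials: $H_n(x)=(-1)^n e^{x^2/2}\frac{d^n}{dx^n}e^{-x^2/2}$. Approximating functions: for $\nu\in\mathbb{N}$ with $\mathbb{E}|Y|^{\nu+2}<\infty$, $$Q_\nu^{Y}(x)=-\frac{1}{\sqrt{2\pi}}e^{-x^2/2}\sum H_{\nu+2l-1}(x)\prod_{m=1}^\nu\frac{1}{k_m!}\left(\frac{\gamma_{m+2}^Y}{(m+2)!\,V_Y^{m+2}}\right)^{k_m},$$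 where the sum is over all non-negative integer solutions $(k_1,\dots,k_\nu)$ of $k_1+2k_2+\dots+\nu k_\nu=\nu$ and $l=\sum_{j=1}^\nu k_j$. *)

(* Defs.v *)
From HB Require Import structures.
From mathcomp Require Import all_boot all_order all_algebra.
From mathcomp Require Import all_classical all_reals all_analysis.
From mathcomp Require Import complex.

Set Implicit Arguments.
Unset Strict Implicit.
Unset Printing Implicit Defensive.

Import Order.TTheory GRing.Theory Num.Theory.
Import numFieldNormedType.Exports.

Local Open Scope classical_set_scope.
Local Open Scope complex_scope.
Local Open Scope ring_scope.

Definition cexp (R : realType) (z : R[i]) : R[i] :=
  (expR (complex.Re z) * cos (complex.Im z)) +i* (expR (complex.Re z) * sin (complex.Im z)).

Definition cderive1n (R : realType) (n : nat) (f : R -> R[i]) (s : R) : R[i] :=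
  derive1n n (fun u => complex.Re (f u)) s +i*
  derive1n n (fun u => complex.Im (f u)) s.

Definition abs_infty (R : realType) : set_system R :=
  filter_from [set: R] (fun M => [set s | M < `|s|]).

Section RandomVariables.
Context (d : measure_display) (T : measurableType d) (R : realType).
Variable P : probability T R.

(* The complex expectation E[exp(i s Y)]; both parts are integrals of bounded
   functions, so [fine] loses nothing when Y is measurable. *)
Definition char_fun (Y : T -> R) (s : R) : R[i] :=
  fine ('E_P[fun w => cos (s * Y w)%R])%E +i* fine ('E_P[fun w => sin (s * Y w)%R])%E.

Definition cramer_condition (Y : T -> R) : Prop :=
  (limf_esup (fun s : R => (Normc.normc (char_fun Y s))%:E) (@abs_infty R) < 1)%E.

Definition is_log_branch (v L : R -> R[i]) : Prop :=
  L 0 = 0 /\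
  \forall s \near (0 : R),
    [/\ {for s, continuous (fun u => complex.Re (L u))},
        {for s, continuous (fun u => complex.Im (L u))} &
        cexp (L s) = v s].

(* Two branches agree near 0, so the derivatives at 0 do not depend on the
   branch chosen. *)
Definition log_char_fun (Y : T -> R) : R -> R[i] :=
  xget (fun=> 0) [set L | is_log_branch (char_fun Y) L].

(* gamma_k^Y. Since v_Y(-s) is the conjugate of v_Y(s), the complex number
   below is real when the k-th absolute moment is finite; [Re] only changes
   its type. *)
Definition cumulant (Y : T -> R) (k : nat) : R :=
  complex.Re (((0 +i* 1) ^+ k)^-1 * cderive1n k (log_char_fun Y) 0).

(* V_Y, the root of the uncentred second moment. *)
Definition rms (Y : T -> R) : R := Num.sqrt (fine ('E_P[fun w => (Y w ^+ 2)%R])%E).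

Definition hermite (n : nat) (x : R) : R :=
  (-1) ^+ n * expR (x ^+ 2 / 2) * derive1n n (fun y : R => expR (- (y ^+ 2 / 2))) x.

(* k_1 + 2 k_2 + ... + nu k_nu = nu, where [k m] stands for k_(m+1); every
   solution has all its entries at most nu. *)
Definition is_weight_solution (nu : nat) (k : {ffun 'I_nu -> 'I_nu.+1}) : bool :=
  (\sum_(m < nu) m.+1 * k m)%N == nu.

Definition edgeworth_Q (Y : T -> R) (nu : nat) (x : R) : R :=
  - (Num.sqrt (2 * pi))^-1 * expR (- (x ^+ 2 / 2)) *
  \sum_(k : {ffun 'I_nu -> 'I_nu.+1} | is_weight_solution k)
    hermite (nu + 2 * (\sum_(m < nu) k m) - 1)%N x *
    \prod_(m < nu)
      (((k m)`!%:R)^-1 *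
       (cumulant Y m.+3 / ((m.+3)`!%:R * rms Y ^+ m.+3)) ^+ k m).

(* Product rule for all measurable sets; since some of the B i may be the whole
   line, this contains the rule for subfamilies. *)
Definition mutually_independent (n : nat) (Y : 'I_n -> T -> R) : Prop :=
  forall B : 'I_n -> set R, (forall i, measurable (B i)) ->
    (P (\bigcap_(i in [set: 'I_n]) (Y i @^-1` B i)) =
     \prod_(i < n) P (Y i @^-1` B i))%E.

(* The time set is [0, +oo[; the values of X at negative times play no role.
   Regularity is continuity in probability: processes with cadlag paths are
   covered, as stationary increments make them continuous in probability. *)
Record levy_process (X : R -> {RV P >-> R}) : Prop := LevyProcess {
  levy_start : P [set w | X 0 w = 0] = 1%E;
  levy_independent_increments : forall (n : nat) (t : nat -> R),
    0 <= t 0%N -> (forall j, (j < n)%N -> t j < t j.+1) ->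
    @mutually_independent n (fun j w => X (t j.+1) w - X (t j) w);
  levy_stationary_increments : forall s t : R, 0 <= s -> s <= t ->
    forall B : set R, measurable B ->
      P [set w | B (X t w - X s w)] = P [set w | B (X (t - s) w)];
  levy_stochastic_continuity : forall t e : R, 0 <= t -> 0 < e ->
    P [set w | e <= `|X s w - X t w|]
      @[s --> within [set s | 0 <= s] (nbhs t)] --> 0%E }.

End RandomVariables.

Definition std_normal_cdf (R : realType) (x : R) : R :=
  fine (normal_prob (0 : R) 1 `]-oo, x]%classic).

(* f(t, x) = o(t^(-a)) as t -> +oo, uniformly in x. *)
Definition unif_little_o_powR (R : realType) (a : R) (f : R -> R -> R) : Prop :=
  forall e : R, 0 < e ->
    \forall t \near +oo, forall x : R, `|f t x| <= e * t `^ (- a).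

(* Main.v *)
(* Write tau = t^(-1/2), V = V_{X_1}, and let v_t be the characteristic function
   of X_t. The functions v_t are multiplicative in t, and near 0 they have the
   form v_t = exp (t L) with L = log v_1: v_t exp (- t L) is multiplicative in t
   and stays close to 1, so it is 1. Hence the cumulants of X_t are t times
   those of X_1, and E X_t^2 = t V^2.

   Taylor's formula for L at 0 turns exp (t L (s tau / V)), the characteristic
   function of X_t / (V sqrt t), into e^(-s^2/2) sum_nu tau^nu P_nu (i s) up to
   o(tau^(k-2)) s / (1 + s^2) as long as s tau is small, and this sum is the
   Fourier transform of the density of the Edgeworth expansion, because the
   transform of H_n phi is (i s)^n e^(-s^2/2). When s tau is not small, Cramer's
   condition makes the characteristic function exponentially small in t.

   Smoothing both distribution functions with the Fejer kernel at frequency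
   tau^(-2k+2) expresses their difference through the characteristic functions on
   that range of frequencies, at a cost O(tau^(k-1)). The second expansion is the
   first one, since Q_nu^{X_t} = t^(-nu/2) Q_nu^{X_1}. *)

From HB Require Import structures.
Require Import Defs.
From mathcomp Require Import all_boot all_order all_algebra.
From mathcomp Require Import all_classical all_reals all_analysis.
From mathcomp Require Import measurable_realfun.
From mathcomp Require Import complex ring lra.
Import Order.TTheory GRing.Theory Num.Theory.
Import numFieldNormedType.Exports.
Local Open Scope classical_set_scope.
Local Open Scope ring_scope.
Set Implicit Arguments.
Unset Strict Implicit.
Unset Printing Implicit Defensive.

(** The Fejer kernel has tails of order [1 / z ^ 2] only, so smoothing at frequency [S] with a shift
    [h] costs [h + 1 / (S h)]. With [K = k - 2], making both terms [tau ^ (K + 1)] forces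
    [S = tau ^ (- 2 K - 2)], far beyond the frequencies where the expansion holds. This is
    affordable because the tail of the characteristic function beats every power of [tau]. Cramer's
    condition speaks of infinity only; comparing [v s] with [v (2 s)] brings it down to all
    [|s| >= delta]. The inversion formula has the weight [1 / s] at the origin, so every local error
    must keep a factor [s]; the denominator [1 + s ^ 2] then keeps the integral bounded whatever [S]
    is. A real time [t] is not a sum of unit steps. Near frequency 0 the logarithm handles all [t]
    at once; in the tail the integer part of [t] suffices. Moments are assumed at time 1 only: the
    second moment of [X_t] is recovered from the curvature of [v_t] at 0. *)

Local Notation normc := Normc.normc.
Local Notation cRe := complex.Re.
Local Notation cIm := complex.Im.
Local Notation L1 mu f := (mu.-integrable setT (EFin \o f)).

(** * Real derivatives and the complex exponential *)

Section RealDerivatives.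
Context {R : realType}.
Implicit Types (f g : R -> R) (x : R).

Lemma is_derive_add f g x a b : is_derive x 1 f a -> is_derive x 1 g b ->
  is_derive x 1 (fun y => f y + g y) (a + b).
Proof. by move=> fa gb; exact: is_deriveD. Qed.

Lemma is_derive_sub f g x a b : is_derive x 1 f a -> is_derive x 1 g b ->
  is_derive x 1 (fun y => f y - g y) (a - b).
Proof. by move=> fa gb; exact: is_deriveB. Qed.

Lemma is_derive_opp f x a : is_derive x 1 f a ->
  is_derive x 1 (fun y => - f y) (- a).
Proof. by move=> fa; exact: is_deriveN. Qed.

Lemma is_derive_mul f g x a b : is_derive x 1 f a -> is_derive x 1 g b ->
  is_derive x 1 (fun y => f y * g y) (a * g x + f x * b).
Proof.
move=> fa gb; have := @is_deriveM _ _ f g x 1 a b fa gb.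
by move/is_derive_eq; apply; rewrite /GRing.scale/= addrC mulrC; congr (_ + _).
Qed.

Lemma is_derive_cmul (c : R) f x a : is_derive x 1 f a ->
  is_derive x 1 (fun y => c * f y) (c * a).
Proof. by move=> fa; exact: is_deriveZ. Qed.

Lemma is_derive_chain f g x a b : is_derive (g x) 1 f a -> is_derive x 1 g b ->
  is_derive x 1 (fun y => f (g y)) (a * b).
Proof.
move=> fa gb; have := @is_derive1_comp _ f g x a b fa gb.
by move/is_derive_eq; apply.
Qed.

Lemma is_derive_pow n x : is_derive x 1 (fun y : R => y ^+ n) (n%:R * x ^+ n.-1).
Proof.
have := @is_deriveX _ _ (@id R) n x 1 1 (is_derive_id x 1).
by rewrite exprfctE => /is_derive_eq; apply; rewrite /GRing.scale/= mulr1.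
Qed.

Lemma is_derive_inv f x a : f x != 0 -> is_derive x 1 f a ->
  is_derive x 1 (fun y => (f y)^-1) (- a * ((f x)^-1 * (f x)^-1)).
Proof.
move=> fx0 fa; have := @is_deriveV R f x a 1 fx0 fa.
move/is_derive_eq; apply; rewrite /GRing.scale/= -exprVn expr2; ring.
Qed.

Lemma continuous_of_derive f f' :
  (forall x : R, is_derive x 1 f (f' x)) -> continuous f.
Proof.
by move=> df x; apply/differentiable_continuous/derivable1_diffP; case: (df x).
Qed.

Lemma mean_value f f' (a b : R) : a < b ->
  (forall x : R, a <= x <= b -> is_derive x 1 f (f' x)) ->
  exists2 c, a <= c <= b & f b - f a = f' c * (b - a).
Proof.
move=> ab df.
have dfi (x : R) : x \in `]a, b[ -> is_derive x 1 f (f' x).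
  by rewrite in_itv/= => /andP[ax xb]; apply: df; rewrite (ltW ax) (ltW xb).
have cf : {within `[a, b], continuous f}.
  apply: derivable_within_continuous => x; rewrite in_itv/= => xab.
  by have [] := df x xab.
have [c] := MVT ab dfi cf.
by rewrite in_itv/= => /andP[ac cb] E; exists c; rewrite ?(ltW ac) ?(ltW cb).
Qed.

Lemma le_mean_value f f' (a b B : R) : a <= b ->
  (forall x : R, a <= x <= b -> is_derive x 1 f (f' x)) ->
  (forall x : R, a <= x <= b -> `|f' x| <= B) -> `|f b - f a| <= B * (b - a).
Proof.
rewrite le_eqVlt => /predU1P[->|ab] df fB; first by rewrite !subrr normr0 mulr0.
have [c cab ->] := mean_value ab df.
rewrite normrM (gtr0_norm (_ : 0 < b - a)) ?subr_gt0//.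
by rewrite ler_wpM2r ?subr_ge0 ?(ltW ab)// fB.
Qed.

Lemma nondecreasing_of_derive f f' (a b : R) : a <= b ->
  (forall x : R, a <= x <= b -> is_derive x 1 f (f' x)) ->
  (forall x : R, a <= x <= b -> 0 <= f' x) -> f a <= f b.
Proof.
rewrite le_eqVlt => /predU1P[->//|ab] df f0; have [c cab E] := mean_value ab df.
by rewrite -subr_ge0 E mulr_ge0 ?f0// subr_ge0 ltW.
Qed.

End RealDerivatives.

Section ComplexPrelim.
Context {R : realType}.
Implicit Types z w : R[i].

Lemma normc_ge0 z : 0 <= normc z.
Proof. by case: z => a b; exact: sqrtr_ge0. Qed.

Lemma normcX z n : normc (z ^+ n) = normc z ^+ n.
Proof.
elim: n => [|n IH]; first by rewrite !expr0 Normc.normc1.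
by rewrite !exprS Normc.normcM IH.
Qed.

Lemma normcR (x : R) : normc (x%:C)%C = `|x|.
Proof. by rewrite /= expr0n /= addr0 sqrtr_sqr. Qed.

Lemma normcB z w : normc (z - w) <= normc z + normc w.
Proof. by rewrite -(normcN w) le_normcD. Qed.

Lemma normc_sum (I : Type) (r : seq I) (P : pred I) (F : I -> R[i]) :
  normc (\sum_(i <- r | P i) F i) <= \sum_(i <- r | P i) normc (F i).
Proof.
elim/big_ind2: _ => [|x y z w h1 h2|//]; first by rewrite Normc.normc0.
exact: le_trans (le_normcD _ _) (lerD h1 h2).
Qed.

Lemma normc_prod (I : Type) (r : seq I) (P : pred I) (F : I -> R[i]) :
  normc (\prod_(i <- r | P i) F i) = \prod_(i <- r | P i) normc (F i).
Proof.
elim/big_ind2: _ => [|x y z w <- <-|//]; first by rewrite Normc.normc1.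
by rewrite Normc.normcM.
Qed.

Lemma Re_le_normc z : `|cRe z| <= normc z.
Proof. by case: z => a b /=; rewrite -sqrtr_sqr ler_wsqrtr// lerDl sqr_ge0. Qed.

Lemma Im_le_normc z : `|cIm z| <= normc z.
Proof. by case: z => a b /=; rewrite -sqrtr_sqr ler_wsqrtr// lerDr sqr_ge0. Qed.

Lemma normc_le_ReIm z : normc z <= `|cRe z| + `|cIm z|.
Proof.
case: z => a b /=; rewrite -[leRHS]ger0_norm ?addr_ge0// -sqrtr_sqr ler_wsqrtr//.
rewrite sqrrD !real_normK ?num_real// addrAC lerDl mulrn_wge0//.

Qed.

Lemma sqr_normc z : normc z ^+ 2 = cRe z ^+ 2 + cIm z ^+ 2.
Proof. by case: z => x y; rewrite /= sqr_sqrtr// addr_ge0 ?sqr_ge0. Qed.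

(** Cauchy-Schwarz against a unit vector: the difference of the squares is [(p y - q x) ^ 2]. Real
    combinations of cosine and sine transforms are bounded through this. *)
Lemma rotation_le_normc (p q : R) z : p ^+ 2 + q ^+ 2 = 1 ->
  `|p * cRe z + q * cIm z| <= normc z.
Proof.
move=> pq; rewrite -(ler_pXn2r (ltn0Sn 1)) ?nnegrE ?normc_ge0//.
rewrite real_normK ?num_real// sqr_normc; move: (cRe z) (cIm z) => x y.
rewrite -[leRHS]mul1r -pq -subr_ge0.
by rewrite [leRHS](_ : _ = (p * y - q * x) ^+ 2) ?sqr_ge0//; ring.
Qed.

Lemma cexpD z w : cexp (z + w) = cexp z * cexp w.
Proof.
case: z => a b; case: w => c d; rewrite /cexp /= expRD cosD sinD.
apply/eqP; rewrite eq_complex /=; apply/andP; split; apply/eqP; ring.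
Qed.

Lemma cexp0 : cexp (0 : R[i]) = 1.
Proof. by rewrite /cexp /= expR0 cos0 sin0 !mul1r. Qed.

Lemma cexp_sum (I : Type) (r : seq I) (P : pred I) (F : I -> R[i]) :
  cexp (\sum_(i <- r | P i) F i) = \prod_(i <- r | P i) cexp (F i).
Proof.
elim/big_ind2: _ => [|x y z w <- <-|//]; first exact: cexp0.
exact: cexpD.
Qed.

Lemma normc_cexp z : normc (cexp z) = expR (cRe z).
Proof.
case: z => a b; rewrite /cexp /= !exprMn -mulrDr cos2Dsin2 mulr1 sqrtr_sqr.
by rewrite ger0_norm ?expR_ge0.
Qed.

Definition is_cderive (f : R -> R[i]) (x : R) (l : R[i]) :=
  is_derive x 1 (fun y => cRe (f y)) (cRe l) /\
  is_derive x 1 (fun y => cIm (f y)) (cIm l).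

Lemma is_cderiveD f g x l m : is_cderive f x l -> is_cderive g x m ->
  is_cderive (fun y => f y + g y) x (l + m).
Proof.
move=> [f1 f2] [g1 g2]; split; rewrite raddfD /=.
- by under eq_fun do rewrite raddfD; exact: is_derive_add.
- by under eq_fun do rewrite raddfD; exact: is_derive_add.
Qed.

Lemma is_cderiveMl f x l c : is_cderive f x l ->
  is_cderive (fun y => c * f y) x (c * l).
Proof.
move=> [f1 f2]; case: c => a b; case: l f1 f2 => l1 l2 /= f1 f2; split => /=.
- rewrite (_ : (fun y => _) = (fun y => a * cRe (f y) - b * cIm (f y))).
    by apply: is_derive_sub; exact: is_derive_cmul.
  by apply/funext => y; case: (f y).
- rewrite (_ : (fun y => _) = (fun y => a * cIm (f y) + b * cRe (f y))).
    by apply: is_derive_add; exact: is_derive_cmul.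
  by apply/funext => y; case: (f y).
Qed.

Lemma is_cderive_sum n (f : nat -> R -> R[i]) x (l : nat -> R[i]) :
  (forall j, (j < n)%N -> is_cderive (f j) x (l j)) ->
  is_cderive (fun y => \sum_(j < n) f j y) x (\sum_(j < n) l j).
Proof.
elim: n => [|n IH] h.
  rewrite big_ord0; under eq_fun do rewrite big_ord0.
  by split; exact: is_derive_cst.
rewrite big_ord_recr /=; under eq_fun do rewrite big_ord_recr /=.
apply: is_cderiveD; last exact: h.
by apply: IH => j jn; apply: h; exact: ltnW.
Qed.

Lemma is_cderive_cexp z (x : R) :
  is_cderive (fun y => cexp ((y%:C)%C * z)) x (z * cexp ((x%:C)%C * z)).
Proof.
case: z => a b; split; rewrite /cexp /=.
- have -> : (fun y : R => expR (y * a - 0 * b) * cos (y * b + 0 * a)) =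
     (fun y => expR (y * a) * cos (y * b)).
    by apply/funext => y; rewrite !mul0r subr0 addr0.
  rewrite !mul0r subr0 addr0.
  apply: is_derive_eq; rewrite /GRing.scale/=; ring.
- have -> : (fun y : R => expR (y * a - 0 * b) * sin (y * b + 0 * a)) =
     (fun y => expR (y * a) * sin (y * b)).
    by apply/funext => y; rewrite !mul0r subr0 addr0.
  rewrite !mul0r subr0 addr0.
  apply: is_derive_eq; rewrite /GRing.scale/=; ring.
Qed.

(** There is no mean value theorem for complex values; it is applied to the real and imaginary parts
    separately, whence the factor 2. *)
Lemma cmean_value (f f' : R -> R[i]) (B : R) :
  (forall x : R, 0 <= x <= 1 -> is_cderive f x (f' x)) ->
  (forall x : R, 0 <= x <= 1 -> normc (f' x) <= B) ->
  normc (f 1 - f 0) <= 2 * B.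
Proof.
move=> df hB.
have B0 : 0 <= B.
  by apply: le_trans (normc_ge0 _) (hB 0 _); rewrite lexx ler01.
have mv (g g' : R -> R) : (forall x : R, 0 <= x <= 1 -> is_derive x 1 g (g' x)) ->
    (forall x : R, 0 <= x <= 1 -> `|g' x| <= B) -> `|g 1 - g 0| <= B.
  by move=> dg gB; have := le_mean_value ler01 dg gB; rewrite subr0 mulr1.
apply: le_trans (normc_le_ReIm _) _; rewrite mulr_natl mulr2n !raddfB /=.
apply: lerD.
- apply: (mv (fun y => cRe (f y)) (fun y => cRe (f' y))) => x /[dup] xI /df [] //.
  by move=> _ _; exact: le_trans (Re_le_normc _) (hB _ xI).
- apply: (mv (fun y => cIm (f y)) (fun y => cIm (f' y))) => x /[dup] xI /df [] //.
  by move=> _ _; exact: le_trans (Im_le_normc _) (hB _ xI).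
Qed.

Definition cexp_trunc (n : nat) z : R[i] :=
  \sum_(j < n) (j`!%:R)^-1 * z ^+ j.

Lemma is_cderive_trunc n z (x : R) :
  is_cderive (fun y => cexp_trunc n.+1 ((y%:C)%C * z)) x
    (z * cexp_trunc n ((x%:C)%C * z)).
Proof.
have pw j : is_cderive (fun y : R => (y ^+ j)%:C%C * z ^+ j) x
    ((x ^+ j.-1 *+ j)%:C%C * z ^+ j).
  have dX := is_derive_pow j x.
  case: (z ^+ j) => a b; split => /=.
  - have -> : (fun y : R => y ^+ j * a - 0 * b) = (fun y => a * y ^+ j).
      by apply/funext => y; rewrite mul0r subr0 mulrC.
    have /is_derive_eq := is_derive_cmul a dX; apply.
    by rewrite mul0r subr0 -[X in X * a]mulr_natl mulrC.
  - have -> : (fun y : R => y ^+ j * b + 0 * a) = (fun y => b * y ^+ j).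
      by apply/funext => y; rewrite mul0r addr0 mulrC.
    have /is_derive_eq := is_derive_cmul b dX; apply.
    by rewrite mul0r addr0 -[X in X * b]mulr_natl mulrC.
have := @is_cderive_sum n.+1
   (fun j y => (j`!%:R)^-1 * ((y ^+ j)%:C%C * z ^+ j)) x _
   (fun j _ => is_cderiveMl (j`!%:R)^-1 (pw j)).
rewrite big_ord_recl /= mulr0n mul0r mulr0 add0r.
have -> : (fun y : R => \sum_(j < n.+1) (j`!%:R)^-1 * ((y ^+ j)%:C%C * z ^+ j)) =
  (fun y => cexp_trunc n.+1 ((y%:C)%C * z)).
  apply/funext => y; rewrite /cexp_trunc; apply: eq_bigr => j _.
  by rewrite exprMn rmorphXn.
congr (is_cderive _ _ _); rewrite /cexp_trunc mulr_sumr; apply: eq_bigr => j _.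
rewrite exprMn factS natrM invfM exprS -rmorphXn /bump /= add1n add0n.
rewrite rmorphMn /= -[X in _ * (X * _)]mulr_natl.
have h : (j.+1%:R : R[i]) != 0 by rewrite pnatr_eq0.
have h' : (j`!%:R : R[i]) != 0 by rewrite pnatr_eq0 -lt0n fact_gt0.
move: (j.+1%:R : R[i]) h (j`!%:R : R[i]) h' => a a0 b b0.
by field; rewrite a0 b0.
Qed.

(** Along the segment from 0 to [z], the remainder of order [n + 1] has derivative [z] times the
    remainder of order [n]. Each use of [cmean_value] costs a factor 2, which gives [2 ^ n] where a
    sharp bound would have [1 / n!]. *)
Lemma cexp_taylor n z :
  normc (cexp z - cexp_trunc n z) <= (2 * normc z) ^+ n * expR (normc z).
Proof.
elim: n z => [|n IH] z.
  rewrite /cexp_trunc big_ord0 subr0 expr0 mul1r normc_cexp ler_expR.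
  exact: le_trans (ler_norm _) (Re_le_normc _).
pose f (y : R) := cexp (y%:C%C * z) - cexp_trunc n.+1 (y%:C%C * z).
pose f' (y : R) := z * (cexp (y%:C%C * z) - cexp_trunc n (y%:C%C * z)).
have -> : cexp z - cexp_trunc n.+1 z = f 1 - f 0.
  rewrite /f !mul1r !mul0r cexp0 /cexp_trunc [X in _ - (1 - X)]big_ord_recl.
  rewrite expr0 fact0 invr1 mulr1 [X in _ - (1 - (1 + X))]big1; last first.
    by move=> i _ /=; rewrite exprS mul0r mulr0.
  by rewrite addr0 subrr subr0.
rewrite exprS -mulrA -mulrA; apply: (@cmean_value f f') => x x01.
- have := is_cderiveD (is_cderive_cexp z x)
    (is_cderiveMl (-1) (is_cderive_trunc n z x)).
  rewrite /f /f' mulrBr; congr (is_cderive _ _ _).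
    by apply/funext => y; rewrite mulN1r.
  by rewrite mulN1r.
- rewrite /f' Normc.normcM ler_wpM2l ?normc_ge0//.
  apply: le_trans (IH _) _.
  have h : normc (x%:C%C * z) <= normc z.
    rewrite Normc.normcM normcR; move: x01 => /andP[x0 x1].
    by rewrite ger0_norm// ler_piMl ?normc_ge0.
  by rewrite ler_pM ?exprn_ge0 ?mulr_ge0 ?normc_ge0 ?expR_ge0// ?lerXn2r ?nnegrE
     ?mulr_ge0 ?normc_ge0 ?ler_expR ?ler_wpM2l.
Qed.

Lemma expR_sum_ge n (x : R) : 0 <= x -> \sum_(j < n) x ^+ j / j`!%:R <= expR x.
Proof.
move=> x0; rewrite expRE.
have -> : \sum_(j < n) x ^+ j / j`!%:R = pseries (fun n => (n`!%:R)^-1) x n.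
  rewrite /pseries /series /= big_mkord; apply: eq_bigr => j _.
  by rewrite mulrC.
apply: (@nondecreasing_cvgn_le R (pseries (fun n => (n`!%:R)^-1) x)).
  apply/nondecreasing_seqP => m; rewrite /pseries /series /= big_nat_recr//=.
  by rewrite lerDl mulr_ge0 ?exprn_ge0.
rewrite /pseries -exp_coeffE; exact: is_cvg_series_exp_coeff.
Qed.

Lemma cexp_trunc_le n z : normc (cexp_trunc n z) <= expR (normc z).
Proof.
apply: le_trans (normc_sum _ _ _) _.
apply: le_trans (expR_sum_ge n (normc_ge0 z)); apply: ler_sum => j _.
rewrite Normc.normcM normcX Normc.normcV mulrC ler_wpM2l ?exprn_ge0 ?normc_ge0//.
have -> : (j`!%:R : R[i]) = (j`!%:R : R)%:C%C by rewrite rmorph_nat.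
by rewrite normcR ger0_norm.
Qed.

End ComplexPrelim.

Local Arguments Normc.normc : simpl never.
Local Arguments char_fun : simpl never.

(** * Integrability and integrals of real-valued functions *)

Section RealIntegrands.
Context d (T : measurableType d) (R : realType) (mu : {measure set T -> \bar R}).
Variable D : set T.
Hypothesis mD : measurable D.
Implicit Types f g : T -> R.

Lemma integrable_add f g : mu.-integrable D (EFin \o f) ->
  mu.-integrable D (EFin \o g) ->
  mu.-integrable D (EFin \o (fun x => f x + g x)).
Proof. by move=> hf hg; exact: (integrableD mD hf hg). Qed.

Lemma integrable_sub f g : mu.-integrable D (EFin \o f) ->
  mu.-integrable D (EFin \o g) ->
  mu.-integrable D (EFin \o (fun x => f x - g x)).
Proof. by move=> hf hg; exact: (integrableB mD hf hg). Qed.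

Lemma integrable_scale (c : R) f : mu.-integrable D (EFin \o f) ->
  mu.-integrable D (EFin \o (fun x => c * f x)).
Proof. by move=> hf; exact: (integrableZl mD c hf). Qed.

Lemma integrable_dominated f g : measurable_fun D f ->
  (forall x, D x -> `|f x| <= g x) -> mu.-integrable D (EFin \o g) ->
  mu.-integrable D (EFin \o f).
Proof.
move=> mf fg; apply: le_integrable => //; first exact/measurable_EFinP.
move=> x Dx /=; rewrite lee_fin; apply: le_trans (fg _ Dx) (ler_norm _).
Qed.

Lemma integrable_measurable f : mu.-integrable D (EFin \o f) ->
  measurable_fun D f.
Proof. by move=> /integrableP[/measurable_EFinP]. Qed.

Lemma le_norm_Rintegral f g : mu.-integrable D (EFin \o f) ->
  mu.-integrable D (EFin \o g) -> (forall x, D x -> `|f x| <= g x) ->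
  `|\int[mu]_(x in D) f x| <= \int[mu]_(x in D) g x.
Proof.
move=> hf hg fg; apply: le_trans (le_normr_Rintegral mD hf) _.
by apply: le_Rintegral => //; exact: integrable_norm.
Qed.

End RealIntegrands.

(** * Characteristic functions and independence *)

Section Independence.
Context d (T : measurableType d) (R : realType) (P : probability T R).
Implicit Types A B : {RV P >-> R}.

Lemma bounded_integrable (f : T -> R) (M : R) : measurable_fun setT f ->
  (forall w, `|f w| <= M) -> L1 P f.
Proof.
move=> mf fM; apply: measurable_bounded_integrable => //.
  by rewrite [ltLHS]probability_setT ltry.
exists M; split; first exact: num_real.
by move=> N MN w _; exact: le_trans (fM w) (ltW MN).
Qed.

Lemma integrable_cstT (c : R) : L1 P (fun=> c).
Proof. by apply: (@bounded_integrable _ `|c|). Qed.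

Lemma Rintegral_cstT (c : R) : \int[P]_w c = c.
Proof.
by rewrite /Rintegral integral_cst//= probability_setT mule1.
Qed.

Lemma char_funE (Y : T -> R) s : char_fun P Y s =
  Complex (\int[P]_w cos (s * Y w)) (\int[P]_w sin (s * Y w)).
Proof. by rewrite /char_fun /Rintegral unlock. Qed.

Lemma Rintegral_comp_eq_dist A B (f : R -> R) (M : R) :
  (forall S, measurable S -> P (A @^-1` S) = P (B @^-1` S)) ->
  measurable_fun setT f -> (forall x, `|f x| <= M) ->
  \int[P]_w f (A w) = \int[P]_w f (B w).
Proof.
move=> AB mf fM; rewrite /Rintegral; congr fine.
have mE : measurable_fun setT (fun x : R => (f x)%:E) by exact/measurable_EFinP.
have iY (Y : {RV P >-> R}) : P.-integrable setT ((EFin \o f) \o Y).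
  by apply: (@bounded_integrable (f \o Y) M) => [|w]; [exact: measurableT_comp|exact: fM].
rewrite -[LHS](integral_distribution mE (iY A)).
rewrite -[RHS](integral_distribution mE (iY B)).
by apply: eq_measure_integral => S mS _; exact: AB.
Qed.

(** The product rule on rectangles identifies the law of the pair with the product of the two laws,
    by uniqueness of the product measure; Fubini then separates the factors. *)
Lemma Rintegral_indepM A B (f g : R -> R) (M : R) :
  (forall S S', measurable S -> measurable S' ->
    P (A @^-1` S `&` B @^-1` S') = (P (A @^-1` S) * P (B @^-1` S'))%E) ->
  measurable_fun setT f -> measurable_fun setT g ->
  (forall x, `|f x| <= M) -> (forall x, `|g x| <= M) ->
  \int[P]_w (f (A w) * g (B w)) = (\int[P]_w f (A w)) * (\int[P]_w g (B w)).
Proof.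
move=> AB mf mg fM gM.
have mAB : measurable_fun setT (fun w => (A w, B w)).
  by apply: measurable_fun_pair.
pose AB_ : {mfun T >-> (R * R)%type} := mfun_Sub (mem_set mAB).
pose h (z : R * R) : \bar R := (f z.1 * g z.2)%:E.
have mh : measurable_fun [set: R * R] h.
  apply/measurable_EFinP; apply: measurable_funM; exact: measurableT_comp.
have M0 : 0 <= M by apply: le_trans (fM 0).
have hM z : `|f z.1 * g z.2| <= M * M by rewrite normrM ler_pM.
have mf' : measurable_fun setT (fun x : R => (f x)%:E) by exact/measurable_EFinP.
have mg' : measurable_fun setT (fun x : R => (g x)%:E) by exact/measurable_EFinP.
pose m1 := distribution P A; pose m2 := distribution P B.
have eqP' : forall X, measurable X -> (m1 \x m2)%E X = distribution P AB_ X.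
  apply: product_measure_unique => S S' mS mS'.
  by rewrite -[RHS](AB _ _ mS mS').
have ih : P.-integrable setT (h \o AB_).
  apply: (@bounded_integrable (fun w => f (A w) * g (B w)) (M * M)).
    by apply: measurable_funM; exact: measurableT_comp.
  by move=> w; exact: (hM (A w, B w)).
have if1 : P.-integrable setT ((EFin \o f) \o A).
  by apply: (@bounded_integrable (f \o A) M) => [|w]; [exact: measurableT_comp|exact: fM].
have ig1 : P.-integrable setT ((EFin \o g) \o B).
  by apply: (@bounded_integrable (g \o B) M) => [|w]; [exact: measurableT_comp|exact: gM].
have ih2 : (m1 \x m2)%E.-integrable setT h.
  apply: measurable_bounded_integrable => //.
    apply: (@le_lt_trans _ _ (distribution P AB_ setT)).
      by rewrite -(eqP' _ measurableT).
    by rewrite [ltLHS]probability_setT ltry.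
    exact/measurable_EFinP.
  exists (M * M); split; first exact: num_real.
  by move=> N MN w _; exact: le_trans (hM w) (ltW MN).
have -> : \int[P]_w (f (A w) * g (B w)) = fine (\int[(m1 \x m2)%E]_z h z).
  rewrite /Rintegral; congr fine.
  rewrite -[LHS](integral_distribution mh ih).
  by apply: eq_measure_integral => X mX _; apply/esym; exact: eqP'.
rewrite -integral12_prod_meas1// /fubini_F.
have E x : (\int[m2]_y h (x, y))%E = ((f x)%:E * (\int[P]_w (g (B w))%:E))%E.
  rewrite /h /=; under eq_integral do rewrite EFinM.
  rewrite integralZl//.
    by congr (_ * _)%E; exact: (integral_distribution mg' ig1).
  exact: integrable_pushforward.
under eq_integral do rewrite E.
have gfin : (\int[P]_w (g (B w))%:E)%E \is a fin_num.
  by apply: integrable_fin_num.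
rewrite -(fineK gfin) integralZr//; last exact: integrable_pushforward.
rewrite (_ : (\int[m1]_x (f x)%:E)%E = (\int[P]_w (f (A w))%:E)%E); last first.
  exact: (integral_distribution mf' if1).
have ffin : (\int[P]_w (f (A w))%:E)%E \is a fin_num.
  by apply: integrable_fin_num.
by rewrite -(fineK ffin).
Qed.

Lemma measurable_cosM (s : R) : measurable_fun setT (fun x : R => cos (s * x)).
Proof.
apply: continuous_measurable_fun => x.
apply: (@continuous_comp _ _ _ (fun x : R => s * x) (@cos R)).
  exact: mulrl_continuous.
exact: continuous_cos.
Qed.

Lemma measurable_sinM (s : R) : measurable_fun setT (fun x : R => sin (s * x)).
Proof.
apply: continuous_measurable_fun => x.
apply: (@continuous_comp _ _ _ (fun x : R => s * x) (@sin R)).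
  exact: mulrl_continuous.
exact: continuous_sin.
Qed.

Lemma char_fun_eq_dist A B s :
  (forall S, measurable S -> P (A @^-1` S) = P (B @^-1` S)) ->
  char_fun P A s = char_fun P B s.
Proof.
move=> AB; rewrite !char_funE; congr Complex.
  apply: (@Rintegral_comp_eq_dist A B (fun x => cos (s * x)) 1) => //.
    exact: measurable_cosM.
  by move=> x; exact: cos_max.
apply: (@Rintegral_comp_eq_dist A B (fun x => sin (s * x)) 1) => //.
  exact: measurable_sinM.
by move=> x; exact: sin_max.
Qed.

Lemma integrable_cosM (Y : {RV P >-> R}) s :
  L1 P (fun w => cos (s * Y w)).
Proof.
apply: (@bounded_integrable _ 1) => [|w]; last exact: cos_max.
exact: (measurableT_comp (measurable_cosM s)).
Qed.

Lemma integrable_sinM (Y : {RV P >-> R}) s :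
  L1 P (fun w => sin (s * Y w)).
Proof.
apply: (@bounded_integrable _ 1) => [|w]; last exact: sin_max.
exact: (measurableT_comp (measurable_sinM s)).
Qed.

Lemma char_fun_indepD A B s :
  (forall S S', measurable S -> measurable S' ->
    P (A @^-1` S `&` B @^-1` S') = (P (A @^-1` S) * P (B @^-1` S'))%E) ->
  char_fun P (fun w => A w + B w) s = char_fun P A s * char_fun P B s.
Proof.
move=> AB; rewrite !char_funE.
have mc := measurable_cosM s; have ms := measurable_sinM s.
have bc (x : R) : `|cos (s * x)| <= 1 by exact: cos_max.
have bs (x : R) : `|sin (s * x)| <= 1 by exact: sin_max.
have im (f g : R -> R) : measurable_fun setT f -> measurable_fun setT g ->
    (forall x, `|f x| <= 1) -> (forall x, `|g x| <= 1) ->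
    L1 P (fun w => f (A w) * g (B w)).
  move=> mf mg f1 g1; apply: (@bounded_integrable _ 1).
    by apply: measurable_funM; exact: measurableT_comp.
  by move=> w; rewrite normrM mulr_ile1.
apply/eqP; rewrite eq_complex /=; apply/andP; split; apply/eqP.
- rewrite -(Rintegral_indepM AB mc mc bc bc) -(Rintegral_indepM AB ms ms bs bs).
  rewrite -RintegralB//; [|exact: (im _ _ mc mc)|exact: (im _ _ ms ms)].
  by apply: eq_Rintegral => w _; rewrite mulrDr cosD.
- rewrite -(Rintegral_indepM AB mc ms bc bs) -(Rintegral_indepM AB ms mc bs bc).
  rewrite -RintegralD//; [|exact: (im _ _ mc ms)|exact: (im _ _ ms mc)].
  by apply: eq_Rintegral => w _; rewrite mulrDr sinD addrC.
Qed.

(* Cauchy-Schwarz for a unit combination [W] of [cos (s Y)] and [sin (s Y)]; the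
   phase making [E W = |v s|] is chosen in [char_fun_phase]. *)
Lemma normc_char_fun_phase (Y : {RV P >-> R}) s (a b : R) :
  a ^+ 2 + b ^+ 2 = 1 ->
  (\int[P]_w (a * cos (s * Y w) + b * sin (s * Y w))) ^+ 2 <=
  \int[P]_w ((a * cos (s * Y w) + b * sin (s * Y w)) ^+ 2).
Proof.
move=> ab; pose W w := a * cos (s * Y w) + b * sin (s * Y w).
have mW : measurable_fun setT W.
  apply: measurable_funD; apply: measurable_funM => //.
    exact: (measurableT_comp (measurable_cosM s)).
  exact: (measurableT_comp (measurable_sinM s)).
have WM w : `|W w| <= `|a| + `|b|.
  rewrite (le_trans (ler_normD _ _))// !normrM lerD// ler_piMr//.
    exact: cos_max.
  exact: sin_max.
have iW : L1 P W by exact: bounded_integrable WM.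
have iW2 : L1 P (fun w => W w ^+ 2).
  apply: (@bounded_integrable _ ((`|a| + `|b|) ^+ 2)).
    exact: measurable_funX.
  by move=> w; rewrite normrX lerXn2r ?nnegrE ?addr_ge0.
set m := \int[P]_w W w.
have ic := integrable_cstT.
have : 0 <= \int[P]_w ((W w - m) ^+ 2).
  by apply: Rintegral_ge0 => w _; exact: sqr_ge0.
have -> : \int[P]_w ((W w - m) ^+ 2) =
    \int[P]_w (W w ^+ 2 - (2 * m * W w - m ^+ 2)).
  by apply: eq_Rintegral => w _; ring.
have i2 : L1 P (fun w => 2 * m * W w).
  apply: (@bounded_integrable _ (`|2 * m| * (`|a| + `|b|))).
    exact: measurable_funM.
  by move=> w; rewrite normrM ler_wpM2l.
have i3 : L1 P (fun w => 2 * m * W w - m ^+ 2).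
  exact: integrable_sub.
rewrite RintegralB// RintegralB// Rintegral_cstT RintegralZl//.
rewrite -/m; lra.
Qed.

Lemma char_fun_phase (Y : {RV P >-> R}) s : exists a b : R, a ^+ 2 + b ^+ 2 = 1 /\
  \int[P]_w (a * cos (s * Y w) + b * sin (s * Y w)) = normc (char_fun P Y s).
Proof.
set v := char_fun P Y s.
have ic := integrable_scale measurableT _ (integrable_cosM Y s).
have is_ := integrable_scale measurableT _ (integrable_sinM Y s).
have [v0|v0] := eqVneq (normc v) 0.
  exists 1, 0; split; first by rewrite expr1n expr0n addr0.
  rewrite v0 -[RHS](_ : cRe v = 0); last by rewrite (Normc.eq0_normc v0).
  rewrite /v char_funE /=; apply: eq_Rintegral => w _.
  by rewrite mul1r mul0r addr0.
exists (cRe v / normc v), (cIm v / normc v).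
have nv := sqr_normc v.
split.
  by rewrite !exprMn -mulrDl -nv exprVn divff// expf_neq0.
rewrite RintegralD// !RintegralZl//; [|exact: integrable_sinM|exact: integrable_cosM].
have -> : \int[P]_w cos (s * Y w) = cRe v by rewrite /v char_funE.
have -> : \int[P]_w sin (s * Y w) = cIm v by rewrite /v char_funE.
by rewrite mulrAC (mulrAC (cIm v)) -mulrDl -!expr2 -nv expr2 mulfK.
Qed.

Lemma normc_char_fun_le1 (Y : {RV P >-> R}) s : normc (char_fun P Y s) <= 1.
Proof.
have [a [b [ab <-]]] := char_fun_phase Y s.
have ic := integrable_scale measurableT a (integrable_cosM Y s).
have is_ := integrable_scale measurableT b (integrable_sinM Y s).
rewrite -[leRHS]Rintegral_cstT; apply: le_Rintegral => //.
- exact: integrable_add.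
- exact: integrable_cstT.
move=> w _; apply: le_trans (ler_norm _) _.
apply: le_trans (rotation_le_normc (Complex (cos (s * Y w)) (sin (s * Y w))) ab) _.
by rewrite /Normc.normc cos2Dsin2 sqrtr1.
Qed.

(** Choose the phase with [E W = |v s|] and use [(E W) ^ 2 <= E W ^ 2]. By the double angle formulas
    [E W ^ 2] is [1 / 2] plus half the pairing of [v (2 s)] with [(a ^ 2 - b ^ 2, 2 a b)], again a
    unit vector. *)
Lemma char_fun_double (Y : {RV P >-> R}) s :
  2 * normc (char_fun P Y s) ^+ 2 - 1 <= normc (char_fun P Y (2 * s)).
Proof.
have [a [b [ab hE]]] := char_fun_phase Y s.
have ic := integrable_cosM Y s; have is_ := integrable_sinM Y s.
have icc := integrable_cosM Y (2 * s); have iss := integrable_sinM Y (2 * s).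
have := @normc_char_fun_phase Y s a b ab; rewrite hE.
have -> : \int[P]_w ((a * cos (s * Y w) + b * sin (s * Y w)) ^+ 2) =
  \int[P]_w (2^-1 + (2^-1 * (a ^+ 2 - b ^+ 2) * cos (2 * s * Y w) +
     a * b * sin (2 * s * Y w))).
  apply: eq_Rintegral => w _.
  have -> : 2 * s * Y w = (s * Y w) *+ 2 by ring.
  rewrite cos_mulr2n sin_mulr2n.
  have := cos2Dsin2 (s * Y w); move: (cos _) (sin _) => x y xy.
  have -> : (a * x + b * y) ^+ 2 = a ^+ 2 * x ^+ 2 + b ^+ 2 * y ^+ 2 +
     2 * a * b * x * y by ring.
  have -> : y ^+ 2 = 1 - x ^+ 2 by rewrite -xy; ring.
  have -> : b ^+ 2 = 1 - a ^+ 2 by rewrite -ab; ring.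
  by field.
have i1 := integrable_cstT 2^-1.
have iZ c f := @integrable_scale _ _ _ P setT measurableT c f.
rewrite RintegralD//; last by apply: integrable_add => //; exact: iZ.
rewrite RintegralD//; [|exact: iZ|exact: iZ].
rewrite Rintegral_cstT !RintegralZl//.
have -> : \int[P]_w cos (2 * s * Y w) = cRe (char_fun P Y (2 * s)) by rewrite char_funE.
have -> : \int[P]_w sin (2 * s * Y w) = cIm (char_fun P Y (2 * s)) by rewrite char_funE.
move=> h.
have CS : (a ^+ 2 - b ^+ 2) * cRe (char_fun P Y (2 * s)) +
   2 * a * b * cIm (char_fun P Y (2 * s)) <= normc (char_fun P Y (2 * s)).
  apply: le_trans (ler_norm _) (rotation_le_normc _ _).
  rewrite (_ : _ + _ = (a ^+ 2 + b ^+ 2) ^+ 2); last by ring.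
  by rewrite ab expr1n.
by lra.
Qed.

End Independence.

(** * Cramer's condition away from the origin *)

Section Cramer.
Context d (T : measurableType d) (R : realType) (P : probability T R).

(** Halving the frequency divides the gap by 4: [2 x ^ 2 - 1 <= 1 - c] gives
    [x ^ 2 <= 1 - c / 2 <= (1 - c / 4) ^ 2]. *)
Lemma char_fun_halve (Y : {RV P >-> R}) (c s : R) (n : nat) : 0 <= c <= 1 ->
  normc (char_fun P Y (2 ^+ n * s)) <= 1 - c ->
  normc (char_fun P Y s) <= 1 - c / 4 ^+ n.
Proof.
elim: n c => [|n IH] c /andP[c0 c1]; first by rewrite expr0 mul1r divr1.
rewrite exprS -mulrA => h.
have -> : c / 4 ^+ n.+1 = (c / 4) / 4 ^+ n.
  by rewrite exprS invfM mulrA.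
apply: IH; first by lra.
have := char_fun_double Y (2 ^+ n * s).
set x := normc (char_fun P Y (2 ^+ n * s)) => h2.
have {h h2} h : 2 * x ^+ 2 - 1 <= 1 - c by exact: le_trans h.
have x0 : 0 <= x by exact: normc_ge0.
rewrite -(ler_pXn2r (ltn0Sn 1)) ?nnegrE//; last by lra.
by have := sqr_ge0 (c / 4); nra.
Qed.

(** The limsup gives a gap beyond some [M]. A fixed number of doublings carries every [|s| >= delta]
    beyond [M], and the gap comes back divided by a fixed power of 4. *)
Lemma cramer_bound (Y : {RV P >-> R}) (delta : R) : cramer_condition P Y ->
  0 < delta -> exists q : R, 0 <= q < 1 /\
    forall s, delta <= `|s| -> normc (char_fun P Y s) <= q.
Proof.
move=> hc d0.
have [M [c [c01 hM]]] : exists (M c : R), 0 < c <= 1 /\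
    forall s, M < `|s| -> normc (char_fun P Y s) <= 1 - c.
  move: hc; rewrite /cramer_condition /limf_esup => /ereal_inf_lt[_ [V VF <-]] V1.
  case: VF => M _ MV.
  have ub s : V s -> ((normc (char_fun P Y s))%:E <= ereal_sup
     [set (normc (char_fun P Y s))%:E | s in V])%E.
    by move=> Vs; apply: ereal_sup_ubound; exists s.
  move: V1 ub; set b := ereal_sup _ => b1 ub.
  (* A point of [V] shows that the supremum is nonnegative, hence not [-oo]; being less than 1, it
     is a real number. *)
  have Vs0 : V (`|M| + 1).
    apply: MV => /=; rewrite ger0_norm ?addr_ge0//.
    by rewrite (le_lt_trans (ler_norm M))// ltrDl.
  have b0 : (0 <= b)%E by apply: le_trans (ub _ Vs0); rewrite lee_fin normc_ge0.
  case: b b1 b0 ub => [b| |]//; rewrite lte_fin lee_fin => b1 b0 ub.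
  exists M, (1 - b); split; first by lra.
  by move=> s Ms; have := ub s (MV s Ms); rewrite lee_fin opprB addrC subrK.
have [n hn] : exists n, M < 2 ^+ n * delta.
  have [n hn] : exists n, M / delta < n%:R.
    by exists (Num.trunc (M / delta)).+1; exact: truncnS_gt.
  exists n; rewrite -ltr_pdivrMr//; apply: lt_trans hn _.
  by rewrite -natrX ltr_nat; exact: ltn_expl.
move: c01 => /andP[c0 c1].
have p4 : 1 <= (4 : R) ^+ n by rewrite exprn_ege1//; lra.
have p4' : 0 < c / 4 ^+ n <= 1.
  rewrite divr_gt0 ?exprn_gt0//= ler_pdivrMr ?exprn_gt0// mul1r.
  exact: le_trans c1 p4.
exists (1 - c / 4 ^+ n); split; first by lra.
move=> s ds; apply: char_fun_halve; first by lra.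
apply: hM; apply: lt_le_trans hn _.
by rewrite normrM ger0_norm ?exprn_ge0// ler_wpM2l ?exprn_ge0.
Qed.

End Cramer.

Section CharFunContinuity.
Context d (T : measurableType d) (R : realType) (P : probability T R).

Lemma continuous_char_fun (Y : {RV P >-> R}) :
  continuous (fun s => cRe (char_fun P Y s)) /\
  continuous (fun s => cIm (char_fun P Y s)).
Proof.
have key (f : R -> R) : continuous f -> (forall x, `|f x| <= 1) ->
    (forall s : R, L1 P (fun w => f (s * Y w))) ->
    continuous (fun s : R => \int[P]_w f (s * Y w)).
  move=> cf f1 hf s.
  have i1 := integrable_cstT P 1.
  apply: (@continuity_under_integral R _ T P (fun s w => f (s * Y w)) setT
    measurableT (s - 1) (s + 1) _ _ (fun=> 1) i1).
  - by move=> x _; exact: hf.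
  - apply: aeW => w _ x _.
    apply: (@continuous_comp _ _ _ (fun x : R => x * Y w) f); last exact: cf.
    exact: mulrr_continuous.
  - by move=> x _; apply: aeW => w _; exact: f1.
  - by rewrite inE /= in_itv/=; apply/andP; split; lra.
split.
  under eq_fun do rewrite char_funE /=.
  by apply: key; [exact: continuous_cos|exact: cos_max|exact: integrable_cosM].
under eq_fun do rewrite char_funE /=.
by apply: key; [exact: continuous_sin|exact: sin_max|exact: integrable_sinM].
Qed.

Lemma char_fun0 (Y : {RV P >-> R}) : char_fun P Y 0 = 1.
Proof.
rewrite char_funE (_ : \int[P]_w cos (0 * Y w) = 1).
  rewrite (_ : \int[P]_w sin (0 * Y w) = 0)//.
  rewrite -[RHS](Rintegral_cstT P); apply: eq_Rintegral => w _.
  by rewrite mul0r sin0.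
rewrite -[RHS](Rintegral_cstT P); apply: eq_Rintegral => w _.
by rewrite mul0r cos0.
Qed.

Lemma char_fun_near0 (Y : {RV P >-> R}) (e : R) : 0 < e ->
  \forall s \near (0 : R), normc (char_fun P Y s - 1) <= e.
Proof.
move=> e0; have [c1 c2] := continuous_char_fun Y.
have e2 : 0 < e / 2 by rewrite divr_gt0.
move/cvgrPdist_le: (c1 0) => /(_ _ e2) h1; move/cvgrPdist_le: (c2 0) => /(_ _ e2) h2.
near=> s; apply: le_trans (normc_le_ReIm _) _; rewrite (_ : e = e / 2 + e / 2); last by lra.
rewrite !raddfB /=; apply: lerD; rewrite distrC.
  by near: s; move: h1; rewrite char_fun0.
by near: s; move: h2; rewrite char_fun0.
Unshelve. all: by end_near.
Qed.

End CharFunContinuity.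

(** * The semigroup of characteristic functions of a Levy process *)

Section LevySemigroup.
Context d (T : measurableType d) (R : realType) (P : probability T R).
Variable X : R -> {RV P >-> R}.
Hypothesis hX : levy_process X.
Local Notation v t s := (char_fun P (X t) s).

Lemma levy_incr_dist (s t : R) (S : set R) : 0 <= s -> s <= t -> measurable S ->
  P ((X t - X s : {RV P >-> R})%R @^-1` S) = P (X (t - s) @^-1` S).
Proof. by move=> s0 st mS; exact: (levy_stationary_increments hX s0 st mS). Qed.

Lemma levy_char_fun0 s : v 0 s = 1.
Proof.
have : P (X 0 @^-1` (~` [set 0])) = 0%E.
  have h := levy_start hX.
  have -> : X 0 @^-1` (~` [set 0]) = ~` (X 0 @^-1` [set 0]) by [].
  rewrite probability_setC; first by rewrite [X in (1 - X)%E]h subee.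
  by rewrite -[Y in measurable Y]setTI; exact: measurable_funPT.
move=> h0.
have ae0 : {ae P, forall w, X 0 w = 0}.
  exists (X 0 @^-1` (~` [set 0])); split => //.
  rewrite -[Y in measurable Y]setTI; apply: measurable_funPT => //.
  exact: measurableC.
have int1 (f : R -> R) : measurable_fun setT f ->
    \int[P]_w f (X 0 w) = f 0.
  move=> mf; rewrite -[RHS](Rintegral_cstT P) /Rintegral; congr fine.
  apply: ae_eq_integral => //.
    by apply/measurable_EFinP; exact: measurableT_comp.
  by apply: filterS ae0 => w -> _.
rewrite char_funE (int1 (fun x => cos (s * x)) (measurable_cosM s)).
by rewrite (int1 (fun x => sin (s * x)) (measurable_sinM s)) mulr0 cos0 sin0.
Qed.

Lemma levy_char_funD (t u s : R) : 0 <= t -> 0 <= u -> v (t + u) s = v t s * v u s.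
Proof.
(* Independence of increments is stated for strictly increasing times, so zero durations are treated
   apart. *)
rewrite le_eqVlt => /predU1P[<-|t0]; first by rewrite add0r levy_char_fun0 mul1r.
rewrite le_eqVlt => /predU1P[<-|u0]; first by rewrite addr0 levy_char_fun0 mulr1.
pose A := (X t - X 0 : {RV P >-> R})%R.
pose B := (X (t + u) - X t : {RV P >-> R})%R.
have dA S : measurable S -> P (A @^-1` S) = P (X t @^-1` S).
  by move=> mS; rewrite (levy_incr_dist _ (ltW t0))// subr0.
have dB S : measurable S -> P (B @^-1` S) = P (X u @^-1` S).
  move=> mS; rewrite (levy_incr_dist (ltW t0))//; last by rewrite lerDl ltW.
  by rewrite (addrC t) addrK.
have dAB S : measurable S ->
    P ((X (t + u) - X 0 : {RV P >-> R})%R @^-1` S) = P (X (t + u) @^-1` S).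
  move=> mS; rewrite (levy_incr_dist (lexx 0))// ?subr0//.
  by rewrite addr_ge0// ltW.
rewrite -(char_fun_eq_dist s dAB) -(char_fun_eq_dist s dA) -(char_fun_eq_dist s dB).
rewrite -char_fun_indepD.
  by congr char_fun; apply/funext => w; 
  change (X (t + u) w - X 0 w = (X t w - X 0 w) + (X (t + u) w - X t w)); ring.
move=> S S' mS mS'.
pose tt (j : nat) : R := if j is j'.+1 then (if j' is 0%N then t else t + u) else 0.
have htt : forall j, (j < 2)%N -> tt j < tt j.+1.
  by move=> [|[|j]]//= _; rewrite ltrDl.
have := @levy_independent_increments _ _ _ _ _ hX 2%N tt (lexx _) htt.
pose C (i : 'I_2) := if i == ord0 then S else S'.
move/(_ C) => /= h.
have {}h := h (fun i => _); rewrite !big_ord_recl big_ord0 /= mule1 in h.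
rewrite -(h _).
  congr (P _); apply/seteqP; split => w /=.
    move=> [Sw S'w] i _; rewrite /C; case: i => [[|[|i]] hi]//=.
  move=> hw; split; first exact: (hw ord0 Logic.I).
  exact: (hw (lift ord0 ord0) Logic.I).
by move=> i; rewrite /C; case: ifP.
Qed.

Lemma levy_char_fun_mulrn (n : nat) (u s : R) : 0 <= u -> v (n%:R * u) s = v u s ^+ n.
Proof.
move=> u0; elim: n => [|n IH]; first by rewrite mul0r levy_char_fun0 expr0.
by rewrite -natr1 mulrDl mul1r levy_char_funD ?mulr_ge0// IH exprSr.
Qed.

(** This transfers Cramer's bound from time 1 to real times: the factor left over at time [t - n]
    has modulus at most 1. *)
Lemma normc_levy_char_fun_le (n : nat) (t s : R) : n%:R <= t ->
  normc (v t s) <= normc (v 1 s) ^+ n.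
Proof.
move=> nt; rewrite -[t](subrK n%:R) levy_char_funD ?subr_ge0//.
rewrite -[n%:R]mulr1 levy_char_fun_mulrn// Normc.normcM normcX.
by rewrite ler_piMl ?exprn_ge0 ?normc_ge0// normc_char_fun_le1.
Qed.

Lemma measurable_norm_ge1 : measurable [set x : R | 1 <= `|x|].
Proof.
rewrite (_ : mkset _ = (@Num.norm _ R) @^-1` `[1, +oo[); last first.
  by apply/seteqP; split => x /=; rewrite in_itv/= andbT.
by rewrite -[Z in measurable Z]setTI; exact: normr_measurable.
Qed.

(** A bound free of moments. Where [|Y| < 1], the functions [cos (s Y)] and [sin (s Y)] each move by
    at most [|s|]; elsewhere they move by at most 2 and 1, which add up to the coefficient 3. *)
Lemma normc_char_funB1 (Y : {RV P >-> R}) (s : R) :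
  normc (char_fun P Y s - 1) <= 2 * `|s| + 3 * fine (P [set w | 1 <= `|Y w|]).
Proof.
pose E := [set w | 1 <= `|Y w|].
have mE : measurable E.
  rewrite -[E]/(Y @^-1` [set x : R | 1 <= `|x|]) -[Z in measurable Z]setTI.
  exact: (measurable_funPT Y measurableT _ measurable_norm_ge1).
have iE : L1 P (\1_E : T -> R).
  apply: (@bounded_integrable _ _ _ _ _ 1); first exact: measurable_indic.
  by move=> w; rewrite indicE; case: (_ \in _); rewrite ?normr1 ?normr0.
have IE : \int[P]_w (\1_E w : R) = fine (P E).
  by rewrite /Rintegral integral_indic// setIT.
have ic := integrable_cstT P.
have key (f : T -> R) (b : R) : L1 P f ->
    (forall w, `|f w| <= `|s| + b * \1_E w) ->
    `|\int[P]_w f w| <= `|s| + b * fine (P E).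
  move=> hf fb; rewrite -IE -(RintegralZl b measurableT iE).
  rewrite -{1}[`|s|](Rintegral_cstT P) -RintegralD//; last exact: integrable_scale.
  apply: le_norm_Rintegral => //.
  by apply: integrable_add => //; exact: integrable_scale.
have lip (f : R -> R) (f' : R -> R) (x : R) : (forall y : R, is_derive y 1 f (f' y)) ->
    (forall y, `|f' y| <= 1) -> `|f x - f 0| <= `|x|.
  move=> df f1; have [x0|x0] := leP 0 x.
    have := @le_mean_value _ f f' 0 x 1 x0 (fun y _ => df y) (fun y _ => f1 y).
    by rewrite mul1r subr0 (ger0_norm x0).
  have := @le_mean_value _ f f' x 0 1 (ltW x0) (fun y _ => df y) (fun y _ => f1 y).
  by rewrite mul1r sub0r distrC (ltr0_norm x0).
rewrite char_funE; apply: le_trans (normc_le_ReIm _) _ => /=; rewrite oppr0 addr0.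
rewrite (_ : 2 * _ + _ = (`|s| + 2 * fine (P E)) + (`|s| + 1 * fine (P E))); last by rewrite /E; ring.
have is_ := integrable_sinM Y s; have ico := integrable_cosM Y s.
have sx w : ~ E w -> `|s * Y w| <= `|s|.
  move=> /negP; rewrite -ltNge => /ltW h.
  by rewrite normrM ler_piMr.
apply: lerD.
- rewrite -[X in _ - X](Rintegral_cstT P) -RintegralB//; apply: key => [|w].
    exact: integrable_sub.
  rewrite indicE; have [/set_mem Ew|/negP nEw] := boolP (w \in E).
    rewrite mulr1; have := cos_max (s * Y w); rewrite ler_norml => /andP[h1 h2].
    rewrite ler_norml; have := normr_ge0 s; lra.
  rewrite mulr0 addr0; apply: le_trans (sx w _); last by move=> /mem_set.
  rewrite -cos0; apply: (lip (@cos R) (fun y => - sin y)).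
  by move=> y; rewrite normrN sin_max.
- apply: key => // w.
  rewrite indicE; have [/set_mem Ew|/negP nEw] := boolP (w \in E).
    by rewrite mulr1 (le_trans (sin_max _))// lerDr.
  rewrite mulr0 addr0; apply: le_trans (sx w _); last by move=> /mem_set.
  rewrite -[X in `|X|]subr0 -[X in _ - X]sin0; apply: (lip (@sin R) (@cos R)).
  by move=> y; exact: cos_max.
Qed.

(** Stochastic continuity at 0 only controls short times. A time in [[0, 1]] is [m / N + r'] with
    [m <= N] and [r'] short; the [m] factors at time [1 / N] are each within [e / (2 N)] of 1 for
    small [s], by continuity of one characteristic function. *)
Lemma levy_char_fun_unif (e : R) : 0 < e -> exists2 delta : R, 0 < delta &
  forall r s, 0 <= r <= 1 -> `|s| <= delta -> normc (v r s - 1) <= e.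
Proof.
move=> e0.
have [d1 d10 hd1] : exists2 d1 : R, 0 < d1 & forall r, 0 <= r < d1 ->
    fine (P [set w | 1 <= `|X r w|]) <= e / 12.
  have h := @levy_stochastic_continuity _ _ _ _ _ hX 0 1 (lexx 0) ltr01.
  move/fine_cvg/cvgrPdist_lt: h => /(_ (e / 12)).
  rewrite divr_gt0// => /(_ isT)[d1 /= d10 hd1].
  exists d1 => // r /andP[r0 rd].
  have := hd1 r; rewrite /= sub0r normrN (ger0_norm r0) => /(_ rd r0).
  rewrite sub0r normrN => /ltW; apply: le_trans; rewrite (le_trans _ (ler_norm _))//.
  have := levy_incr_dist (lexx 0) r0 measurable_norm_ge1; rewrite subr0.
  by rewrite /preimage /= => <-.
pose N := (Num.trunc d1^-1).+1.
have N0 : 0 < N%:R :> R by [].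
have Nd : N%:R^-1 < d1 by rewrite invf_plt ?posrE//; exact: truncnS_gt.
have [d2 /= d20 hd2] : \forall s \near (0 : R), normc (v N%:R^-1 s - 1) <= e / 2 / N%:R.
  exact: char_fun_near0 (divr_gt0 (divr_gt0 e0 _) N0).
(* With [|s| <= e / 8] and probability at most [e / 12], the bound [2 |s| + 3 P] of
   [normc_char_funB1] is [e / 2]. *)
exists (Num.min (d2 / 2) (e / 8)); first by rewrite lt_min !divr_gt0.
move=> r s /andP[r0 r1]; rewrite le_min => /andP[s2 s8].
have {}hd2 : normc (v N%:R^-1 s - 1) <= e / 2 / N%:R.
  by apply: hd2 => /=; rewrite sub0r normrN; lra.
pose m := Num.trunc (r * N%:R).
have rN0 : 0 <= r * N%:R by rewrite mulr_ge0.
have /andP[m1 m2] := truncn_itv rN0; rewrite -/m in m1 m2.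
have mN : (m <= N)%N.
  by rewrite -(ler_nat R) (le_trans m1)// ler_piMl.
pose r' := r - m%:R / N%:R.
have r'0 : 0 <= r' by rewrite subr_ge0 ler_pdivrMr.
have r'1 : r' < d1.
  by apply: lt_trans Nd; rewrite ltrBlDr -{1}[N%:R^-1]mul1r -mulrDl nat1r ltr_pdivlMr.
rewrite (_ : r = m%:R * N%:R^-1 + r'); last by rewrite /r' addrC subrK.
rewrite levy_char_funD ?mulr_ge0// ?invr_ge0// levy_char_fun_mulrn ?invr_ge0//.
have powB1 (z : R[i]) n : normc z <= 1 -> normc (z ^+ n - 1) <= n%:R * normc (z - 1).
  move=> z1; elim: n => [|n IH]; first by rewrite expr0 subrr Normc.normc0 mul0r.
  rewrite (_ : z ^+ n.+1 - 1 = z ^+ n * (z - 1) + (z ^+ n - 1)); last by rewrite exprSr; ring.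
  apply: le_trans (le_normcD _ _) _; rewrite -natr1 mulrDl mul1r addrC lerD//.
  by rewrite Normc.normcM ler_piMl ?normc_ge0// normcX exprn_ile1 ?normc_ge0.
rewrite (_ : _ * _ - 1 = v N%:R^-1 s ^+ m * (v r' s - 1) + (v N%:R^-1 s ^+ m - 1)); last by ring.
apply: le_trans (le_normcD _ _) _; rewrite (_ : e = e / 2 + e / 2); last by lra.
apply: lerD.
  rewrite Normc.normcM; apply: (@le_trans _ _ (normc (v r' s - 1))).
    by rewrite ler_piMl ?normc_ge0// normcX exprn_ile1 ?normc_ge0// normc_char_fun_le1.
  apply: le_trans (normc_char_funB1 _ _) _.
  by have := hd1 r'; rewrite r'0 r'1 => /(_ isT); lra.
apply: le_trans (powB1 _ _ (normc_char_fun_le1 _ _)) _.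
apply: (@le_trans _ _ (N%:R * normc (v N%:R^-1 s - 1))).
  by rewrite ler_wpM2r ?normc_ge0// ler_nat.
by rewrite mulrC -ler_pdivlMr.
Qed.

End LevySemigroup.

(* [|w ^+ 2 - 1| >= 3 / 2 * |w - 1|] when [|w - 1| <= 1 / 2], so a value
   [w t <> 1] would leave this disc under repeated doubling of [t]. *)
Lemma unit_of_bounded_powers (R : realType) (w : R -> R[i]) :
  (forall t u, 0 <= t -> 0 <= u -> w (t + u) = w t * w u) ->
  (forall t, 0 <= t -> normc (w t - 1) <= 2^-1) ->
  forall t, 0 <= t -> w t = 1.
Proof.
move=> wD w1.
have h n : forall t, 0 <= t -> (1 + n%:R / 2) * normc (w t - 1) <= 2^-1.
  elim: n => [|n IH] t t0; first by rewrite mul0r addr0 mul1r w1.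
  have := IH (t + t) (addr_ge0 t0 t0); rewrite wD//.
  have -> : w t * w t - 1 = (w t - 1) * (2 + (w t - 1)) by ring.
  rewrite Normc.normcM.
  have : 2 - normc (w t - 1) <= normc (2 + (w t - 1)).
    rewrite lerBlDr; apply: le_trans (normcB _ _).
    rewrite (_ : 2 + _ - _ = (2%:R : R)%:C%C); last by rewrite rmorph_nat addrK.
    by rewrite normcR ger0_norm.
  have := w1 t t0; have := normc_ge0 (w t - 1).
  rewrite -(natr1 n); have : 0 <= n%:R :> R by [].
  move: (n%:R) (normc (w t - 1)) (normc (2 + (w t - 1))) => m x y m0 x0 x1 xy hh.
  have : (1 + m / 2) * (x * (3 / 2)) <= 2^-1.
    apply: le_trans hh; rewrite ler_wpM2l//; first by lra.
    by rewrite ler_wpM2l//; lra.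
  by apply: le_trans; nra.
move=> t t0; apply/eqP; rewrite -subr_eq0; apply/eqP; apply: Normc.eq0_normc.
apply/eqP; rewrite eq_le normc_ge0 andbT leNgt; apply/negP => x0.
set x := normc (w t - 1) in x0.
have := h (Num.trunc x^-1).+1 t t0; rewrite -/x.
have := truncnS_gt x^-1; rewrite -(ltr_pM2r x0) mulVf ?gt_eqF//.
by move: ((Num.trunc x^-1).+1%:R) => m; lra.
Qed.

Section LevyLog.
Context d (T : measurableType d) (R : realType) (P : probability T R).
Variable X : R -> {RV P >-> R}.
Hypothesis hX : levy_process X.
Local Notation v t s := (char_fun P (X t) s).

(** The quotient [w r = v_r exp (- r L)] is multiplicative and equals 1 at time 1, so it has period
    1. Its closeness to 1 on [[0, 1]] therefore extends to all times, which is what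
    [unit_of_bounded_powers] requires. *)
Lemma levy_char_fun_exp (L : R -> R[i]) :
  (\forall s \near (0 : R), cexp (L s) = v 1 s) ->
  (forall e : R, 0 < e -> \forall s \near (0 : R), normc (L s) <= e) ->
  exists2 delta : R, 0 < delta &
    forall s t, `|s| <= delta -> 0 <= t -> v t s = cexp (t%:C%C * L s).
Proof.
move=> hL L0.
(* With [|v - 1| <= 1 / 8] and [|L s| <= 1 / 16], the bound on [w r - 1] below is
   [2 / 8 + 2 * (1 / 16) * 2 = 1 / 2]. *)
have [d1 d10 h1] := @levy_char_fun_unif _ _ _ _ _ hX (8^-1) ltac:(by rewrite invr_gt0).
have [d2 /= d20 h2] : \forall s \near (0 : R), cexp (L s) = v 1 s /\ normc (L s) <= 16^-1.
  by near=> s; split; near: s => //; apply: L0; rewrite invr_gt0.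
exists (Num.min d1 (d2 / 2)); first by rewrite lt_min d10 divr_gt0.
move=> s t; rewrite le_min => /andP[sd1 sd2] t0.
have [Ls Lb] : cexp (L s) = v 1 s /\ normc (L s) <= 16^-1.
  apply: h2 => /=; rewrite sub0r normrN; apply: le_lt_trans sd2 _; lra.
pose w r := v r s * cexp (- (r%:C%C * L s)).
have wD r u : 0 <= r -> 0 <= u -> w (r + u) = w r * w u.
  move=> r0 u0; rewrite /w levy_char_funD// rmorphD mulrDl opprD cexpD.
  by rewrite mulrACA.
have w1 : w 1 = 1 by rewrite /w -Ls -cexpD mul1r subrr cexp0.
have wn n r : 0 <= r -> w (n%:R + r) = w r.
  move=> r0; elim: n => [|n IH]; first by rewrite add0r.
  by rewrite -natr1 (addrC n%:R) -addrA wD ?addr_ge0// w1 mul1r.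
have wle r : 0 <= r <= 1 -> normc (w r - 1) <= 2^-1.
  move=> r01; set z := - (r%:C%C * L s).
  have zb : normc z <= 16^-1.
    rewrite normcN Normc.normcM normcR; apply: le_trans Lb.
    by move: r01 => /andP[r0 r1]; rewrite ger0_norm// ler_piMl ?normc_ge0.
  have ez : expR (normc z) <= 2.
    have h := expR_ge1Dx (- normc z).
    rewrite -[leLHS]invrK -expRN invf_ple ?posrE ?expR_gt0//; lra.
  have -> : w r - 1 = (v r s - 1) * cexp z + (cexp z - 1).
    by rewrite /w; ring.
  apply: le_trans (le_normcD _ _) _; rewrite Normc.normcM.
  have hv := h1 r s r01 sd1.
  have hz1 : normc (cexp z) <= 2.
    by rewrite normc_cexp (le_trans _ ez)// ler_expR (le_trans (ler_norm _))// Re_le_normc.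
  have hz2 : normc (cexp z - 1) <= 4^-1.
    have := cexp_taylor 1 z; rewrite /cexp_trunc big_ord1 expr0 fact0 invr1 mulr1 expr1.
    move=> /le_trans; apply.
    have := normc_ge0 z; have := expR_ge0 (normc z).
    move: (normc z) (expR _) zb ez => a b; nra.
  have := normc_ge0 (cexp z); have := normc_ge0 (v r s - 1).
  move: (normc (cexp z)) (normc _) (normc _) hv hz1 hz2 => a b c; nra.
have hw : w t = 1.
  apply: (unit_of_bounded_powers wD) => // r r0.
  have /andP[n1 n2] := truncn_itv r0.
  have -> : w r = w (r - (Num.trunc r)%:R).
    by rewrite -[in LHS](subrK (Num.trunc r)%:R r) addrC wn ?subr_ge0.
  apply: wle.
  by rewrite subr_ge0 n1/= lerBlDr nat1r; exact: ltW.
have : w t * cexp (t%:C%C * L s) = cexp (t%:C%C * L s) by rewrite hw mul1r.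
by rewrite /w -mulrA -cexpD addNr cexp0 mulr1.
Unshelve. all: by end_near.
Qed.

End LevyLog.

Section UnderIntegral.
Context d (T : measurableType d) (R : realType) (mu : {measure set T -> \bar R}).
Variable D : set T.
Hypothesis mD : measurable D.

Lemma is_derive_under_integral (f f' : R -> T -> R) (G : T -> R) (a : R) :
  (forall (x : R) w, D w -> is_derive x 1 (f ^~ w) (f' x w)) ->
  (forall x, mu.-integrable D (EFin \o f x)) ->
  (forall w, 0 <= G w) ->
  mu.-integrable D (EFin \o G) ->
  (forall (x : R) w, D w -> `|f' x w| <= G w) ->
  is_derive a 1 (fun x => \int[mu]_(w in D) f x w) (\int[mu]_(w in D) f' a w).
Proof.
move=> df fi G0 Gi f'G.
have Ia : (`]a - 1, a + 1[)%classic a.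
  by rewrite /= in_itv/=; apply/andP; split; lra.
have dE x w : D w -> partial1of2 f x w = f' x w.
  by move=> Dw; rewrite partial1of2E; have [_ ->] := df x w Dw.
have h1 x w : (`]a - 1, a + 1[)%classic x -> D w -> derivable (f ^~ w) x 1.
  by move=> _ Dw; have [] := df x w Dw.
have h2 x w : (`]a - 1, a + 1[)%classic x -> D w -> `|partial1of2 f x w| <= G w.
  by move=> _ Dw; rewrite dE// f'G.
have fi' x : (`]a - 1, a + 1[)%classic x -> mu.-integrable D (EFin \o f x) by [].
apply: DeriveDef.
  exact: (derivable_under_integral mD Ia fi' h1 G0 Gi h2).
rewrite -derive1E (differentiation_under_integral mD Ia fi' h1 G0 Gi h2).
by apply: eq_Rintegral => w /set_mem Dw; rewrite dE.
Qed.

End UnderIntegral.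

(** * Taylor expansion at 0 of the logarithm of a characteristic function *)

Section SmoothAtZero.
Context {R : realType}.
Implicit Types f g : R -> R.

(** The last derivative is only asked to be continuous at 0: this is just enough for a Taylor
    formula with Peano remainder, and it is preserved by the operations that build the logarithm.
    Carrying the derivative as a witness [g] lets every proof go by induction on [n]. *)
Fixpoint smooth0 (n : nat) f : Prop :=
  if n is n'.+1 then
    exists2 g : R -> R, (\forall s \near (0 : R), is_derive (s : R) 1 f (g s)) & smooth0 n' g
  else {for (0 : R), continuous f}.

Lemma smooth0_cont n f : smooth0 n f -> {for (0 : R), continuous f}.
Proof.
case: n => // n [g /nbhs_singleton dg _].
by apply/differentiable_continuous/derivable1_diffP; have [] := dg.
Qed.

Lemma smooth0W n f : smooth0 n.+1 f -> smooth0 n f.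
Proof.
elim: n f => [|n IH] f; first exact: (@smooth0_cont 1).
by move=> [g dg sg]; exists g => //; exact: IH.
Qed.

Lemma near0_eqP f g : (\forall s \near (0 : R), f s = g s) ->
  \forall s \near (0 : R), \forall x \near s, f x = g x.
Proof. exact: near_join. Qed.

Lemma is_derive_near_eq f g (s a : R) : (\forall x \near s, f x = g x) ->
  is_derive (s : R) 1 f a -> is_derive (s : R) 1 g a.
Proof. by move=> fg; apply: near_eq_is_derive; rewrite ?oner_neq0. Qed.

Lemma near0_derive1 f g : (\forall s \near (0 : R), f s = g s) ->
  \forall s \near (0 : R), derive1 f s = derive1 g s.
Proof.
move/near0_eqP; apply: filterS => s fg; rewrite !derive1E.
by apply: near_eq_derive; rewrite ?oner_neq0.
Qed.

Lemma near0_derive1n n f g : (\forall s \near (0 : R), f s = g s) ->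
  \forall s \near (0 : R), derive1n n f s = derive1n n g s.
Proof. by elim: n => // n IH /IH; rewrite !derive1nS; exact: near0_derive1. Qed.

Lemma derive1n_near0 n f g : (\forall s \near (0 : R), f s = g s) ->
  derive1n n f 0 = derive1n n g 0.
Proof. by move/(near0_derive1n n)/nbhs_singleton. Qed.

Lemma derive1n_smoothS n f g : (\forall s \near (0 : R), is_derive (s : R) 1 f (g s)) ->
  derive1n n.+1 f 0 = derive1n n g 0.
Proof.
move=> dg; rewrite derive1Sn; apply: derive1n_near0.
by apply: filterS dg => s [_ <-]; rewrite derive1E.
Qed.

Lemma smooth0_cst n (c : R) : smooth0 n (fun=> c).
Proof.
elim: n c => [|n IH] c /=; first exact: cst_continuous.
exists (fun=> 0); last exact: IH.
by apply: (@filterE _ (nbhs (0 : R))) => s; exact: is_derive_cst.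
Qed.

Lemma smooth0D n f g : smooth0 n f -> smooth0 n g -> smooth0 n (fun s => f s + g s).
Proof.
elim: n f g => [|n IH] f g /=; first exact: continuousD.
move=> [f' df sf] [g' dg sg]; exists (fun s => f' s + g' s); last exact: IH.
by apply: filterS2 df dg => s; exact: is_derive_add.
Qed.

Lemma smooth0M n f g : smooth0 n f -> smooth0 n g -> smooth0 n (fun s => f s * g s).
Proof.
elim: n f g => [|n IH] f g; first exact: continuousM.
move=> Sf Sg; have Sf1 := smooth0W Sf; have Sg1 := smooth0W Sg.
move: Sf Sg => [f' df sf] [g' dg sg].
exists (fun s => f' s * g s + f s * g' s); last by apply: smooth0D; exact: IH.
by apply: filterS2 df dg => s; exact: is_derive_mul.
Qed.

Lemma smooth0Z n c f : smooth0 n f -> smooth0 n (fun s => c * f s).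
Proof. by move=> sf; apply: smooth0M sf; exact: smooth0_cst. Qed.

Lemma near0_neq0 n f : smooth0 n f -> f 0 != 0 -> \forall s \near (0 : R), f s != 0.
Proof. by move=> /smooth0_cont cf f0; exact: (cvgr_neq0 _ cf f0). Qed.

Lemma smooth0V n f : smooth0 n f -> f 0 != 0 -> smooth0 n (fun s => (f s)^-1).
Proof.
move=> + f0; elim: n => [|n IH] Sf; first exact: continuousV.
have f1 := near0_neq0 Sf f0; have Sf1 := IH (smooth0W Sf).
move: Sf => [f' df sf].
exists (fun s => - 1 * f' s * ((f s)^-1 * (f s)^-1)).
  by apply: filterS2 df f1 => s ? ?; rewrite mulN1r; exact: is_derive_inv.
apply: smooth0M; first exact: smooth0Z.
exact: smooth0M.
Qed.

Lemma smooth0_ln n f : smooth0 n f -> 0 < f 0 -> smooth0 n (fun s => ln (f s)).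
Proof.
move=> + f0; case: n => [|n] Sf.
  by apply: (@continuous_comp _ _ _ f (@ln R)) => //; exact: continuous_ln.
have f1 : \forall s \near (0 : R), 0 < f s.
  by have cf := smooth0_cont Sf; exact: (cvgr_gt _ cf _ f0).
have S1 := smooth0V (smooth0W Sf) (lt0r_neq0 f0).
move: Sf => [f' df sf]; exists (fun s => (f s)^-1 * f' s); last exact: smooth0M.
apply: filterS2 df f1 => s dfs fs0.
by apply: is_derive_chain dfs; exact: is_derive1_ln.
Qed.

Lemma smooth0_atan n f : smooth0 n f -> smooth0 n (fun s => atan (f s)).
Proof.
case: n => [|n] Sf.
  by apply: (@continuous_comp _ _ _ f (@atan R)) => //; exact: continuous_atan.
have S0 : smooth0 n f by exact: smooth0W.
have S1 : smooth0 n (fun s => (1 + f s * f s)^-1).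
  apply: smooth0V; first by apply: smooth0D; [exact: smooth0_cst|exact: smooth0M].
  by rewrite gt_eqF// ltr_pwDl// -expr2 sqr_ge0.
move: Sf => [f' df sf]; exists (fun s => (1 + f s * f s)^-1 * f' s); last exact: smooth0M.
apply: filterS df => s dfs; rewrite -expr2.
by apply: is_derive_chain dfs; exact: is_derive1_atan.
Qed.

Lemma derive1nZ0 n j c f : smooth0 n f -> (j <= n)%N ->
  derive1n j (fun s => c * f s) 0 = c * derive1n j f 0.
Proof.
elim: n j f => [|n IH] [|j] f // [g dg sg] jn.
rewrite (derive1n_smoothS j dg) -IH//; apply: derive1n_smoothS.
by apply: filterS dg => s; exact: is_derive_cmul.
Qed.

(* With [e = 1] or [- 1]: real parts of characteristic functions are even,
   imaginary parts odd, which makes the cumulants real. *)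
Lemma derive1n_parity n j (e : R) f : smooth0 n f -> (j <= n)%N ->
  (\forall s \near (0 : R), f (- s) = e * f s) ->
  derive1n j f 0 = e * (-1) ^+ j * derive1n j f 0.
Proof.
elim: n j e f => [|n IH] [|j] e f// Sf jn fe.
- by have := nbhs_singleton fe; rewrite oppr0 expr0 mulr1.
- by have := nbhs_singleton fe; rewrite oppr0 expr0 mulr1.
case: Sf => g dg sg; rewrite (derive1n_smoothS j dg) exprS mulrA.
rewrite (_ : e * -1 = - e); last by rewrite mulrN1.
apply: (IH j (- e) g) => //.
have dgN : \forall s \near (0 : R), is_derive (- s : R) 1 f (g (- s)).
  case: dg => r r0 h; exists r => // s /=; rewrite sub0r normrN => sr.
  by apply: h; rewrite /= sub0r opprK.
have := near0_eqP fe; apply: filterS3 dg dgN => s dgs dgNs fes.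
have h1 : is_derive (s : R) 1 (fun x => f (- x)) (g (- s) * -1).
  by apply: (is_derive_chain dgNs); apply: is_derive_opp; exact: is_derive_id.
have h2 : is_derive (s : R) 1 (fun x => f (- x)) (e * g s).
  apply: is_derive_near_eq (is_derive_cmul e dgs).
  by apply: filterS fes => x.
case: h1 => _ E1; case: h2 => _ E2; move/eqP: (etrans (esym E1) E2).
by rewrite mulrN1 eqr_oppLR => /eqP ->; rewrite mulNr.
Qed.

Definition taylor0 (n : nat) f (s : R) := \sum_(j < n.+1) derive1n j f 0 / j`!%:R * s ^+ j.

Lemma is_derive_bigsum n (F : nat -> R -> R) (s : R) (l : nat -> R) :
  (forall j, is_derive (s : R) 1 (F j) (l j)) ->
  is_derive (s : R) 1 (fun x => \sum_(j < n) F j x) (\sum_(j < n) l j).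
Proof.
move=> dF; elim: n => [|n IH].
  rewrite big_ord0; under eq_fun do rewrite big_ord0; exact: is_derive_cst.
rewrite big_ord_recr /=; under eq_fun do rewrite big_ord_recr /=.
exact: is_derive_add.
Qed.

Lemma is_derive_taylor0 n f g (s : R) : (\forall s \near (0 : R), is_derive (s : R) 1 f (g s)) ->
  is_derive (s : R) 1 (taylor0 n.+1 f) (taylor0 n g s).
Proof.
move=> dg; rewrite /taylor0.
have : is_derive (s : R) 1 (fun x => \sum_(j < n.+2) derive1n j f 0 / j`!%:R * x ^+ j)
   (\sum_(j < n.+2) derive1n j f 0 / j`!%:R * (j%:R * s ^+ j.-1)).
  apply: (@is_derive_bigsum n.+2 (fun j x => derive1n j f 0 / j`!%:R * x ^+ j)
    s (fun j => derive1n j f 0 / j`!%:R * (j%:R * s ^+ j.-1))) => j.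
  by apply: is_derive_cmul; exact: is_derive_pow.
rewrite [X in is_derive _ _ _ X -> _]big_ord_recl.
rewrite (_ : ((ord0 : 'I_n.+2) : nat)%:R = 0 :> R)// mul0r mulr0 add0r.
congr (is_derive _ _ _ _); apply: eq_bigr => j _.
rewrite lift0 (derive1n_smoothS j dg) factS natrM invfM succnK.
have h : (j.+1%:R : R) != 0 by rewrite pnatr_eq0.
have h' : (j`!%:R : R) != 0 by rewrite pnatr_eq0 -lt0n fact_gt0.
by move: (j.+1%:R : R) h (j`!%:R : R) h' => a a0 b b0; field; rewrite a0 b0.
Qed.

(** The remainder of [f] has the remainder of its derivative as derivative, so the mean value
    inequality on the segment between 0 and [s] gains one factor [|s|] per induction step.
    Continuity at 0 starts the induction. *)
Lemma taylor0_peano n f (e : R) : smooth0 n f -> 0 < e ->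
  \forall s \near (0 : R), `|f s - taylor0 n f s| <= e * `|s| ^+ n.
Proof.
move=> + e0; elim: n f => [|n IH] f.
  move=> cf; move/cvgrPdist_le: (cf) => /(_ _ e0); apply: filterS => s.
  rewrite /taylor0 big_ord1 expr0 fact0 divr1 !mulr1 distrC.
  by rewrite derive1n0.
move=> [g dg sg]; have [d1 /= d10 h1] := IH g sg.
case: (dg) => d2 /= d20 h2.
exists (Num.min d1 d2) => /=; first by rewrite lt_min d10.
move=> s; rewrite /= sub0r normrN lt_min => /andP[s1 s2].
pose h x := f x - taylor0 n.+1 f x.
have h0 : h 0 = 0.
  rewrite /h /taylor0 big_ord_recl expr0 fact0 divr1 mulr1 derive1n0.
  rewrite big1 ?addr0 ?subrr// => i _.
  by rewrite exprS mul0r mulr0.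
have dh (x : R) : `|x| <= `|s| -> is_derive x 1 h (g x - taylor0 n g x).
  move=> xs; apply: is_derive_sub; last exact: is_derive_taylor0.
  by apply: h2 => /=; rewrite sub0r normrN; exact: le_lt_trans s2.
have hB (x : R) : `|x| <= `|s| -> `|g x - taylor0 n g x| <= e * `|s| ^+ n.
  move=> xs; apply: le_trans (h1 x _) _.
    by rewrite /= sub0r normrN; exact: le_lt_trans s1.
  by rewrite ler_wpM2l ?(ltW e0)// lerXn2r ?nnegrE.
have [s0|s0] := leP 0 s.
  have nx x : 0 <= x <= s -> `|x| <= `|s|.
    by move=> /andP[x0 xs]; rewrite !ger0_norm.
  have := le_mean_value s0 (fun x hx => dh x (nx x hx)) (fun x hx => hB x (nx x hx)).
  by rewrite h0 !subr0 exprSr mulrA (ger0_norm s0).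
have nx x : s <= x <= 0 -> `|x| <= `|s|.
  by move=> /andP[x0 xs]; rewrite !ler0_norm ?lerN2// ltW.
have := le_mean_value (ltW s0) (fun x hx => dh x (nx x hx)) (fun x hx => hB x (nx x hx)).
by rewrite h0 !sub0r normrN exprSr mulrA (ltr0_norm s0).
Qed.

End SmoothAtZero.

Section Moments.
Context d (T : measurableType d) (R : realType) (P : probability T R).
Variables (Y : {RV P >-> R}) (k : nat).
Hypothesis Yk : L1 P (fun w => `|Y w| ^+ k).

Lemma integrable_moment_le j (f : R -> R) : (j <= k)%N -> measurable_fun setT f ->
  (forall x, `|f x| <= 1) ->
  L1 P (fun w => Y w ^+ j * f (Y w)).
Proof.
move=> jk mf f1.
have i1 := integrable_cstT P 1.
apply: (integrable_dominated measurableT _ _ (integrable_add measurableT i1 Yk)).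
  by apply: measurable_funM; [exact: measurable_funX|exact: measurableT_comp].
move=> w _; rewrite normrM normrX.
apply: (@le_trans _ _ (`|Y w| ^+ j)); first by rewrite ler_piMr ?exprn_ge0.
have [Y1|Y1] := leP `|Y w| 1.
  by apply: (@le_trans _ _ 1); [exact: exprn_ile1|rewrite lerDl exprn_ge0].
by apply: (@le_trans _ _ (`|Y w| ^+ k)); [rewrite ler_weXn2l// ltW|rewrite lerDr].
Qed.

Lemma integrable_abs_moment_le j : (j <= k)%N ->
  L1 P (fun w => `|Y w| ^+ j).
Proof.
move=> jk; have := integrable_moment_le jk (@measurable_cst _ _ _ _ setT (1 : R)).
move=> /(_ (fun=> _)) h.
have /integrable_norm : L1 P (fun w => Y w ^+ j * cst 1 (Y w)).
  by apply: h => x; rewrite normr1.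
by under [X in P.-integrable _ X -> _]eq_fun do rewrite /= mulr1 normrX.
Qed.

Definition cos_moment j (s : R) := \int[P]_w (Y w ^+ j * cos (s * Y w)).
Definition sin_moment j (s : R) := \int[P]_w (Y w ^+ j * sin (s * Y w)).

Lemma is_derive_trig_moment j (s : R) : (j < k)%N ->
  is_derive (s : R) 1 (cos_moment j) (- sin_moment j.+1 s) /\
  is_derive (s : R) 1 (sin_moment j) (cos_moment j.+1 s).
Proof.
move=> jk; have Gi := integrable_abs_moment_le jk.
have cb (x : R) : `|cos x| <= 1 := cos_max x.
have sb (x : R) : `|sin x| <= 1 := sin_max x.
have ic i x : (i <= k)%N -> L1 P (fun w => Y w ^+ i * cos (x * Y w)).
  by move=> ik; exact: (@integrable_moment_le i (fun y => cos (x * y)) ik (measurable_cosM x)).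
have is_ i x : (i <= k)%N -> L1 P (fun w => Y w ^+ i * sin (x * Y w)).
  by move=> ik; exact: (@integrable_moment_le i (fun y => sin (x * y)) ik (measurable_sinM x)).
have dl (x : R) w : is_derive (x : R) 1 (fun x : R => x * Y w) (Y w).
  have := is_derive_cmul (Y w) (is_derive_id x 1).
  by under eq_fun do rewrite mulrC; rewrite mulr1.
split.
- have -> : - sin_moment j.+1 s = \int[P]_w (- (Y w ^+ j.+1 * sin (s * Y w))).
    rewrite /sin_moment -mulN1r -RintegralZl//; last exact: is_.
    by apply: eq_Rintegral => w _; rewrite mulN1r.
  apply: (@is_derive_under_integral _ _ _ P setT measurableT _
    (fun x w => - (Y w ^+ j.+1 * sin (x * Y w))) (fun w => `|Y w| ^+ j.+1)) => //.
  + move=> x w _; have := is_derive_cmul (Y w ^+ j) (@is_derive_chain _ (@cos R) (fun x => x * Y w) x _ _ (is_derive_cos (x * Y w)) (dl x w)).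
    by move/is_derive_eq; apply; rewrite exprSr; ring.
  + by move=> x; apply: ic; exact: ltnW.
  + by move=> x w _; rewrite normrN normrM normrX ler_piMr ?exprn_ge0.
- apply: (@is_derive_under_integral _ _ _ P setT measurableT _
    (fun x w => Y w ^+ j.+1 * cos (x * Y w)) (fun w => `|Y w| ^+ j.+1)) => //.
  + move=> x w _; have := is_derive_cmul (Y w ^+ j) (@is_derive_chain _ (@sin R) (fun x => x * Y w) x _ _ (is_derive_sin (x * Y w)) (dl x w)).
    by move/is_derive_eq; apply; rewrite exprSr; ring.
  + by move=> x; apply: is_; exact: ltnW.
  + by move=> x w _; rewrite normrM normrX ler_piMr ?exprn_ge0.
Qed.

Lemma continuous_trig_moment j : (j <= k)%N ->
  continuous (cos_moment j) /\ continuous (sin_moment j).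
Proof.
move=> jk; have Gi := integrable_abs_moment_le jk.
have key (f : R -> R) : continuous f -> (forall x, `|f x| <= 1) ->
    continuous (fun s : R => \int[P]_w (Y w ^+ j * f (s * Y w))).
  move=> cf f1 s.
  apply: (@continuity_under_integral R _ T P (fun s w => Y w ^+ j * f (s * Y w)) setT
    measurableT (s - 1) (s + 1) _ _ (fun w => `|Y w| ^+ j) Gi).
  - move=> x _; apply: (@integrable_moment_le j (fun y => f (x * y))) => //.
    apply: continuous_measurable_fun => y.
    apply: (@continuous_comp _ _ _ (fun y : R => x * y) f); last exact: cf.
    exact: mulrl_continuous.
  - apply: aeW => w _ x _.
    apply: (@continuous_comp _ _ _ (fun x : R => f (x * Y w)) (fun z : R => Y w ^+ j * z));
      last exact: mulrl_continuous.
    apply: (@continuous_comp _ _ _ (fun x : R => x * Y w) f); last exact: cf.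
    exact: mulrr_continuous.
  - by move=> x _; apply: aeW => w _; rewrite normrM normrX ler_piMr ?exprn_ge0.
  - by rewrite inE /= in_itv/=; apply/andP; split; lra.
by split; apply: key; [exact: continuous_cos|exact: cos_max|exact: continuous_sin|exact: sin_max].
Qed.

Lemma smooth0_trig_moment n j : (j + n <= k)%N ->
  smooth0 n (cos_moment j) /\ smooth0 n (sin_moment j).
Proof.
elim: n j => [|n IH] j.
  by rewrite addn0 => /continuous_trig_moment[c1 c2]; split => /=; [exact: c1|exact: c2].
rewrite addnS -addSn => jn; have [c s] := IH _ jn.
have jk : (j < k)%N by apply: leq_trans jn; exact: leq_addr.
split.
- exists (fun s => - 1 * sin_moment j.+1 s); last exact: smooth0Z.
  apply: (@filterE _ (nbhs (0 : R))) => x; rewrite mulN1r.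
  by have [] := is_derive_trig_moment x jk.
- exists (cos_moment j.+1) => //.
  apply: (@filterE _ (nbhs (0 : R))) => x.
  by have [] := is_derive_trig_moment x jk.
Qed.

End Moments.

(** * The principal logarithm and the cumulants *)

Section LogBranch.
Context d (T : measurableType d) (R : realType) (P : probability T R).
Implicit Types (Y : {RV P >-> R}).

(* The principal logarithm on the half plane [Re z > 0]; junk elsewhere. *)
Definition plog (z : R[i]) : R[i] :=
  Complex (2^-1 * ln (cRe z * cRe z + cIm z * cIm z)) (atan (cIm z * (cRe z)^-1)).

Lemma Re_plog z : cRe (plog z) = 2^-1 * ln (cRe z * cRe z + cIm z * cIm z).
Proof. by []. Qed.

Lemma Im_plog z : cIm (plog z) = atan (cIm z * (cRe z)^-1).
Proof. by []. Qed.

Lemma plog1 : plog 1 = 0.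
Proof. by rewrite /plog /= mulr0 addr0 mulr1 ln1 mulr0 mul0r atan0. Qed.

Lemma cexp_plog (z : R[i]) : 0 < cRe z -> cexp (plog z) = z.
Proof.
case: z => a b /= a0; rewrite /cexp /plog /=.
have s0 : 0 < a * a + b * b by rewrite ltr_pwDl ?mulr_gt0// -expr2 sqr_ge0.
set r := Num.sqrt (a * a + b * b).
have r0 : 0 < r by rewrite sqrtr_gt0.
have -> : expR (2^-1 * ln (a * a + b * b)) = r.
  by rewrite /r -powR12_sqrt ?(ltW s0)// /powR gt_eqF.
have hc : cos (atan (b * a^-1)) = a / r.
  rewrite cos_atan -[X in X^-1]/(Num.sqrt _).
  have -> : 1 + (b * a^-1) ^+ 2 = (a * a + b * b) * (a^-1 * a^-1).
    by field; rewrite gt_eqF.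
  rewrite sqrtrM ?(ltW s0)// -expr2 sqrtr_sqr gtr0_norm ?invr_gt0// -/r invfM invrK.
  by rewrite mulrC.
have hs : sin (atan (b * a^-1)) = b / r.
  have := atanK (b * a^-1); rewrite /tan hc => h.
  rewrite (_ : sin _ = sin (atan (b * a^-1)) / (a / r) * (a / r)); last first.
    by rewrite divfK// gt_eqF// divr_gt0.
  by rewrite h; field; rewrite !gt_eqF.
rewrite hc hs; apply/eqP; rewrite eq_complex /=.
by rewrite !(mulrC r) !divfK ?eqxx ?gt_eqF.
Qed.

Lemma plog_cexp (z : R[i]) : `|cIm z| < pi / 2 -> plog (cexp z) = z.
Proof.
case: z => x y /=; rewrite ltr_norml => /andP[y1 y2]; rewrite /plog /cexp /=.
have c0 : 0 < cos y by apply: cos_gt0_pihalf; rewrite y1 y2.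
congr Complex.
  have -> : expR x * cos y * (expR x * cos y) + expR x * sin y * (expR x * sin y) =
      expR x * expR x * (cos y ^+ 2 + sin y ^+ 2) by ring.
  rewrite cos2Dsin2 mulr1 -expRD expRK; lra.
have -> : expR x * sin y * (expR x * cos y)^-1 = tan y.
  by rewrite /tan; field; rewrite !gt_eqF ?expR_gt0.
by rewrite tanK// in_itv/= y1 y2.
Qed.

Lemma plog_branch Y : is_log_branch (char_fun P Y) (fun s => plog (char_fun P Y s)).
Proof.
have [c1 c2] := continuous_char_fun Y.
split.
  by rewrite char_fun0 plog1.
have : \forall s \near (0 : R), 0 < cRe (char_fun P Y s).
  by apply: (cvgr_gt _ (c1 0)); rewrite char_fun0 /= ltr01.
apply: filterS => s s0.
have h0 : 0 < cRe (char_fun P Y s) * cRe (char_fun P Y s) +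
    cIm (char_fun P Y s) * cIm (char_fun P Y s).
  by rewrite ltr_pwDl ?mulr_gt0// -expr2 sqr_ge0.
split; last exact: cexp_plog.
- apply: continuousM; first exact: cst_continuous.
  apply: (@continuous_comp _ _ _ (fun s => cRe (char_fun P Y s) * cRe (char_fun P Y s) +
    cIm (char_fun P Y s) * cIm (char_fun P Y s)) (@ln R)).
    by apply: continuousD; apply: continuousM; [exact: c1|exact: c1|exact: c2|exact: c2].
  exact: continuous_ln.
- apply: (@continuous_comp _ _ _ (fun s => cIm (char_fun P Y s) *
    (cRe (char_fun P Y s))^-1) (@atan R)); last exact: continuous_atan.
  apply: continuousM; first exact: c2.
  by apply: continuousV; [rewrite gt_eqF|exact: c1].
Qed.

(** Continuity and [L 0 = 0] keep the imaginary part of [L] within [pi / 2] near 0, where [plog]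
    inverts [cexp]. So cumulants may be computed with any branch. *)
Lemma log_branch_plog (v L : R -> R[i]) : is_log_branch v L ->
  \forall s \near (0 : R), L s = plog (v s).
Proof.
move=> [L0 hL]; have [_ cI _] := nbhs_singleton hL.
have : \forall s \near (0 : R), `|cIm (L s)| < pi / 2.
  have p2 : 0 < pi / 2 :> R by rewrite divr_gt0 ?pi_gt0.
  move/cvgrPdist_lt: cI => /(_ _ p2); apply: filterS => s.
  by rewrite L0 /= sub0r normrN.
by apply: filterS2 hL => s [_ _ <-] hs; rewrite plog_cexp.
Qed.

(** [plog] witnesses that a branch exists, so [xget] does not fall back on its default. *)
Lemma log_char_funP Y : is_log_branch (char_fun P Y) (log_char_fun P Y).
Proof. exact: (@xgetI _ (fun=> 0) [set L | is_log_branch (char_fun P Y) L] _ (plog_branch Y)). Qed.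

Lemma log_char_fun_near Y L : is_log_branch (char_fun P Y) L ->
  \forall s \near (0 : R), log_char_fun P Y s = L s.
Proof.
move=> hL; have h1 := log_branch_plog hL; have h2 := log_branch_plog (log_char_funP Y).
by apply: filterS2 h1 h2 => s -> ->.
Qed.

Lemma cderive1n_near0 j (f g : R -> R[i]) : (\forall s \near (0 : R), f s = g s) ->
  cderive1n j f 0 = cderive1n j g 0.
Proof.
move=> fg; rewrite /cderive1n; congr Complex; apply: derive1n_near0;
  by apply: filterS fg => s ->.
Qed.

Lemma cumulant_branch Y L j : is_log_branch (char_fun P Y) L ->
  cumulant P Y j = cRe ((Complex 0 1 ^+ j)^-1 * cderive1n j L 0).
Proof.
by move=> /log_char_fun_near h; rewrite /cumulant (cderive1n_near0 j h).
Qed.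

End LogBranch.

Section CumulantExpansion.
Context d (T : measurableType d) (R : realType) (P : probability T R).
Variables (Y : {RV P >-> R}) (k : nat).
Hypothesis Yk : L1 P (fun w => `|Y w| ^+ k).
Local Notation v := (char_fun P Y).
Local Notation L := (fun s => plog (v s)).

Lemma smooth0_char_fun :
  smooth0 k (fun s => cRe (v s)) /\ smooth0 k (fun s => cIm (v s)).
Proof.
have [c s] := @smooth0_trig_moment _ _ _ _ _ _ Yk k 0 (leqnn k).
split.
  rewrite (_ : (fun s => _) = cos_moment Y 0)//; apply/funext => x.
  by rewrite char_funE /=; apply: eq_Rintegral => w _; rewrite expr0 mul1r.
rewrite (_ : (fun s => _) = sin_moment Y 0)//; apply/funext => x.
by rewrite char_funE /=; apply: eq_Rintegral => w _; rewrite expr0 mul1r.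
Qed.

Lemma smooth0_plog :
  smooth0 k (fun s => cRe (L s)) /\ smooth0 k (fun s => cIm (L s)).
Proof.
have [c s] := smooth0_char_fun; split.
  apply: smooth0Z; apply: smooth0_ln; last by rewrite char_fun0 /= mulr0 addr0 mulr1.
  by apply: smooth0D; exact: smooth0M.
apply: smooth0_atan; apply: smooth0M => //; apply: smooth0V => //.
by rewrite char_fun0 oner_neq0.
Qed.

Lemma char_funN s : cRe (v (- s)) = cRe (v s) /\ cIm (v (- s)) = - cIm (v s).
Proof.
rewrite !char_funE /=; split.
  by apply: eq_Rintegral => w _; rewrite mulNr cosN.
rewrite -[RHS]mulN1r; transitivity (\int[P]_w (-1 * sin (s * Y w))); last first.
  by rewrite (RintegralZl (-1) measurableT (integrable_sinM Y s)).
by apply: eq_Rintegral => w _; rewrite (mulNr s) sinN mulN1r.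
Qed.

(** The real part of [L] is even and its imaginary part odd, so at order [j] only the part matching
    the parity of [j] survives. Dividing by [i ^ j] leaves a real number, and the [Re] in [cumulant]
    loses nothing. *)
Lemma cderive1n_plog j : (j <= k)%N ->
  cderive1n j L 0 = Complex 0 1 ^+ j * (cumulant P Y j)%:C%C.
Proof.
move=> jk; have [S1 S2] := smooth0_plog.
have p1 : derive1n j (fun s => cRe (L s)) 0 = (-1) ^+ j * derive1n j (fun s => cRe (L s)) 0.
  rewrite -[X in X * _]mul1r; apply: (derive1n_parity S1 jk).
  apply: (@filterE _ (nbhs (0 : R))) => s.
  by have [h1 h2] := char_funN s; rewrite !Re_plog h1 h2 mulrNN mul1r.
have p2 : derive1n j (fun s => cIm (L s)) 0 = - (-1) ^+ j * derive1n j (fun s => cIm (L s)) 0.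
  rewrite -mulN1r; apply: (derive1n_parity S2 jk).
  apply: (@filterE _ (nbhs (0 : R))) => s.
  by have [h1 h2] := char_funN s; rewrite !Im_plog h1 h2 mulNr atanN mulN1r.
rewrite (cumulant_branch j (plog_branch Y)) /cderive1n.
move: (derive1n j (fun s => cRe (L s)) 0) (derive1n j (fun s => cIm (L s)) 0) p1 p2.
move=> x y p1 p2.
have i2m m : (Complex 0 1 : R[i]) ^+ m.*2 = ((-1) ^+ m : R)%:C%C.
  by rewrite -mul2n exprM sqr_i rmorphXn rmorphN1.
have ee m : (-1) ^+ m * (-1) ^+ m = 1 :> R by rewrite -expr2 sqrr_sign.
have ij0 : (Complex 0 1 : R[i]) ^+ j != 0.
  by rewrite expf_neq0// eq_complex /= oner_eq0 andbF.
have [z hz] : exists z : R, (Complex 0 1 ^+ j)^-1 * Complex x y = z%:C%C.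
  have := odd_double_half j; move: (j./2) => h; case: (odd j) => jE.
    exists ((-1) ^+ h * y).
    have x0 : x = 0.
      move: p1; rewrite -jE add1n exprS -mul2n exprM sqrrN !expr1n mulr1 mulN1r; lra.
    rewrite x0; apply: (mulfI ij0); rewrite mulVKf//.
    rewrite -jE add1n exprS i2m; have := ee h; move: ((-1) ^+ h) => f ff.
    apply/eqP; rewrite eq_complex /=; apply/andP; split; apply/eqP; first by ring.
    by transitivity (f * f * y); [rewrite ff mul1r|ring].
  exists ((-1) ^+ h * x).
  have y0 : y = 0.
    by move: p2; rewrite -jE add0n -mul2n exprM sqrrN !expr1n mulN1r; lra.
  rewrite y0; apply: (mulfI ij0); rewrite mulVKf//.
  rewrite -jE add0n i2m; have := ee h; move: ((-1) ^+ h) => f ff.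
  apply/eqP; rewrite eq_complex /=; apply/andP; split; apply/eqP; last by ring.
  by transitivity (f * f * x); [rewrite ff mul1r|ring].
by rewrite hz /= -hz mulVKf.
Qed.

Lemma plog_taylor (e : R) : 0 < e -> \forall s \near (0 : R),
  normc (L s - \sum_(j < k.+1) (j`!%:R)^-1 *
     ((cumulant P Y j)%:C%C * (Complex 0 1 * s%:C%C) ^+ j)) <= e * `|s| ^+ k.
Proof.
move=> e0; have e2 : 0 < e / 2 by rewrite divr_gt0.
have [S1 S2] := smooth0_plog.
apply: filterS2 (taylor0_peano S1 e2) (taylor0_peano S2 e2) => s h1 h2.
rewrite (_ : \sum_(j < k.+1) _ = Complex (taylor0 k (fun s => cRe (L s)) s)
   (taylor0 k (fun s => cIm (L s)) s)).
  apply: le_trans (normc_le_ReIm _) _; rewrite [X in X * _](_ : e = e / 2 + e / 2); last by lra.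
  by rewrite mulrDl; apply: lerD; rewrite raddfB.
rewrite (_ : Complex (taylor0 _ _ _) _ = \sum_(j < k.+1) Complex (derive1n j (fun s => cRe (L s)) 0 / j`!%:R * s ^+ j)
   (derive1n j (fun s => cIm (L s)) 0 / j`!%:R * s ^+ j)); last first.
  by apply/eqP; rewrite eq_complex !raddf_sum !eqxx.
apply: eq_bigr => j _; rewrite exprMn [LHS]mulrC -!mulrA [LHS]mulrA (mulrC _ (Complex 0 1 ^+ j)).
rewrite -cderive1n_plog; last by rewrite -ltnS.
rewrite -rmorphXn (_ : (j`!%:R : R[i])^-1 = (j`!%:R^-1 : R)%:C%C); last by rewrite fmorphV rmorph_nat.
by apply/eqP; rewrite eq_complex /cderive1n /=; apply/andP; split; apply/eqP; ring.
Qed.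

Lemma cumulant0 : cumulant P Y 0 = 0.
Proof.
rewrite (cumulant_branch 0 (plog_branch Y)) expr0 invr1 mul1r.
rewrite (_ : cRe _ = cRe (plog (v 0)))//.
by rewrite char_fun0 plog1.
Qed.

(** The imaginary part of [L] is [atan (S / C)] with [S = E sin (s Y)] and [C = E cos (s Y)]. At 0
    one has [S = 0] and [C = 1], so its derivative there is that of [S], namely [E Y]. *)
Lemma cumulant1 : (0 < k)%N -> cumulant P Y 1 = \int[P]_w Y w.
Proof.
move=> k0; have := cderive1n_plog k0.
move/(congr1 (fun z => cIm z)); rewrite expr1 /= mul0r mul1r add0r => <-.
have d0 := is_derive_trig_moment Yk 0 k0.
have cE : (fun s => cRe (v s)) = cos_moment Y 0.
  apply/funext => x; rewrite char_funE /=.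
  by apply: eq_Rintegral => w _; rewrite expr0 mul1r.
have sE : (fun s => cIm (v s)) = sin_moment Y 0.
  apply/funext => x; rewrite char_funE /=.
  by apply: eq_Rintegral => w _; rewrite expr0 mul1r.
have [c0 s0] : cos_moment Y 0 0 = 1 /\ sin_moment Y 0 0 = 0.
  by rewrite -cE -sE char_fun0.
have -> : (fun s => cIm (L s)) = (fun s => atan (sin_moment Y 0 s * (cos_moment Y 0 s)^-1)).
  by rewrite -cE -sE.
case: d0 => dc ds; rewrite derive1E.
have c00 : cos_moment Y 0 0 != 0 by rewrite c0 oner_neq0.
have dV := is_derive_inv c00 dc; have dM := is_derive_mul ds dV.
have [_ ->] := is_derive_chain (is_derive1_atan _) dM.
rewrite c0 s0 !mul0r addr0 expr0n addr0 !invr1 mul1r mulr1.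
by apply: eq_Rintegral => w _; rewrite mul0r cos0 expr1 mulr1.
Qed.

End CumulantExpansion.

Section CosBounds.
Context {R : realType}.
Implicit Types x y : R.

Lemma cexp_truncS n (z : R[i]) :
  cexp_trunc n.+1 z = cexp_trunc n z + (n`!%:R)^-1 * z ^+ n.
Proof. by rewrite /cexp_trunc big_ord_recr. Qed.

Lemma cexp_trunc2 (z : R[i]) : cexp_trunc 2 z = 1 + z.
Proof.
by rewrite !cexp_truncS /cexp_trunc big_ord0 add0r !invr1 mul1r expr0 mul1r expr1.
Qed.

Lemma cexp_trunc3 (z : R[i]) : cexp_trunc 3 z = 1 + z + 2^-1 * z ^+ 2.
Proof. by rewrite cexp_truncS cexp_trunc2. Qed.

Lemma sin_le_abs x : `|sin x| <= `|x|.
Proof.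
have h (z : R) : 0 <= z -> `|sin z| <= z.
  move=> z0; have := @le_mean_value _ (@sin R) (@cos R) 0 z 1 z0
    (fun y _ => is_derive_sin y) (fun y _ => cos_max y).
  by rewrite mul1r sin0 !subr0.
have [x0|x0] := leP 0 x; first by rewrite (ger0_norm x0) h.
by rewrite -normrN -sinN (ltr0_norm x0) h// oppr_ge0 ltW.
Qed.

Lemma cos_ge_quad x : 2 * (1 - cos x) <= x ^+ 2.
Proof.
have -> : x = (x / 2) *+ 2 by rewrite -mulr_natr divfK.
rewrite cos_mulr2n cos2sin2; move: (x / 2) => y.
have h : sin y ^+ 2 <= y ^+ 2.
  by rewrite -[leLHS]real_normK ?num_real// -[leRHS]real_normK ?num_real// lerXn2r ?nnegrE// sin_le_abs.
rewrite (_ : (y *+ 2) ^+ 2 = 4 * y ^+ 2); last by ring.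
by move: (sin y ^+ 2) (y ^+ 2) h => a b; lra.
Qed.

Lemma cos_taylor x : `|2 * (1 - cos x) - x ^+ 2| <= 16 * `|x| ^+ 3 * expR `|x|.
Proof.
have := cexp_taylor 3 (Complex 0 x).
have -> : normc (Complex 0 x) = `|x|.
  by rewrite /Normc.normc expr0n add0r sqrtr_sqr.
rewrite cexp_trunc3 (_ : Complex 0 x ^+ 2 = (- x ^+ 2)%:C%C); last first.
  by rewrite !expr2; apply/eqP; rewrite eq_complex /=; apply/andP; split; apply/eqP; ring.
move=> h; have {h} := le_trans (Re_le_normc _) h.
rewrite /cexp (_ : (2 : R[i])^-1 = (2^-1 : R)%:C%C); last first.
  by rewrite fmorphV rmorph_nat.
rewrite (_ : cRe (_ - _) = cos x - (1 + 2^-1 * - x ^+ 2)); last by rewrite /= expR0; ring.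
move=> h.
rewrite (_ : 2 * _ - _ = -2 * (cos x - (1 + 2^-1 * - x ^+ 2))); last by field.
rewrite normrM normrN (ger0_norm (_ : 0 <= 2))//.
have -> : 16 * `|x| ^+ 3 * expR `|x| = 2 * ((2 * `|x|) ^+ 3 * expR `|x|) by ring.
by rewrite ler_wpM2l.
Qed.

End CosBounds.

(** * Moments of a Levy process *)

Section SecondMoment.
Context d (T : measurableType d) (R : realType) (P : probability T R).

(* Fatou bounds the second moment by the curvature of the characteristic
   function at 0, and [2 (1 - cos x) <= x ^+ 2] gives the converse bound. *)
Lemma second_moment_char_fun (Y : {RV P >-> R}) (c : R) :
  (forall e : R, 0 < e -> \forall s \near (0 : R),
     `|2 * (1 - cRe (char_fun P Y s)) - c * s ^+ 2| <= e * s ^+ 2) ->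
  (\int[P]_w (Y w ^+ 2)%:E = c%:E)%E.
Proof.
move=> hc.
pose s_ n : R := n.+1%:R^-1.
have s0 n : 0 < s_ n by rewrite invr_gt0.
have s2 n : 0 < s_ n ^+ 2 by rewrite exprn_gt0.
(* These nonnegative quotients stay below [Y ^ 2] and converge to it pointwise, while their
   expectations [u n] converge to [c] by hypothesis. *)
pose g n w := 2 * (1 - cos (s_ n * Y w)) / s_ n ^+ 2.
have i1 := integrable_cstT P 1.
have ig n : L1 P (g n).
  have h := integrable_scale measurableT (2 / s_ n ^+ 2)
    (integrable_sub measurableT i1 (integrable_cosM Y (s_ n))).
  rewrite (_ : g n = fun w => 2 / s_ n ^+ 2 * (1 - cos (s_ n * Y w)))//.
  by apply/funext => w; rewrite /g mulrAC.
have g0 n w : 0 <= g n w.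
  by rewrite /g divr_ge0 ?(ltW (s2 n))// mulr_ge0// subr_ge0 cos_le1.
have gY n w : g n w <= Y w ^+ 2.
  rewrite /g ler_pdivrMr// -exprMn mulrC [leRHS]exprMn -exprMn mulrC.
  by rewrite (mulrC (Y w)) cos_ge_quad.
pose u n := 2 * (1 - cRe (char_fun P Y (s_ n))) / s_ n ^+ 2.
have Ig n : (\int[P]_w (g n w)%:E)%E = (u n)%:E.
  have := integrable_fin_num measurableT (ig n) => /fineK <-; congr EFin.
  rewrite -[LHS]/(\int[P]_w g n w) /u char_funE /=.
  rewrite -{2}(Rintegral_cstT P 1) -RintegralB//; last exact: integrable_cosM.
  rewrite mulrAC -RintegralZl//; last first.
    by apply: integrable_sub => //; exact: integrable_cosM.
  by apply: eq_Rintegral => w _; rewrite /g mulrAC.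
have s_0 : s_ n @[n --> \oo] --> (0 : R) by exact: cvg_harmonic.
have uc : u n @[n --> \oo] --> c.
  apply/cvgrPdist_le => e e0.
  have : \forall n \near \oo, `|2 * (1 - cRe (char_fun P Y (s_ n))) - c * s_ n ^+ 2| <=
      e * s_ n ^+ 2 by exact: (s_0 _ (hc e e0)).
  apply: filterS => n; rewrite /u distrC => h.
  rewrite -(ler_pM2r (s2 n)); apply: le_trans h.
  rewrite -[X in _ * X](gtr0_norm (s2 n)) -normrM mulrBl divfK ?gt_eqF//.
have ucE : (u n)%:E @[n --> \oo] --> c%:E by apply: cvg_EFin; [exact: nearW|exact: uc].
have mg n : measurable_fun setT (fun w => (g n w)%:E).
  by apply/measurable_EFinP; exact: integrable_measurable (ig n).
have gc w : (g n w)%:E @[n --> \oo] --> (Y w ^+ 2)%:E.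
  apply: cvg_EFin; first exact: nearW.
  pose B := 16 * `|Y w| ^+ 3 * expR `|Y w|.
  have B0 : 0 <= B by rewrite !mulr_ge0 ?exprn_ge0 ?expR_ge0.
  have gB n : `|g n w - Y w ^+ 2| <= B * s_ n.
    rewrite -(ler_pM2r (s2 n)) -{1}(gtr0_norm (s2 n)) -normrM mulrBl /g divfK ?gt_eqF//.
    rewrite (_ : Y w ^+ 2 * s_ n ^+ 2 = (s_ n * Y w) ^+ 2); last by ring.
    apply: le_trans (cos_taylor _) _; rewrite normrM (gtr0_norm (s0 n)).
    rewrite (_ : B * _ * _ = 16 * (s_ n * `|Y w|) ^+ 3 * expR `|Y w|); last by rewrite /B; ring.
    rewrite ler_wpM2l ?mulr_ge0 ?exprn_ge0 ?mulr_ge0 ?(ltW (s0 n))// ler_expR.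
    by rewrite ler_piMl// /s_ invf_le1// ler1n.
  apply/cvgrPdist_le => e e0.
  have : B * s_ n @[n --> \oo] --> B * 0 by apply: cvgMr; exact: s_0.
  rewrite mulr0 => /cvgrPdist_le/(_ _ e0); apply: filterS => n.
  rewrite sub0r normrN ger0_norm ?mulr_ge0 ?(ltW (s0 n))//.
  by move=> h; rewrite /= distrC; exact: le_trans (gB n) h.
apply/eqP; rewrite eq_le; apply/andP; split.
  have := @fatou _ _ _ P setT measurableT (fun n w => (g n w)%:E) mg
    (fun n w _ => g0 n w).
  rewrite (_ : limn_einf (fun n => _) = c%:E); last first.
    under eq_fun do rewrite Ig.
    rewrite is_cvg_limn_einfE; first by apply/cvg_lim.
    by apply/cvg_ex; exists c%:E.
  under eq_integral => w _.
    rewrite is_cvg_limn_einfE; last by apply/cvg_ex; exists (Y w ^+ 2)%:E; exact: gc.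
    rewrite (cvg_lim _ (gc w))//; over.
  by [].
apply: (cvge_le _ ucE); apply: nearW => n; rewrite -Ig.
apply: ge0_le_integral => //.
- by move=> w _; rewrite lee_fin.
- by apply/measurable_EFinP; apply: measurable_funX.
- by move=> w _; rewrite lee_fin.
Qed.

End SecondMoment.

Section LevyMoments.
Context d (T : measurableType d) (R : realType) (P : probability T R).
Variable X : R -> {RV P >-> R}.
Hypothesis hX : levy_process X.
Variable k : nat.
Hypothesis hk : (2 <= k)%N.
Hypothesis Xk : L1 P (fun w => `|X 1 w| ^+ k).
Hypothesis X10 : \int[P]_w X 1 w = 0.
Local Notation v t s := (char_fun P (X t) s).
Local Notation L := (fun s => plog (v 1 s)).
Local Notation gam j := (cumulant P (X 1) j).

Lemma plog_near0 (e : R) : 0 < e -> \forall s \near (0 : R), normc (L s) <= e.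
Proof.
move=> e0; have [L0 hL] := plog_branch (X 1).
have [c1 c2 _] := nbhs_singleton hL.
have e2 : 0 < e / 2 by rewrite divr_gt0.
move/cvgrPdist_le: c1 => /(_ _ e2); move/cvgrPdist_le: c2 => /(_ _ e2).
rewrite L0 (_ : cIm 0 = 0)// (_ : cRe 0 = 0)//; apply: filterS2 => s.
rewrite !sub0r !normrN => h1 h2.
by apply: le_trans (normc_le_ReIm _) _; lra.
Qed.

Lemma levy_char_fun_local : exists2 delta : R, 0 < delta &
  forall s t, `|s| <= delta -> 0 <= t -> v t s = cexp (t%:C%C * L s).
Proof.
apply: levy_char_fun_exp => //; last exact: plog_near0.
have [_ hL] := plog_branch (X 1).
by apply: filterS hL => s [].
Qed.

(** [t L] is itself a branch of the logarithm of [v t], and any branch computes the cumulants. *)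
Lemma levy_cumulant (t : R) j : 0 <= t -> (j <= k)%N ->
  cumulant P (X t) j = t * gam j.
Proof.
move=> t0 jk; have [dl dl0 hdl] := levy_char_fun_local.
have [L0 hL] := plog_branch (X 1).
have ReE s : cRe (t%:C%C * L s) = t * cRe (L s) by case: (L s) => a b /=; ring.
have ImE s : cIm (t%:C%C * L s) = t * cIm (L s) by case: (L s) => a b /=; ring.
have br : is_log_branch (char_fun P (X t)) (fun s => t%:C%C * L s).
  split; first by rewrite L0 mulr0.
  have hs : \forall s \near (0 : R), `|s| <= dl.
    by exists dl => //= s /=; rewrite sub0r normrN => /ltW.
  apply: filterS2 hL hs => s [c1 c2 _] sd; split; last by rewrite (hdl s t).
  - rewrite (_ : (fun u => _) = (fun u => t * cRe (L u))); last exact/funext.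
    by apply: continuousM => //; exact: cst_continuous.
  - rewrite (_ : (fun u => _) = (fun u => t * cIm (L u))); last exact/funext.
    by apply: continuousM => //; exact: cst_continuous.
have [S1 S2] := smooth0_plog Xk.
rewrite (cumulant_branch j br) (cumulant_branch j (plog_branch (X 1))).
have -> : cderive1n j (fun s => t%:C%C * L s) 0 = t%:C%C * cderive1n j L 0.
  rewrite /cderive1n (_ : (fun u => cRe _) = (fun u => t * cRe (L u))); last exact/funext.
  rewrite (_ : (fun u => cIm _) = (fun u => t * cIm (L u))); last exact/funext.
  rewrite (derive1nZ0 t S1 jk) (derive1nZ0 t S2 jk).
  by apply/eqP; rewrite eq_complex /=; apply/andP; split; apply/eqP; ring.
rewrite mulrCA; move: (_^-1 * _) => z.
by case: z => a b /=; ring.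
Qed.

Lemma levy_cumulant1 : gam 1 = 0.
Proof. by rewrite (cumulant1 Xk) ?X10//; exact: leq_trans hk. Qed.

Lemma integrable_sqr_of_moment : L1 P (fun w => `|X 1 w| ^+ 2).
Proof. exact: (integrable_abs_moment_le Xk hk). Qed.

Lemma plog_quad (e : R) : 0 < e -> \forall s \near (0 : R),
  normc (L s + (gam 2 / 2 * s ^+ 2)%:C%C) <= e * s ^+ 2.
Proof.
move=> e0; apply: filterS (plog_taylor integrable_sqr_of_moment e0) => s.
rewrite !big_ord_recr big_ord0 /= cumulant0 levy_cumulant1 !mul0r !mulr0 !add0r.
rewrite real_normK ?num_real//; apply: le_trans; rewrite le_eqVlt; apply/orP; left.
apply/eqP; congr normc; congr (_ + _).
rewrite (_ : (2`!%:R : R[i])^-1 = (2^-1 : R)%:C%C); last by rewrite fmorphV rmorph_nat.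
by rewrite expr2; apply/eqP; rewrite eq_complex /=; apply/andP; split; apply/eqP; ring.
Qed.

(** The value is asserted in the extended reals, so finiteness at time [t] is part of the
    conclusion: it comes from [2 (1 - Re v_t) = t gam_2 s ^ 2 + o(s ^ 2)], which needs moments at
    time 1 only. *)
Lemma levy_second_moment (t : R) : 0 <= t ->
  (\int[P]_w (X t w ^+ 2)%:E = (t * gam 2)%:E)%E.
Proof.
move=> t0; apply: second_moment_char_fun => e e0.
have [dl dl0 hdl] := levy_char_fun_local.
pose a := t * (`|gam 2| / 2 + 1).
have a0 : 0 <= a by rewrite mulr_ge0// addr_ge0// divr_ge0.
(* [e1] bounds the error of [t L] against its quadratic part by [e / 4 * s ^ 2], and [m] will bound
   the error [exp z - 1 - z] by [e / 8 * s ^ 2]. Both are doubled at the end, which leaves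
   [3 / 4 * e]. *)
pose e1 := Num.min 1 (e / 4 / (t + 1)).
have t1 : 0 < t + 1 by rewrite ltr_wpDl.
have e10 : 0 < e1 by rewrite lt_min ltr01 !divr_gt0.
pose m := 8 * a ^+ 2 * expR a + 1.
have m0 : 0 < m by rewrite ltr_wpDl// !mulr_ge0 ?exprn_ge0 ?expR_ge0.
pose dl2 := Num.min dl (Num.min 1 (e / 4 / m)).
have dl20 : 0 < dl2 by rewrite !lt_min dl0 ltr01 !divr_gt0.
have hs : \forall s \near (0 : R), `|s| <= dl2.
  by exists dl2 => //= s /=; rewrite sub0r normrN => /ltW.
apply: filterS2 hs (plog_quad e10) => s; rewrite !le_min => /and3P[sd s1 sm] hq.
rewrite (hdl s t sd t0); set z := t%:C%C * L s.
have hz : normc (z + (t * (gam 2 / 2) * s ^+ 2)%:C%C) <= t * (e1 * s ^+ 2).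
  have -> : z + (t * (gam 2 / 2) * s ^+ 2)%:C%C = t%:C%C * (L s + (gam 2 / 2 * s ^+ 2)%:C%C).
    by rewrite mulrDr -[t * _ * _]mulrA rmorphM.
  by rewrite Normc.normcM normcR ger0_norm// ler_wpM2l.
clearbody z; have s20 : 0 <= s ^+ 2 by exact: sqr_ge0.
have hz2 : normc z <= a * s ^+ 2.
  rewrite -[z](addrK (t * (gam 2 / 2) * s ^+ 2)%:C%C).
  apply: le_trans (normcB _ _) _; rewrite normcR.
  rewrite /a (normrM (t * _)) (normrM t) (normrM (gam 2)) (ger0_norm t0) (ger0_norm s20) (@ger0_norm _ 2^-1)//.
  apply: le_trans (lerD hz (lexx _)) _.
  have : e1 <= 1 by rewrite ge_min lexx.
  have := normr_ge0 (gam 2); move: `|_| => g g0 h.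
  rewrite (_ : t * (g / 2 + 1) * s ^+ 2 = t * (1 * s ^+ 2) + t * (g / 2) * s ^+ 2); last by ring.
  by rewrite lerD2r ler_wpM2l// ler_wpM2r.
have s21 : s ^+ 2 <= 1.
  by rewrite -real_normK ?num_real// expr_le1.
have hz3 : normc z <= a by apply: le_trans hz2 _; rewrite ler_piMr.
clearbody a; have := cexp_taylor 2 z; rewrite cexp_trunc2.
move=> ht; have {}ht := le_trans (Re_le_normc _) ht.
have hr := le_trans (Re_le_normc _) hz.
rewrite raddfB raddfD /= in ht; rewrite raddfD /= in hr.
have hb : (2 * normc z) ^+ 2 * expR (normc z) <= e / 8 * s ^+ 2.
  apply: (@le_trans _ _ ((2 * (a * s ^+ 2)) ^+ 2 * expR a)).
    rewrite ler_pM ?exprn_ge0 ?mulr_ge0 ?normc_ge0 ?expR_ge0// ?ler_expR//.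
    have h2 : 2 * normc z <= 2 * (a * s ^+ 2) by rewrite ler_wpM2l.
    have h3 : 0 <= 2 * normc z by rewrite mulr_ge0// normc_ge0.
    by apply: lerXn2r => //; rewrite nnegrE ?(le_trans h3 h2).
  rewrite (_ : _ * expR a = (4 * a ^+ 2 * expR a * s ^+ 2) * s ^+ 2); last by ring.
  rewrite ler_wpM2r//; apply: (@le_trans _ _ (m / 2 * (e / 4 / m))); last first.
    by rewrite le_eqVlt; apply/orP; left; apply/eqP; field; rewrite gt_eqF.
  have q0 : 0 <= a ^+ 2 * expR a by rewrite mulr_ge0 ?exprn_ge0 ?expR_ge0.
  have qE : m / 2 = 4 * a ^+ 2 * expR a + 1 / 2 by rewrite /m; field.
  have qE2 : 4 * a ^+ 2 * expR a = 4 * (a ^+ 2 * expR a) by rewrite mulrA.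
  apply: ler_pM => //.
  - by rewrite qE2 mulr_ge0.
  - by rewrite qE lerDl.
  by apply: le_trans sm; rewrite -real_normK ?num_real// expr2 ler_piMr.
have he1 : t * (e1 * s ^+ 2) <= e / 4 * s ^+ 2.
  rewrite mulrA ler_wpM2r//; apply: (@le_trans _ _ (t * (e / 4 / (t + 1)))).
    by rewrite ler_wpM2l// ge_min lexx orbT.
  rewrite mulrA ler_pdivrMr// mulrC ler_wpM2l ?divr_ge0 ?(ltW e0)//; lra.
have -> : 2 * (1 - cRe (cexp z)) - t * gam 2 * s ^+ 2 =
  -2 * (cRe (cexp z) - (1 + cRe z)) + -2 * (cRe z + t * (gam 2 / 2) * s ^+ 2) by field.
apply: le_trans (ler_normD _ _) _; rewrite !normrM normrN (ger0_norm (_ : 0 <= 2 :> R))//.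
apply: (@le_trans _ _ (2 * (e / 8 * s ^+ 2) + 2 * (e / 4 * s ^+ 2))).
  apply: lerD; rewrite ler_wpM2l//; first exact: le_trans ht hb.
  exact: le_trans hr he1.
have : 0 <= e * s ^+ 2 by rewrite mulr_ge0// ltW.
by rewrite !mulrA; move: (s ^+ 2) => w; lra.
Qed.

End LevyMoments.

(** * Expansion of the normalised characteristic function *)

Section WeightExpansion.
Variable A : comNzRingType.

(* Solutions of weight [nu] have no entry beyond [nu], so they may equally be
   indexed by [K >= nu] variables; this makes all weights live in one type. *)
Lemma sum_ffun_weight (K nu : nat) (F : nat -> nat -> A) : (nu <= K)%N ->
  (forall m, F m 0%N = 1) ->
  \sum_(f : {ffun 'I_K -> 'I_K.+1} | (\sum_(m < K) m.+1 * f m)%N == nu)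
     \prod_(m < K) F m (f m) =
  \sum_(k : {ffun 'I_nu -> 'I_nu.+1} | is_weight_solution k)
     \prod_(m < nu) F m (k m).
Proof.
move=> nK F0.
pose kk (k : {ffun 'I_nu -> 'I_nu.+1}) (m : nat) : nat :=
  if insub m is Some m' then k m' else 0%N.
have kkE k (m : 'I_nu) : kk k m = k m by rewrite /kk valK.
have kk0 k m : (nu <= m)%N -> kk k m = 0%N.
  by move=> nm; rewrite /kk insubN// -leqNgt.
have kkK k m : (kk k m < K.+1)%N.
  rewrite /kk; case: insubP => [m' _ _|_]//.
  by apply: leq_trans (ltn_ord (k m')) _.
pose h k : {ffun 'I_K -> 'I_K.+1} := [ffun m : 'I_K => inord (kk k m)].
pose h' (f : {ffun 'I_K -> 'I_K.+1}) : {ffun 'I_nu -> 'I_nu.+1} :=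
  [ffun m => inord (f (widen_ord nK m))].
have hE k (m : 'I_K) : h k m = kk k m :> nat by rewrite ffunE inordK.
have wide (B : nmodType) (G : nat -> nat -> B) k : (forall m, G m 0%N = 0) ->
    \sum_(m < K) G m (h k m) = \sum_(m < nu) G m (k m).
  move=> G0; transitivity (\sum_(m < nu) G m (kk k m)); last first.
    by apply: eq_bigr => m _; rewrite kkE.
  rewrite (big_ord_widen K (fun m => G m (kk k m)) nK) [RHS]big_mkcond.
  apply: eq_bigr => m _; rewrite hE; case: ltnP => // nm.
  by rewrite kk0.
rewrite (reindex_onto h h') /=; last first.
  move=> f /eqP wf; apply/ffunP => m; apply: val_inj => /=; rewrite ffunE.
  (* No single term exceeds the weight: entries are thus at most [nu], and those of index at least
     [nu] vanish. *)
  have le (i : 'I_K) : (i.+1 * f i <= nu)%N.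
    by rewrite -wf (bigD1 i)//= leq_addr.
  rewrite inordK//; case: (ltnP m nu) => mnu.
    rewrite /kk insubT /= ffunE inordK; last first.
      rewrite ltnS; apply: leq_trans (le (widen_ord nK (Ordinal mnu))).
      by rewrite leq_pmull.
    by congr (f _ : nat); exact: val_inj.
  rewrite kk0//; apply/esym/eqP; rewrite -leqn0 leqNgt; apply/negP => fm.
  have := le m; rewrite leqNgt => /negP; apply.
  by rewrite -ltnS in mnu; apply: leq_trans mnu _; rewrite leq_pmulr.
apply: eq_big => [k|k _].
  rewrite (wide nat (fun m j => m.+1 * j)%N k) /is_weight_solution; last first.
    by move=> m; rewrite muln0.
  rewrite (_ : h' (h k) == k) ?andbT//; apply/eqP/ffunP => m; apply: val_inj.
  by rewrite /= ffunE hE kkE inordK.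
transitivity (\prod_(m < nu) F m (kk k m)); last first.
  by apply: eq_bigr => m _; rewrite kkE.
rewrite (big_ord_widen K (fun m => F m (kk k m)) nK) [RHS]big_mkcond.
apply: eq_bigr => m _; rewrite hE; case: ltnP => // nm.
by rewrite kk0.
Qed.

End WeightExpansion.

Section ExpExpansion.
Context {R : realType}.
Implicit Types (u : nat -> R[i]).

(** The coefficient of [tau ^ nu] in the formal series [exp (sum_m tau ^ (m + 1) u_m)]. *)
Definition epoly (nu : nat) u : R[i] :=
  \sum_(k : {ffun 'I_nu -> 'I_nu.+1} | is_weight_solution k)
     \prod_(m < nu) ((k m)`!%:R^-1 * u m ^+ k m).

Lemma normc_factV (n : nat) : normc ((n`!%:R : R[i])^-1) <= 1.
Proof.
rewrite (_ : (n`!%:R : R[i])^-1 = ((n`!%:R)^-1 : R)%:C%C); last by rewrite fmorphV rmorph_nat.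
by rewrite normcR ger0_norm// invf_le1 ?ltr0n ?fact_gt0// ler1n fact_gt0.
Qed.

(** Truncating each exponential after the power [K] loses nothing up to weight [K], as no exponent
    can be larger there. Expanding the product and sorting by weight yields the [epoly] terms; all
    others carry at least [tau ^ (K + 1)]. *)
Lemma prod_cexp_trunc K u (tau : R) :
  \prod_(m < K) cexp_trunc K.+1 ((tau ^+ m.+1)%:C%C * u m) =
  \sum_(nu < K.+1) (tau ^+ nu)%:C%C * epoly nu u +
  \sum_(f : {ffun 'I_K -> 'I_K.+1} | (K < \sum_(m < K) m.+1 * f m)%N)
    (tau ^+ (\sum_(m < K) m.+1 * f m)%N)%:C%C *
    \prod_(m < K) ((f m)`!%:R^-1 * u m ^+ f m).
Proof.
rewrite /cexp_trunc bigA_distr_bigA /=.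
have E (f : {ffun 'I_K -> 'I_K.+1}) :
    \prod_(i < K) ((f i)`!%:R^-1 * ((tau ^+ i.+1)%:C%C * u i) ^+ f i) =
    (tau ^+ (\sum_(m < K) m.+1 * f m)%N)%:C%C *
      \prod_(m < K) ((f m)`!%:R^-1 * u m ^+ f m).
  rewrite rmorphXn /= -prodrXr -big_split /=; apply: eq_bigr => i _.
  by rewrite exprMn rmorphXn -exprM mulrCA.
under eq_bigr do rewrite E.
rewrite (bigID (fun f : {ffun 'I_K -> 'I_K.+1} => (\sum_(m < K) m.+1 * f m <= K)%N)) /=.
congr (_ + _); last by apply: eq_bigl => f; rewrite ltnNge.
(* [inord] returns the true weight here, since only weights at most [K] remain. *)
pose w (f : {ffun 'I_K -> 'I_K.+1}) : 'I_K.+1 := inord (\sum_(m < K) m.+1 * f m)%N.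
rewrite (partition_big w xpredT)//=; apply: eq_bigr => nu _.
rewrite /epoly -(@sum_ffun_weight _ K nu (fun m j => j`!%:R^-1 * u m ^+ j)); last 2 first.
- by rewrite -ltnS.
- by move=> m; rewrite fact0 invr1 expr0 mulr1.
rewrite mulr_sumr; apply: eq_big => [f|f /andP[fK /eqP <-]]; last first.
  by rewrite /w inordK.
apply/andP/eqP => [[fK /eqP <-]|fnu]; first by rewrite /w inordK.
split; first by rewrite fnu -ltnS.
by apply/eqP; rewrite /w fnu; exact: inord_val.
Qed.

(** Telescoping, one factor at a time. Writing the sizes as [exp (p i)] lets them multiply into a
    single exponential. *)
Lemma normc_prodB n (x y : nat -> R[i]) (p d : nat -> R) :
  (forall i, normc (x i) <= expR (p i)) -> (forall i, normc (y i) <= expR (p i)) ->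
  (forall i, normc (x i - y i) <= d i * expR (p i)) -> (forall i, 0 <= d i) ->
  normc (\prod_(i < n) x i - \prod_(i < n) y i) <=
    (\sum_(i < n) d i) * expR (\sum_(i < n) p i).
Proof.
move=> xp yp xy d0; elim: n => [|n IH].
  by rewrite !big_ord0 subrr Normc.normc0 mul0r.
rewrite !big_ord_recr /=.
set X := \prod_(i < n) x i; set Y := \prod_(i < n) y i.
have -> : X * x n - Y * y n = (X - Y) * x n + Y * (x n - y n) by ring.
have Yb : normc Y <= expR (\sum_(i < n) p i).
  by rewrite normc_prod expR_sum; apply: ler_prod => i _; rewrite normc_ge0 yp.
apply: le_trans (le_normcD _ _) _; rewrite !Normc.normcM mulrDl expRD.
apply: lerD.
  by rewrite mulrA ler_pM ?normc_ge0.
rewrite (mulrC (expR _)) mulrA (mulrC (normc Y)) ler_pM ?normc_ge0//.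
Qed.

(** The first sum pays for truncating the exponentials, the second for dropping the products of
    weight above [K]. As [tau <= 1], all surplus powers of [tau] are discarded. *)
Lemma cexp_sum_expansion K u (tau : R) : 0 <= tau <= 1 ->
  normc (cexp (\sum_(m < K) (tau ^+ m.+1)%:C%C * u m) -
         \sum_(nu < K.+1) (tau ^+ nu)%:C%C * epoly nu u) <=
  tau ^+ K.+1 * (\sum_(m < K) (2 * normc (u m)) ^+ K.+1 +
     \sum_(f : {ffun 'I_K -> 'I_K.+1} | (K < \sum_(m < K) m.+1 * f m)%N)
       \prod_(m < K) normc (u m) ^+ f m) *
  expR (\sum_(m < K) tau ^+ m.+1 * normc (u m)).
Proof.
move=> /andP[t0 t1].
pose y := \prod_(m < K) cexp_trunc K.+1 ((tau ^+ m.+1)%:C%C * u m).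
have nE m : normc ((tau ^+ m.+1)%:C%C * u m) = tau ^+ m.+1 * normc (u m).
  by rewrite Normc.normcM normcR ger0_norm// exprn_ge0.
have h1 : normc (cexp (\sum_(m < K) (tau ^+ m.+1)%:C%C * u m) - y) <=
    tau ^+ K.+1 * (\sum_(m < K) (2 * normc (u m)) ^+ K.+1) *
    expR (\sum_(m < K) tau ^+ m.+1 * normc (u m)).
  rewrite cexp_sum mulr_sumr.
  apply: (@normc_prodB K (fun m => cexp ((tau ^+ m.+1)%:C%C * u m))
    (fun m => cexp_trunc K.+1 ((tau ^+ m.+1)%:C%C * u m))
    (fun m => tau ^+ m.+1 * normc (u m))
    (fun m => tau ^+ K.+1 * (2 * normc (u m)) ^+ K.+1)) => m.
  - by rewrite normc_cexp ler_expR -nE (le_trans (ler_norm _))// Re_le_normc.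
  - by rewrite -nE cexp_trunc_le.
  - apply: le_trans (cexp_taylor _ _) _; rewrite nE ler_wpM2r ?expR_ge0//.
    rewrite mulrCA exprMn -exprM ler_wpM2r ?exprn_ge0 ?mulr_ge0 ?normc_ge0//.
    by rewrite ler_wiXn2l// leq_pmull.
  - by rewrite mulr_ge0 ?exprn_ge0 ?mulr_ge0 ?normc_ge0.
have e1 : 1 <= expR (\sum_(m < K) tau ^+ m.+1 * normc (u m)).
  rewrite -expR0 ler_expR sumr_ge0// => m _.
  by rewrite mulr_ge0 ?exprn_ge0 ?normc_ge0.
have h2 : normc (y - \sum_(nu < K.+1) (tau ^+ nu)%:C%C * epoly nu u) <=
    tau ^+ K.+1 * \sum_(f : {ffun 'I_K -> 'I_K.+1} | (K < \sum_(m < K) m.+1 * f m)%N)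
       \prod_(m < K) normc (u m) ^+ f m.
  rewrite /y prod_cexp_trunc addrAC subrr add0r.
  apply: le_trans (normc_sum _ _ _) _; rewrite mulr_sumr; apply: ler_sum => f Kf.
  rewrite Normc.normcM normcR ger0_norm ?exprn_ge0// ler_pM ?exprn_ge0 ?normc_ge0//.
    by rewrite ler_wiXn2l.
  rewrite normc_prod; apply: ler_prod => m _; rewrite normc_ge0 /= Normc.normcM normcX.
  by rewrite ler_piMl ?exprn_ge0 ?normc_ge0// normc_factV.
rewrite -[X in normc X](subrKA y); apply: le_trans (le_normcD _ _) _.
rewrite mulrDr mulrDl; apply: lerD => //.
apply: le_trans h2 _; rewrite ler_peMr// mulr_ge0 ?exprn_ge0 ?sumr_ge0// => f _.
by rewrite prodr_ge0// => m _; rewrite exprn_ge0// normc_ge0.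
Qed.

(** Positive weight provides an index with nonzero exponent, and one copy of that variable is
    bounded by [s * B] rather than [B]. The factor [s] saved here later cancels the pole of the
    Fejer weight. *)
Lemma prod_pow_le K (f : 'I_K -> nat) (x : 'I_K -> R) (s B : R) (N : nat) :
  0 <= s -> 1 <= B -> (forall m, 0 <= x m <= B) -> (forall m, x m <= s * B) ->
  (forall m, f m <= N)%N -> (0 < \sum_(m < K) m.+1 * f m)%N ->
  \prod_(m < K) x m ^+ f m <= s * B ^+ (N * K).
Proof.
move=> s0 B1 xB xs fN.
rewrite lt0n sum_nat_eq0 negb_forall => /existsP[m0 /=].
rewrite muln_eq0 negb_or /= => fm0.
have B0 : 0 <= B by exact: le_trans ler01 B1.
rewrite (bigD1 m0)//=.
have x0 m : 0 <= x m by have /andP[] := xB m.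
have h0 : x m0 ^+ f m0 <= s * B ^+ N.
  move: fm0 (fN m0); case: (f m0) => // n _ nN; rewrite exprS.
  apply: (@le_trans _ _ (s * B * B ^+ n)).
    rewrite ler_pM ?exprn_ge0// lerXn2r ?nnegrE//.
    by have /andP[] := xB m0.
  by rewrite -mulrA -exprS ler_wpM2l// ler_weXn2l.
have h1 : \prod_(i < K | i != m0) x i ^+ f i <= B ^+ (N * K.-1).
  rewrite exprM; apply: (@le_trans _ _ (\prod_(i < K | i != m0) B ^+ N)).
    apply: ler_prod => i _; rewrite exprn_ge0//=.
    apply: (@le_trans _ _ (B ^+ f i)); last by rewrite ler_weXn2l.
    by rewrite lerXn2r ?nnegrE//; have /andP[] := xB i.
  rewrite prodr_const; apply: ler_weXn2l; first by rewrite exprn_ege1.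
  by rewrite (@eq_card _ _ (predC1 m0))// cardC1 card_ord.
have K0 : (0 < K)%N by exact: leq_ltn_trans (ltn_ord m0).
apply: le_trans (ler_pM _ _ h0 h1) _; rewrite ?exprn_ge0//.
  by rewrite prodr_ge0// => i _; rewrite exprn_ge0.
by rewrite -mulrA -exprD -{1}(muln1 N) -mulnDr add1n prednK.
Qed.

(** With [M = N + 2], both [(1 + s) ^ N] and the factor [1 + s ^ 2] fit under [(2 (1 + s ^ 2)) ^ M].
    The exponential of [y = (1 + s ^ 2) / 4] exceeds [y ^ M / M!]; [8 ^ M] comes from
    [2 (1 + s ^ 2) = 8 y], and [expR 4^-1] completes [s ^ 2 / 4] to [y]. *)
Lemma poly_gauss_bound (N : nat) : exists2 C : R, 0 < C & forall s : R, 0 <= s ->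
  (1 + s) ^+ N * expR (- (s ^+ 2 / 4)) <= C / (1 + s ^+ 2).
Proof.
pose M := N.+2.
exists (8 ^+ M * M`!%:R * expR 4^-1).
  by rewrite mulr_gt0 ?expR_gt0// mulr_gt0 ?exprn_gt0// ltr0n fact_gt0.
move=> s s0; have q0 : 0 < 1 + s ^+ 2 by rewrite ltr_pwDl ?sqr_ge0.
rewrite ler_pdivlMr// expRN mulrAC ler_pdivrMr ?expR_gt0//.
apply: (@le_trans _ _ ((1 + s) ^+ M)).
  have s1 : 0 <= 1 + s by rewrite addr_ge0.
  have -> : (1 + s) ^+ M = (1 + s) ^+ N * (1 + s) ^+ 2 by rewrite -exprD addn2.
  apply: ler_wpM2l; first by rewrite exprn_ge0.
  by rewrite sqrrD expr1n mul1r lerD2r lerDl mulrn_wge0.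
apply: (@le_trans _ _ ((2 * (1 + s ^+ 2)) ^+ M)).
  rewrite lerXn2r ?nnegrE ?addr_ge0 ?mulr_ge0 ?sqr_ge0//; nra.
have h : ((1 + s ^+ 2) / 4) ^+ M / M`!%:R <= expR ((1 + s ^+ 2) / 4).
  have x0 : 0 <= (1 + s ^+ 2) / 4 by rewrite divr_ge0// ltW.
  by apply: le_trans (expR_ge1Dxn N.+1 x0); rewrite lerDr.
rewrite -(mulrA _ (expR _)).
have -> : expR (4^-1) * expR (s ^+ 2 / 4) = expR ((1 + s ^+ 2) / 4).
  by rewrite -expRD mulrDl mul1r.
rewrite ler_pdivrMr ?ltr0n ?fact_gt0// in h.
have -> : 2 * (1 + s ^+ 2) = 8 * ((1 + s ^+ 2) / 4) by field.
rewrite exprMn -(mulrA (8 ^+ M)); apply: ler_wpM2l; first exact: exprn_ge0.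
by rewrite (mulrC M`!%:R).
Qed.

Lemma epoly_le nu (u : nat -> R[i]) (x B : R) : 0 <= x ->
  1 <= B -> (forall m, normc (u m) <= B) ->
  normc (epoly nu u) <= #|{ffun 'I_nu -> 'I_nu.+1}|%:R * B ^+ (nu * nu).
Proof.
move=> x0 B1 uB; have B0 : 0 <= B by exact: le_trans ler01 B1.
rewrite /epoly; apply: le_trans (normc_sum _ _ _) _.
apply: (@le_trans _ _ (\sum_(k : {ffun 'I_nu -> 'I_nu.+1}) B ^+ (nu * nu))); last first.
  by rewrite sumr_const mulr_natl.
rewrite big_mkcond; apply: ler_sum => k _; case: ifP => _; last by rewrite exprn_ge0.
rewrite normc_prod exprM; apply: (@le_trans _ _ (\prod_(m < nu) B ^+ nu)); last first.
  by rewrite prodr_const card_ord.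
apply: ler_prod => m _; rewrite normc_ge0 /= Normc.normcM normcX.
apply: (@le_trans _ _ (1 * B ^+ nu)); last by rewrite mul1r.
rewrite ler_pM ?exprn_ge0 ?normc_ge0 ?normc_factV//.
apply: (@le_trans _ _ (B ^+ k m)).
  by rewrite lerXn2r ?nnegrE ?normc_ge0.
by rewrite ler_weXn2l// -ltnS.
Qed.

End ExpExpansion.

(** * Expansion in powers of [tau] with explicit error *)

Section LocalExpansion.
Context {R : realType}.
Variables (K : nat) (V : R) (gam : nat -> R).
Hypothesis V0 : 0 < V.

Definition bcoef (m : nat) : R := gam m.+3 / ((m.+3)`!%:R * V ^+ m.+3).

(** [tau ^ (m + 1)] times this is the Taylor term of order [m + 3] of [t L (s tau / V)], see
    [taylor_rescaled]. *)
Definition uvar (s : R) (m : nat) : R[i] :=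
  (bcoef m)%:C%C * (Complex 0 1 * s%:C%C) ^+ m.+3.

Definition ghat (tau s : R) : R[i] :=
  (expR (- (s ^+ 2 / 2)))%:C%C * \sum_(nu < K.+1) (tau ^+ nu)%:C%C * epoly nu (uvar s).

Lemma normc_uvar s m : 0 <= s -> normc (uvar s m) = `|bcoef m| * s ^+ m.+3.
Proof.
move=> s0; rewrite /uvar Normc.normcM normcX Normc.normcM !normcR (ger0_norm s0).
by rewrite (_ : normc (Complex 0 1) = 1) ?mul1r// /Normc.normc expr0n expr1n add0r sqrtr1.
Qed.

Definition bsum : R := 1 + \sum_(m < K) `|bcoef m|.

Lemma bsum_ge1 : 1 <= bsum.
Proof. by rewrite lerDl sumr_ge0. Qed.

Lemma bcoef_le m : (m < K)%N -> `|bcoef m| <= bsum.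
Proof.
move=> mK; rewrite /bsum (bigD1 (Ordinal mK))//= addrCA lerDl.
by rewrite addr_ge0// sumr_ge0.
Qed.

(** One bound for all [uvar s m] with [m < K]: the largest power of [s] among them is [K + 2]. *)
Definition ubound (s : R) := bsum * (1 + s) ^+ K.+2.

Lemma ubound_ge1 s : 0 <= s -> 1 <= ubound s.
Proof.
move=> s0; rewrite -[1](mulr1 1) /ubound ler_pM// ?bsum_ge1//.
by rewrite exprn_ege1// lerDl.
Qed.

Lemma uvar_le s m : 0 <= s -> (m < K)%N -> normc (uvar s m) <= ubound s /\
  normc (uvar s m) <= s * ubound s.
Proof.
move=> s0 mK; rewrite normc_uvar// /ubound.
have b1 := bcoef_le mK; have s1 : s <= 1 + s by rewrite lerDr.
have p0 : 1 <= 1 + s by rewrite lerDl.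
split.
  apply: ler_pM => //; first by rewrite exprn_ge0.
  apply: (@le_trans _ _ ((1 + s) ^+ m.+3)).
    by apply: lerXn2r; rewrite ?nnegrE// addr_ge0.
  by rewrite ler_weXn2l// !ltnS.
rewrite exprS mulrCA ler_wpM2l// ler_pM ?exprn_ge0//.
apply: (@le_trans _ _ ((1 + s) ^+ m.+2)).
  by apply: lerXn2r; rewrite ?nnegrE// addr_ge0.
by rewrite ler_weXn2l// !ltnS ltnW.
Qed.

(* [t = tau ^- 2], so that [s * tau / V] is the argument [s / (V sqrt t)]. *)
Lemma expansion_remainder : exists (N : nat) (C : R), 0 < C /\
  forall s tau, 0 <= s -> 0 <= tau <= 1 ->
  normc (cexp (\sum_(m < K) (tau ^+ m.+1)%:C%C * uvar s m) -
         \sum_(nu < K.+1) (tau ^+ nu)%:C%C * epoly nu (uvar s)) <=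
  tau ^+ K.+1 * s * (C * (1 + s) ^+ N) *
  expR (\sum_(m < K) tau ^+ m.+1 * normc (uvar s m)).
Proof.
pose c1 : R := K%:R * 2 ^+ K.+1.
pose c2 : R := #|{ffun 'I_K -> 'I_K.+1}|%:R.
(* [K + 1] serves the truncation errors, and [K * K] the products of [K] variables with exponents at
   most [K]. *)
pose NN := (K.+1 + K * K)%N.
have b1 := bsum_ge1.
exists (K.+2 * NN)%N, ((c1 + c2 + 1) * bsum ^+ NN); split.
  rewrite mulr_gt0 ?exprn_gt0 ?(lt_le_trans ltr01 b1)// ltr_wpDl// addr_ge0//.
  by rewrite mulr_ge0// exprn_ge0.
move=> s tau s0 t01; apply: le_trans (cexp_sum_expansion K (uvar s) t01) _.
rewrite ler_wpM2r ?expR_ge0// -(mulrA (_ ^+ _)) ler_wpM2l//.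
  by move: t01 => /andP[? _]; rewrite exprn_ge0.
have U1 := ubound_ge1 s0; set U := ubound s in U1.
have U0 : 0 <= U by exact: le_trans ler01 U1.
have UE : U ^+ NN = bsum ^+ NN * (1 + s) ^+ K.+2 ^+ NN by rewrite -exprMn.
rewrite exprM -(mulrA (c1 + c2 + 1)) -UE.
apply: (@le_trans _ _ (s * (c1 * U ^+ NN) + s * (c2 * U ^+ NN))); last first.
  by rewrite -mulrDr ler_wpM2l// -mulrDl ler_wpM2r ?exprn_ge0// lerDl.
apply: lerD.
  have -> : s * (c1 * U ^+ NN) = \sum_(m < K) 2 ^+ K.+1 * (s * U ^+ NN).
    by rewrite sumr_const card_ord /c1; move: (U ^+ NN) => x; rewrite -[RHS]mulr_natl; ring.
  apply: ler_sum => m _; have [h1 h2] := uvar_le s0 (ltn_ord m).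
  rewrite exprMn ler_wpM2l ?exprn_ge0// exprS.
  apply: (@le_trans _ _ (s * U * U ^+ K)).
    by apply: ler_pM; rewrite ?exprn_ge0 ?normc_ge0//; apply: lerXn2r; rewrite ?nnegrE ?normc_ge0.
  by rewrite -mulrA -exprS ler_wpM2l// ler_weXn2l// leq_addr.
rewrite mulrCA mulr_natl -sumr_const big_mkcond; apply: ler_sum => f _.
case: ifP => Kf; last by rewrite mulr_ge0 ?exprn_ge0.
apply: (@le_trans _ _ (s * U ^+ (K * K))); last first.
  by rewrite ler_wpM2l// ler_weXn2l// leq_addl.
apply: prod_pow_le => //.
- by move=> m; rewrite normc_ge0; have [] := uvar_le s0 (ltn_ord m).
- by move=> m; have [] := uvar_le s0 (ltn_ord m).
- by move=> m; rewrite -ltnS.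
- by apply: leq_ltn_trans Kf.
Qed.

Lemma ghat_bound : exists2 C : R, 0 < C & forall s tau, 0 <= s -> 0 <= tau <= 1 ->
  normc (ghat tau s) <= C * expR (- (s ^+ 2 / 4)).
Proof.
pose n_ nu : R := #|{ffun 'I_nu -> 'I_nu.+1}|%:R.
pose D := \sum_(nu < K.+1) n_ nu.
have D0 : 0 <= D by apply: sumr_ge0.
have [C C0 hC] := @poly_gauss_bound R (K.+2 * (K * K)).
have b1 := bsum_ge1.
exists ((D + 1) * bsum ^+ (K * K) * C).
  by rewrite !mulr_gt0 ?exprn_gt0 ?(lt_le_trans ltr01 b1)// ltr_wpDl.
move=> s tau s0 /andP[t0 t1].
have U1 := ubound_ge1 s0; set U := ubound s in U1.
have U0 : 0 <= U by exact: le_trans ler01 U1.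
rewrite /ghat Normc.normcM normcR ger0_norm ?expR_ge0//.
have h : normc (\sum_(nu < K.+1) (tau ^+ nu)%:C%C * epoly nu (uvar s)) <=
    (D + 1) * U ^+ (K * K).
  apply: le_trans (normc_sum _ _ _) _.
  apply: (@le_trans _ _ (D * U ^+ (K * K))); last by rewrite ler_wpM2r ?exprn_ge0// lerDl.
  rewrite mulr_suml; apply: ler_sum => nu _.
  have nuK : (nu <= K)%N by rewrite -ltnS.
  rewrite Normc.normcM normcR ger0_norm ?exprn_ge0//.
  apply: (@le_trans _ _ (1 * normc (epoly nu (uvar s)))).
    by rewrite ler_wpM2r ?normc_ge0// exprn_ile1.
  rewrite mul1r.
  (* [epoly nu] reads only the variables below [nu <= K]; cutting the others to 0 gives the bound
     for every index that [epoly_le] expects. *)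
  have -> : epoly nu (uvar s) = epoly nu (fun m => if (m < K)%N then uvar s m else 0).
    apply: eq_bigr => k _; apply: eq_bigr => m _.
    by rewrite (leq_trans (ltn_ord m) nuK).
  apply: (@le_trans _ _ (n_ nu * U ^+ (nu * nu))).
    apply: (@epoly_le R nu _ 0) => // m; case: ifP => mK.
      by have [] := uvar_le s0 mK.
    by rewrite Normc.normc0.
  by rewrite ler_wpM2l// ler_weXn2l// leq_mul.
apply: le_trans (ler_wpM2l (expR_ge0 _) h) _.
have -> : - (s ^+ 2 / 2) = - (s ^+ 2 / 4) + - (s ^+ 2 / 4) by field.
rewrite expRD /U /ubound exprMn -exprM.
have := hC s s0; have e0 := expR_ge0 (- (s ^+ 2 / 4)).
have hC' : C / (1 + s ^+ 2) <= C.
  by rewrite ler_piMr ?(ltW C0)// invf_le1 ?ltr_pwDl ?sqr_ge0// lerDl sqr_ge0.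
move=> h1; have {h1 hC'} h1 := le_trans h1 hC'.
rewrite [leLHS](_ : _ = (D + 1) * bsum ^+ (K * K) *
  ((1 + s) ^+ (K.+2 * (K * K)) * expR (- (s ^+ 2 / 4))) * expR (- (s ^+ 2 / 4))); last by ring.
rewrite ler_wpM2r// ler_wpM2l// mulr_ge0 ?exprn_ge0 ?(le_trans ler01 b1)//.
by rewrite addr_ge0.
Qed.

(** Since [tau ^ (m + 1) s ^ (m + 3) = (s tau) ^ (m + 1) s ^ 2], these terms are a small multiple of
    [s ^ 2] as soon as [s tau] is small, and the Gaussian factor can absorb their exponential. *)
Lemma uvar_exponent (eta : R) : 0 < eta -> exists2 delta : R, 0 < delta &
  forall s tau, 0 <= s -> 0 <= tau -> s * tau <= delta ->
  \sum_(m < K) tau ^+ m.+1 * normc (uvar s m) <= eta * s ^+ 2.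
Proof.
move=> e0; have b1 := bsum_ge1; have b0 : 0 < bsum by exact: lt_le_trans b1.
pose delta := Num.min 1 (eta / (K.+1%:R * bsum)).
have d0 : 0 < delta by rewrite lt_min ltr01 divr_gt0// mulr_gt0.
exists delta => // s tau s0 t0; rewrite le_min => /andP[x1 x2].
have x0 : 0 <= s * tau by rewrite mulr_ge0.
apply: (@le_trans _ _ (\sum_(m < K) bsum * (s * tau) * s ^+ 2)).
  apply: ler_sum => m _; rewrite normc_uvar//.
  rewrite (_ : tau ^+ m.+1 * _ = `|bcoef m| * (s * tau) ^+ m.+1 * s ^+ 2); last first.
    have -> : s ^+ m.+3 = s ^+ m.+1 * s ^+ 2 by rewrite -exprD addn2.
    by rewrite exprMn; ring.
  rewrite ler_wpM2r ?sqr_ge0// ler_pM ?exprn_ge0 ?bcoef_le//.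
  by rewrite exprS ler_piMr// exprn_ile1.
rewrite sumr_const card_ord -mulr_natl mulrA ler_wpM2r ?sqr_ge0//.
apply: (@le_trans _ _ (K.+1%:R * bsum * (s * tau))).
  by rewrite mulrA ler_wpM2r// ler_wpM2r ?(ltW b0)// ler_nat.
by rewrite mulrC -ler_pdivlMr// mulr_gt0.
Qed.

Variable L : R -> R[i].
Hypothesis gam0 : gam 0 = 0.
Hypothesis gam1 : gam 1 = 0.
Hypothesis gam2 : gam 2 = V ^+ 2.
Hypothesis hL : forall e : R, 0 < e -> \forall u \near (0 : R),
  normc (L u - \sum_(j < K.+3) (j`!%:R)^-1 *
     ((gam j)%:C%C * (Complex 0 1 * u%:C%C) ^+ j)) <= e * `|u| ^+ K.+2.

Lemma taylor_rescaled (tau s : R) : tau != 0 ->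
  (tau ^- 2)%:C%C * (\sum_(j < K.+3) (j`!%:R)^-1 *
     ((gam j)%:C%C * (Complex 0 1 * (s * tau / V)%:C%C) ^+ j)) =
  (- (s ^+ 2 / 2))%:C%C + \sum_(m < K) (tau ^+ m.+1)%:C%C * uvar s m.
Proof.
move=> t0; have Vn0 : V != 0 by rewrite gt_eqF.
rewrite !big_ord_recl gam0 gam1 !mul0r !mulr0 !add0r gam2 mulrDr; congr (_ + _).
  rewrite lift0 lift0 (_ : (ord0 : nat).+2 = 2%N)// (_ : (2`!%:R : R[i])^-1 = (2^-1 : R)%:C%C); last first.
    by rewrite fmorphV rmorph_nat.
  rewrite exprMn sqr_i mulN1r -rmorphXn -rmorphN -!rmorphM; congr (_%:C)%C.
  by rewrite !exprMn exprVn; field; rewrite t0 Vn0.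
rewrite mulr_sumr; apply: eq_bigr => m _; rewrite !lift0 /uvar /bcoef.
rewrite !exprMn -!rmorphXn.
rewrite (_ : ((m.+3)`!%:R : R[i])^-1 = (((m.+3)`!%:R)^-1 : R)%:C%C); last first.
  by rewrite fmorphV rmorph_nat.
set I := Complex 0 1 ^+ m.+3.
transitivity (I * ((tau ^- 2) * ((m.+3)`!%:R^-1 * (gam m.+3 * (s * tau / V) ^+ m.+3)))%:C%C).
  by rewrite !rmorphM; ring.
transitivity (I * (tau ^+ m.+1 * (gam m.+3 / (m.+3`!%:R * V ^+ m.+3) * s ^+ m.+3))%:C%C); last first.
  by rewrite !rmorphM; ring.
congr (_ * (_ %:C)%C).
have -> : (s * tau / V) ^+ m.+3 = s ^+ m.+3 * (tau ^+ m.+1 * tau ^+ 2) / V ^+ m.+3.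
  by rewrite -exprD addn2 expr_div_n exprMn.
move: (V ^+ m.+3) (expf_neq0 m.+3 Vn0) (s ^+ m.+3) (tau ^+ m.+1) => v vn0 x y.
by field; rewrite vn0 t0 pnatr_eq0 -lt0n fact_gt0.
Qed.

(** Let [z] be the Taylor terms of order 3 to [K + 2], [rho] the remainder and [S] the expansion of
    [exp z]. The difference is [exp (- s ^ 2 / 2) * ((exp z - S) + exp z * (exp rho - 1))]. The
    first part has order [tau ^ (K + 1)]; the second is [o(tau ^ K)] because [rho] is a Peano
    remainder multiplied by [tau ^ (- 2)]. *)
Lemma local_expansion (e : R) : 0 < e -> exists delta tau0 : R, 0 < delta /\ 0 < tau0 /\
  forall s tau, 0 <= s -> 0 < tau <= tau0 -> s * tau <= delta ->
  normc (cexp ((tau ^- 2)%:C%C * L (s * tau / V)) - ghat tau s) <=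
    e * tau ^+ K * (s / (1 + s ^+ 2)).
Proof.
move=> e0.
have [N [C1 [C10 hR]]] := expansion_remainder.
have [C2 C20 hC2] := @poly_gauss_bound R (K.+2 + N).
have e8 : 0 < 8^-1 :> R by rewrite invr_gt0.
have [d1 d10 hM] := uvar_exponent e8.
have V2 : 0 < V ^+ 2 by rewrite exprn_gt0.
have Vk : 0 < V ^+ K.+2 by rewrite exprn_gt0.
(* The first bound gives [|rho| <= s ^ 2 / 8]; the second makes the contribution of [rho] at most
   half of the target. *)
pose eps := Num.min (V ^+ 2 / 8) (e * V ^+ K.+2 / (4 * C2)).
have eps0 : 0 < eps.
  rewrite lt_min; apply/andP; split; first by apply: divr_gt0.
  by apply: divr_gt0; apply: mulr_gt0.
have [d2 /= d20 hd2] := hL eps0.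
(* [d1] controls [z]; [V] and [d2 * V / 2] ensure [u <= 1] and [u < d2]. The last bound on [tau]
   makes the [exp z - S] part the other half of the target. *)
exists (Num.min d1 (Num.min V (d2 * V / 2))), (Num.min 1 (e / (2 * C1 * C2))); split.
  by rewrite !lt_min d10 V0 divr_gt0// mulr_gt0.
split; first by rewrite lt_min ltr01 divr_gt0// !mulr_gt0.
move=> s tau s0 /andP[t0]; rewrite !le_min => /andP[t1 tC] /and3P[sd1 sV sd2].
have t01 : 0 <= tau <= 1 by rewrite (ltW t0).
set u := s * tau / V.
have u0 : 0 <= u by rewrite divr_ge0 ?mulr_ge0 ?(ltW t0) ?(ltW V0).
have u1 : u <= 1 by rewrite ler_pdivrMr// mul1r.
have ud : u < d2.
  rewrite ltr_pdivrMr//; apply: le_lt_trans sd2 _.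
  by rewrite ltr_pdivrMr// ltr_pMr ?mulr_gt0// ltr1n.
pose ru := L u - \sum_(j < K.+3) (j`!%:R)^-1 *
     ((gam j)%:C%C * (Complex 0 1 * u%:C%C) ^+ j).
have hru : normc ru <= eps * u ^+ K.+2.
  have := hd2 u; rewrite /= sub0r normrN (ger0_norm u0) => /(_ ud).
  by [].
pose rho := (tau ^- 2)%:C%C * ru.
pose z := \sum_(m < K) (tau ^+ m.+1)%:C%C * uvar s m.
pose S := \sum_(nu < K.+1) (tau ^+ nu)%:C%C * epoly nu (uvar s).
have LE : (tau ^- 2)%:C%C * L u = (- (s ^+ 2 / 2))%:C%C + (z + rho).
  rewrite addrA -(taylor_rescaled s (lt0r_neq0 t0)) -mulrDr; congr (_ * _).
  by rewrite /ru addrC subrK.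
have t2 : 0 < tau ^- 2 by rewrite invr_gt0 exprn_gt0.
have rho1 : normc rho <= eps / V ^+ K.+2 * (tau ^+ K * s ^+ K.+2).
  rewrite Normc.normcM normcR gtr0_norm//; apply: le_trans (ler_wpM2l (ltW t2) hru) _.
  rewrite le_eqVlt; apply/orP; left; apply/eqP.
  have -> : u ^+ K.+2 = s ^+ K.+2 * (tau ^+ K * tau ^+ 2) / V ^+ K.+2.
    by rewrite -exprD addn2 expr_div_n exprMn.
  move: (V ^+ K.+2) (lt0r_neq0 Vk) (s ^+ K.+2) (tau ^+ K) => v vn0 x y.
  by field; rewrite vn0 gt_eqF.
have rho2 : normc rho <= 8^-1 * s ^+ 2.
  rewrite Normc.normcM normcR gtr0_norm//; apply: le_trans (ler_wpM2l (ltW t2) hru) _.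
  apply: (@le_trans _ _ (tau ^- 2 * (V ^+ 2 / 8 * u ^+ 2))).
    apply: ler_wpM2l; first exact: ltW.
    apply: ler_pM; rewrite ?exprn_ge0 ?(ltW eps0) ?ge_min ?lexx//.
    by rewrite -addn2 exprD ler_piMl ?exprn_ge0// exprn_ile1.
  rewrite le_eqVlt; apply/orP; left; apply/eqP.
  by rewrite /u !expr2; field; rewrite !gt_eqF.
have hz : normc z <= 8^-1 * s ^+ 2.
  apply: le_trans (hM s tau s0 (ltW t0) sd1); apply: le_trans (normc_sum _ _ _) _.
  apply: ler_sum => m _; rewrite Normc.normcM normcR ger0_norm// exprn_ge0//.
  exact: ltW.
have hzS := hR s tau s0 t01; rewrite -/z -/S in hzS.
have q0 : 0 <= s ^+ 2 by exact: sqr_ge0.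
pose g4 := expR (- (s ^+ 2 / 4)).
have g40 : 0 <= g4 := expR_ge0 _.
(* The two factors [exp (- s ^ 2 / 8)] pay for [exp |z|] and [exp |rho|]; [g4] is kept for the
   polynomial in [s]. *)
have gE : expR (- (s ^+ 2 / 2)) = g4 * (expR (- (8^-1 * s ^+ 2)) * expR (- (8^-1 * s ^+ 2))).
  by rewrite -!expRD; congr expR; field.
have cE : cexp ((tau ^- 2)%:C%C * L u) - ghat tau s =
    (expR (- (s ^+ 2 / 2)))%:C%C * ((cexp z - S) + cexp z * (cexp rho - 1)).
  rewrite LE cexpD cexpD (_ : cexp (_%:C)%C = (expR (- (s ^+ 2 / 2)))%:C%C).
    by rewrite /ghat -/S; ring.
  by rewrite /cexp /= cos0 sin0 mulr1 mulr0.
rewrite cE Normc.normcM normcR (ger0_norm (expR_ge0 _)).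
have ez (x : R) : x <= 8^-1 * s ^+ 2 -> expR (- (8^-1 * s ^+ 2)) * expR x <= 1.
  by move=> hx; rewrite -expRD -[leRHS]expR0 ler_expR addrC subr_le0.
have E0 : 0 <= expR (- (8^-1 * s ^+ 2)) <= 1.
  by rewrite expR_ge0 -[leRHS]expR0 ler_expR oppr_le0 mulr_ge0// ltW.
set E := expR (- (8^-1 * s ^+ 2)) in gE ez E0.
have hA : E * E * normc (cexp z - S) <= tau ^+ K.+1 * s * (C1 * (1 + s) ^+ N).
  have M8 := hM s tau s0 (ltW t0) sd1.
  have := ez _ M8; move: E0 hzS => /andP[E0 E1].
  set F := expR (\sum_(m < K) _); set B := _ * (C1 * _) => hB hF.
  have B0 : 0 <= B.
    by rewrite !mulr_ge0 ?exprn_ge0 ?(ltW t0) ?(ltW C10)// addr_ge0.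
  apply: (@le_trans _ _ (E * (E * (B * F)))).
    by rewrite -mulrA; apply: ler_wpM2l => //; apply: ler_wpM2l.
  rewrite (_ : E * (E * (B * F)) = E * (E * F) * B); last by ring.
  by rewrite ler_piMl// mulr_ile1 ?mulr_ge0 ?expR_ge0.
have hB : E * E * normc (cexp z * (cexp rho - 1)) <= 2 * (eps / V ^+ K.+2 * (tau ^+ K * s ^+ K.+2)).
  have h1 : normc (cexp rho - 1) <= 2 * normc rho * expR (normc rho).
    by have := cexp_taylor 1 rho; rewrite cexp_truncS /cexp_trunc big_ord0 add0r invr1 mul1r expr0 expr1.
  have h2 : normc (cexp z) <= expR (normc z).
    by rewrite normc_cexp ler_expR (le_trans (ler_norm _))// Re_le_normc.
  have := ez _ hz; have := ez _ rho2; move: E0 => /andP[E0 E1] k1 k2.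
  rewrite Normc.normcM.
  apply: (@le_trans _ _ ((E * expR (normc z)) * (E * expR (normc rho)) * (2 * normc rho))).
    rewrite (_ : (E * expR (normc z)) * _ * _ = E * E * (expR (normc z) * (2 * normc rho * expR (normc rho)))); last by ring.
    by apply: ler_wpM2l; [rewrite mulr_ge0|rewrite ler_pM ?normc_ge0].
  apply: (@le_trans _ _ (2 * normc rho)).
    by rewrite ler_piMl ?mulr_ge0 ?normc_ge0// mulr_ile1 ?mulr_ge0 ?expR_ge0.
  by rewrite ler_wpM2l.
rewrite gE -[leLHS]mulrA.
have hAB : E * E * normc (cexp z - S + cexp z * (cexp rho - 1)) <=
    tau ^+ K * s * (1 + s) ^+ (K.+2 + N) * (e / C2).
  apply: (@le_trans _ _ (E * E * (normc (cexp z - S) + normc (cexp z * (cexp rho - 1))))).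
    by rewrite ler_wpM2l ?le_normcD// mulr_ge0; case/andP: E0.
  rewrite mulrDr; apply: le_trans (lerD hA hB) _.
  have p1 : 1 <= 1 + s by rewrite lerDl.
  have pN : (1 + s) ^+ N <= (1 + s) ^+ (K.+2 + N) by rewrite ler_weXn2l// leq_addl.
  have pK : s ^+ K.+1 <= (1 + s) ^+ (K.+2 + N).
    apply: (@le_trans _ _ ((1 + s) ^+ K.+1)).
      by apply: lerXn2r; rewrite ?nnegrE ?addr_ge0// lerDr.
    by rewrite ler_weXn2l// addSn ltnW// ltnS leq_addr.
  have tK : 0 <= tau ^+ K by rewrite exprn_ge0// ltW.
  set Pw := (1 + s) ^+ (K.+2 + N) in pN pK *.
  rewrite [e / C2](_ : _ = e / (2 * C2) + e / (2 * C2)); last by field; rewrite gt_eqF.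
  rewrite mulrDr; apply: lerD.
    rewrite exprSr (_ : _ * _ * _ = tau ^+ K * s * ((1 + s) ^+ N * (tau * C1))); last by ring.
    rewrite -[leRHS]mulrA; apply: ler_wpM2l; first by rewrite mulr_ge0.
    apply: ler_pM => //; rewrite ?exprn_ge0 ?addr_ge0 ?mulr_ge0 ?(ltW t0) ?(ltW C10)//.
    rewrite -ler_pdivlMr//; apply: le_trans tC _.
    by rewrite le_eqVlt; apply/orP; left; apply/eqP; field; rewrite !gt_eqF.
  rewrite [leLHS](_ : _ = tau ^+ K * s * (s ^+ K.+1 * (2 * (eps / V ^+ K.+2)))); last first.
    by rewrite (exprS s K.+1); move: (s ^+ K.+1) (eps / _) (tau ^+ K) => a b c; ring.
  rewrite -[leRHS]mulrA; apply: ler_wpM2l; first by rewrite mulr_ge0.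
  apply: ler_pM => //; first exact: exprn_ge0.
    by apply: mulr_ge0 => //; apply: divr_ge0; exact: ltW.
  rewrite mulrA ler_pdivrMr//.
  have : eps <= e * V ^+ K.+2 / (4 * C2) by rewrite ge_min lexx orbT.
  move=> he; apply: (@le_trans _ _ (2 * (e * V ^+ K.+2 / (4 * C2)))); first by rewrite ler_wpM2l.
  by rewrite le_eqVlt; apply/orP; left; apply/eqP; field; rewrite !gt_eqF.
apply: le_trans (ler_wpM2l g40 hAB) _.
have := hC2 s s0; rewrite -/g4 => hC.
rewrite (_ : g4 * _ = tau ^+ K * s * (e / C2) * ((1 + s) ^+ (K.+2 + N) * g4)); last by ring.
apply: (@le_trans _ _ (tau ^+ K * s * (e / C2) * (C2 / (1 + s ^+ 2)))).
  apply: ler_wpM2l => //; apply: mulr_ge0; last by apply: divr_ge0; exact: ltW.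
  by apply: mulr_ge0 => //; rewrite exprn_ge0// ltW.
rewrite le_eqVlt; apply/orP; left; apply/eqP; field.
by rewrite (gt_eqF C20) gt_eqF// ltr_pwDl.
Qed.

End LocalExpansion.

(** * Hermite functions and their Fourier transforms *)

Lemma Rintegral_cvg_exhaustion d (T : measurableType d) (R : realType)
  (m : {measure set T -> \bar R}) (D : set T) (A : nat -> set T) (f : T -> R) :
  measurable D -> m.-integrable D (EFin \o f) ->
  (forall n, measurable (A n)) -> (forall n, A n `<=` D) ->
  (forall x, D x -> \forall n \near \oo, A n x) ->
  \int[m]_(x in A n) f x @[n --> \oo] --> \int[m]_(x in D) f x.
Proof.
move=> mD fi mA AD Dn; apply: fine_cvg.
rewrite fineK; last exact: integrable_fin_num.
under eq_fun => n do rewrite -(setIidr (AD n)) integral_mkcondr.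
have fin : m.-integrable D (EFin \o (fun x => `|f x|)) by exact: integrable_norm.
have mf : measurable_fun D (EFin \o f) by apply: (measurable_int m).
have [] // := @dominated_convergence _ _ _ m D mD
  (fun n => (EFin \o f) \_ (A n)) (EFin \o f) (EFin \o (fun x => `|f x|)).
- move=> n; apply/(measurable_restrict (EFin \o f) (mA n) mD).
  by apply: measurable_funS mf => //; exact: subIsetl.
- apply/nearW => x Dx; apply: cvg_near_cst; near=> n.
  rewrite patchE ifT// mem_set//; near: n; exact: Dn.
- apply/nearW => x n Dx; rewrite patchE; case: ifP => _ //=.
  by rewrite normr0 lee_fin.
Unshelve. all: by end_near. Qed.

Section WholeLine.
Context {R : realType}.
Local Notation mu := (@lebesgue_measure R).
Implicit Types (f : R -> R).

Lemma Rintegral_FTC f f' (a b : R) : a <= b ->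
  (forall x : R, is_derive x 1 f (f' x)) -> continuous f' ->
  \int[mu]_(x in `[a, b]) f' x = f b - f a.
Proof.
rewrite le_eqVlt => /predU1P[->|ab] df cf'.
  by rewrite set_itv1 Rintegral_set1 subrr.
have cf := continuous_of_derive df.
rewrite /Rintegral (@continuous_FTC2 _ f' f)//.
- exact: continuous_subspaceT.
- split; [|by apply: cvg_at_right_filter; exact: cf|by apply: cvg_at_left_filter; exact: cf].
  by move=> x _; case: (df x).
- by move=> x _; rewrite derive1E; case: (df x).
Qed.

Variables (f f' : R -> R) (C : R).
Hypothesis df : forall x : R, is_derive x 1 f (f' x).
Hypothesis cf' : continuous f'.
Hypothesis if' : L1 mu f'.
Hypothesis fC : forall x, `|f x| * (1 + `|x|) <= C.

Lemma decay_cvg (u : nat -> R) : (forall n, `|u n| = n%:R) -> f (u n) @[n --> \oo] --> 0.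
Proof.
move=> un; have C0 : 0 <= C by apply: le_trans (fC 0); rewrite mulr_ge0 ?addr_ge0.
have h n : `|f (u n)| <= C * harmonic n.
  rewrite /harmonic /= ler_pdivlMr// -natr1 -un addrC; exact: fC.
have : C * harmonic n @[n --> \oo] --> C * 0 by apply: cvgMr; exact: cvg_harmonic.
rewrite mulr0 => Ch; apply/cvgr0Pnorm_le => e e0.
move/cvgr0Pnorm_le : Ch => /(_ e e0); apply: filterS => n; apply: le_trans.
by apply: le_trans (h n) (ler_norm _).
Qed.

Lemma Rintegral_derive_line : \int[mu]_x f' x = 0.
Proof.
have h : \int[mu]_(x in `[- n%:R, n%:R]) f' x @[n --> \oo] --> \int[mu]_x f' x.
  apply: Rintegral_cvg_exhaustion => //.
  move=> x _; near=> n; rewrite /= in_itv/= -ler_norml.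
  by near: n; exact: nbhs_infty_ger.
have k : f n%:R - f (- n%:R) @[n --> \oo] --> (0 - 0 : R).
  by apply: cvgB; apply: decay_cvg => n; rewrite ?normrN ger0_norm.
rewrite subr0 in k; apply: cvg_unique h _ => //.
rewrite (_ : (fun n : nat => _) = (fun n : nat => f n%:R - f (- n%:R)))//.
by apply/funext => n; rewrite (Rintegral_FTC _ df cf')// ge0_cp.
Unshelve. all: by end_near. Qed.

Lemma Rintegral_derive_Ny (x : R) : \int[mu]_(y in `]-oo, x]) f' y = f x.
Proof.
have h : \int[mu]_(y in `[- n%:R, x]) f' y @[n --> \oo] --> \int[mu]_(y in `]-oo, x]) f' y.
  apply: Rintegral_cvg_exhaustion => //.
  - by apply: (integrableS _ _ (subsetT _)).
  - by move=> n y /=; rewrite !in_itv/= => /andP[].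
  - move=> y /=; rewrite in_itv/= => yx; near=> n; rewrite /= in_itv/= yx andbT.
    rewrite lerNl; near: n; exact: nbhs_infty_ger.
apply: cvg_unique h _ => //.
have E : \forall n \near \oo, f x - f (- n%:R) = \int[mu]_(y in `[- n%:R, x]) f' y.
  near=> n; rewrite (Rintegral_FTC _ df cf')// lerNl; near: n; exact: nbhs_infty_ger.
apply: cvg_trans (near_eq_cvg E) _.
have k : f x - f (- n%:R) @[n --> \oo] --> (f x - 0 : R).
  apply: cvgB; first exact: cvg_cst.
  by apply: decay_cvg => n; rewrite normrN ger0_norm.
by rewrite subr0 in k.
Unshelve. all: by end_near. Qed.

End WholeLine.

Section Hermite.
Context {R : realType}.
Local Notation mu := (@lebesgue_measure R).
Implicit Types (p q : {poly R}) (x s : R).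

Fixpoint hermite_poly (n : nat) : {poly R} :=
  if n is n'.+1 then 'X * hermite_poly n' - (hermite_poly n')^`() else 1.

Definition gauss_exp x : R := expR (- (x ^+ 2 / 2)).

Lemma is_derive_gauss_exp x : is_derive x 1 gauss_exp (- x * gauss_exp x).
Proof.
have h : is_derive x 1 (fun y : R => - (2^-1 * y ^+ 2)) (- x).
  have := is_derive_opp (is_derive_cmul 2^-1 (is_derive_pow 2 x)).
  by move/is_derive_eq; apply; rewrite /= expr1; field.
have := is_derive_chain (is_derive_expR _) h.
rewrite (_ : (fun y => expR (- (2^-1 * y ^+ 2))) = gauss_exp); last first.
  by apply/funext => y; rewrite /gauss_exp mulrC.
by move/is_derive_eq; apply; rewrite /gauss_exp mulrC (mulrC 2^-1).
Qed.

Lemma is_derive_horner p x : is_derive x 1 (fun y => p.[y]) (p^`()).[x].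
Proof.
apply: DeriveDef; first exact: derivable_horner.
by rewrite derivE derive1E.
Qed.

Lemma is_derive_poly_gauss p x :
  is_derive x 1 (fun y => p.[y] * gauss_exp y) (- (('X * p - p^`()).[x] * gauss_exp x)).
Proof.
have := is_derive_mul (is_derive_horner p x) (is_derive_gauss_exp x).
by move/is_derive_eq; apply; rewrite hornerD hornerN hornerM hornerX; ring.
Qed.

Lemma derive1n_gauss_exp n :
  derive1n n gauss_exp = fun x => (-1) ^+ n * ((hermite_poly n).[x] * gauss_exp x).
Proof.
elim: n => [|n IH].
  by apply/funext => x; rewrite derive1n0 expr0 mul1r /= hornerC mul1r.
apply/funext => x; rewrite derive1nS IH derive1E.
have := is_derive_cmul ((-1) ^+ n) (is_derive_poly_gauss (hermite_poly n) x).
by case=> _ ->; rewrite exprS; ring.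
Qed.

Lemma hermiteE n x : hermite n x = (hermite_poly n).[x].
Proof.
rewrite /hermite (_ : (fun y : R => _) = gauss_exp)// derive1n_gauss_exp.
rewrite mulrACA -signr_odd -expr2 sqrr_sign mul1r mulrCA /gauss_exp.
by rewrite -expRD subrr expR0 mulr1.
Qed.

Lemma horner_le_pow p : exists N (C : R), 0 < C /\
  forall x, `|p.[x]| <= C * (1 + `|x|) ^+ N.
Proof.
elim/poly_ind: p => [|p c [N [C [C0 h]]]].
  by exists 0%N, 1; split => // x; rewrite horner0 normr0 mul1r exprn_ge0// addr_ge0.
exists N.+1, (C + `|c|); split; first by rewrite ltr_wpDr.
move=> x; rewrite !hornerE; apply: le_trans (ler_normD _ _) _.
rewrite mulrDl; apply: lerD.
  rewrite normrM exprSr mulrA ler_pM//.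
  by rewrite lerDr.
by rewrite ler_peMr// exprn_ege1// lerDl.
Qed.

Lemma poly_gauss_le p : exists2 C : R, 0 < C &
  forall x, `|p.[x] * gauss_exp x| * (1 + x ^+ 2) <= C * expR (- (x ^+ 2 / 4)).
Proof.
have [N [C [C0 h]]] := horner_le_pow p.
have [D D0 hD] := @poly_gauss_bound R N.
exists (C * D) => [|x]; first exact: mulr_gt0.
have s0 : 0 < 1 + x ^+ 2 by rewrite ltr_pwDl// sqr_ge0.
have := hD _ (normr_ge0 x); rewrite real_normK ?num_real// ler_pdivlMr// => hDx.
have -> : gauss_exp x = expR (- (x ^+ 2 / 4)) * expR (- (x ^+ 2 / 4)).
  by rewrite /gauss_exp -expRD; congr expR; field.
have e0 := expR_ge0 (- (x ^+ 2 / 4)); set e := expR _ in hDx e0 *.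
rewrite normrM (ger0_norm (mulr_ge0 e0 e0)).
apply: (@le_trans _ _ (C * (1 + `|x|) ^+ N * (e * e) * (1 + x ^+ 2))).
  by apply: ler_wpM2r; [exact: ltW|apply: ler_wpM2r => //; exact: mulr_ge0].
rewrite [leLHS](_ : _ = C * ((1 + `|x|) ^+ N * e * (1 + x ^+ 2)) * e); last by ring.
by apply: ler_wpM2r => //; apply: ler_wpM2l => //; exact: ltW.
Qed.

Lemma integrable_gauss4 : L1 mu (fun x => expR (- (x ^+ 2 / 4))).
Proof.
(* Up to its peak value, the integrand is the normal density of variance 2. *)
pose s : R := Num.sqrt 2.
have s0 : s != 0 by rewrite sqrtr_eq0 -ltNge.
have := integrable_scale measurableT (normal_peak s)^-1 (@integrable_normal_pdf R 0 s).
apply: eq_integrable => // x _ /=; congr EFin.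
rewrite /normal_pdf (negbTE s0) mulrA mulVf ?mul1r; last first.
  by rewrite gt_eqF// normal_peak_gt0.
by rewrite /normal_fun subr0 /s sqr_sqrtr//; congr expR; field.
Qed.

Definition gauss_poly p x : R := (Num.sqrt (2 * pi))^-1 * (p.[x] * gauss_exp x).

Lemma is_derive_gauss_poly p x :
  is_derive x 1 (gauss_poly p) (- gauss_poly ('X * p - p^`()) x).
Proof.
have := is_derive_cmul (Num.sqrt (2 * pi))^-1 (is_derive_poly_gauss p x).
by move/is_derive_eq; apply; rewrite mulrN.
Qed.

Lemma continuous_gauss_poly p : continuous (gauss_poly p).
Proof.
exact: continuous_of_derive (is_derive_gauss_poly p).
Qed.

Lemma measurable_gauss_poly p : measurable_fun setT (gauss_poly p).
Proof. by apply: continuous_measurable_fun; exact: continuous_gauss_poly. Qed.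

Lemma gauss_polyD p q x : gauss_poly (p + q) x = gauss_poly p x + gauss_poly q x.
Proof. by rewrite /gauss_poly hornerD; ring. Qed.

Lemma gauss_polyZ a p x : gauss_poly (a *: p) x = a * gauss_poly p x.
Proof. by rewrite /gauss_poly hornerZ; ring. Qed.

Lemma gauss_poly_le p : exists2 C : R, 0 < C &
  forall x, `|gauss_poly p x| * (1 + x ^+ 2) <= C * expR (- (x ^+ 2 / 4)).
Proof.
have [C C0 h] := poly_gauss_le p.
have c0 : 0 < (Num.sqrt (2 * pi))^-1 :> R by rewrite invr_gt0 sqrtr_gt0 mulr_gt0// pi_gt0.
exists ((Num.sqrt (2 * pi))^-1 * C); first exact: mulr_gt0.
move=> x; rewrite normrM (gtr0_norm c0) -[leLHS]mulrA -[leRHS]mulrA.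
by apply: ler_wpM2l; [exact: ltW|exact: h].
Qed.

Lemma integrable_gauss_polyM p (phi : R -> R) : measurable_fun setT phi ->
  (forall x, `|phi x| <= 1 + x ^+ 2) ->
  L1 mu (fun x => gauss_poly p x * phi x).
Proof.
move=> mphi hphi; have [C C0 h] := gauss_poly_le p.
apply: (@integrable_dominated _ _ _ mu setT measurableT _
  (fun x => C * expR (- (x ^+ 2 / 4)))).
- by apply: measurable_funM => //; exact: measurable_gauss_poly.
- by move=> x _; rewrite normrM; apply: le_trans (h x); exact: ler_wpM2l.
- exact: integrable_scale integrable_gauss4.
Qed.

Lemma integrable_gauss_poly p : L1 mu (gauss_poly p).
Proof.
have := @integrable_gauss_polyM p (cst 1) (measurable_cst _).
rewrite (_ : (fun x => _) = gauss_poly p); last by apply/funext => x /=; rewrite mulr1.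
by apply => x /=; rewrite normr1 lerDl sqr_ge0.
Qed.

Lemma integrable_gauss_poly_bounded p (phi : R -> R) : measurable_fun setT phi ->
  (forall x, `|phi x| <= 1) ->
  L1 mu (fun x => gauss_poly p x * phi x).
Proof.
move=> mphi phi1; apply: integrable_gauss_polyM => // x; apply: le_trans (phi1 x) _.
by rewrite lerDl sqr_ge0.
Qed.

(** Cosines and sines as [phi] give the Fourier transform, indicators of half lines give the
    distribution function; linearity in [p] is proved once for both. *)
Definition gauss_int (phi : R -> R) p : R := \int[mu]_x (gauss_poly p x * phi x).

Section GaussInt.
Variable phi : R -> R.
Hypotheses (mphi : measurable_fun setT phi) (phi1 : forall x, `|phi x| <= 1).

Let ip p := @integrable_gauss_poly_bounded p phi mphi phi1.

Lemma gauss_intD p q : gauss_int phi (p + q) = gauss_int phi p + gauss_int phi q.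
Proof.
rewrite /gauss_int -RintegralD//; apply: eq_Rintegral => x _.
by rewrite gauss_polyD mulrDl.
Qed.

Lemma gauss_intZ a p : gauss_int phi (a *: p) = a * gauss_int phi p.
Proof.
rewrite /gauss_int -RintegralZl//; apply: eq_Rintegral => x _.
by rewrite gauss_polyZ mulrA.
Qed.

Lemma gauss_int_sum I (r : seq I) (Q : pred I) (a : I -> R) (F : I -> {poly R}) :
  gauss_int phi (\sum_(i <- r | Q i) a i *: F i) =
  \sum_(i <- r | Q i) a i * gauss_int phi (F i).
Proof.
rewrite (big_morph _ gauss_intD (_ : gauss_int phi 0 = 0)); last first.
  by rewrite -(scale0r 0) gauss_intZ mul0r.
by apply: eq_bigr => i _; rewrite gauss_intZ.
Qed.

End GaussInt.

Lemma le_1Dsqr x : `|x| <= 1 + x ^+ 2.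
Proof.
have := sqr_ge0 (`|x| - 1); rewrite sqrrB1 real_normK ?num_real// => h.
have := sqr_ge0 x; lra.
Qed.

Let cosM s x : `|cos (s * x)| <= 1. Proof. exact: cos_max. Qed.
Let sinM s x : `|sin (s * x)| <= 1. Proof. exact: sin_max. Qed.

Lemma gauss_poly_decay p (phi : R -> R) : (forall x, `|phi x| <= 1) -> exists C,
  forall x, `|gauss_poly p x * phi x| * (1 + `|x|) <= C.
Proof.
move=> phi1; have [C C0 h] := gauss_poly_le p; exists (2 * C) => x.
have e1 : expR (- (x ^+ 2 / 4)) <= 1.
  by rewrite -[leRHS]expR0 ler_expR oppr_le0 divr_ge0// sqr_ge0.
apply: (@le_trans _ _ (`|gauss_poly p x| * (2 * (1 + x ^+ 2)))).
  rewrite normrM -mulrA ler_wpM2l//; apply: (@le_trans _ _ (1 * (1 + `|x|))).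
    by rewrite ler_wpM2r ?addr_ge0.
  by have := le_1Dsqr x; have := sqr_ge0 x; lra.
rewrite mulrCA ler_wpM2l//; apply: le_trans (h x) _.
by rewrite ler_piMr// ltW.
Qed.

(** Integration by parts: the Hermite recurrence makes [gauss_poly (hermite_poly n.+1)] minus the
    derivative of [gauss_poly (hermite_poly n)], and the boundary terms vanish by Gaussian decay. *)
Lemma gauss_int_derive n (phi phi' : R -> R) :
  (forall x, is_derive x 1 phi (phi' x)) -> continuous phi' ->
  (forall x, `|phi x| <= 1) ->
  L1 mu (fun x => gauss_poly (hermite_poly n) x * phi' x) ->
  gauss_int phi (hermite_poly n.+1) = gauss_int phi' (hermite_poly n).
Proof.
move=> dphi cphi' phi1 iphi'; have cphi := continuous_of_derive dphi.
have iphi p := integrable_gauss_poly_bounded p (continuous_measurable_fun cphi) phi1.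
have [C hC] := gauss_poly_decay (hermite_poly n) phi1.
have := @Rintegral_derive_line R _ (fun x => gauss_poly (hermite_poly n) x * phi' x -
  gauss_poly (hermite_poly n.+1) x * phi x) C _ _ _ hC.
rewrite RintegralB// => h; apply/esym/eqP; rewrite -subr_eq0; apply/eqP; apply: h.
- move=> x; have := is_derive_mul (is_derive_gauss_poly (hermite_poly n) x) (dphi x).
  by move/is_derive_eq; apply; rewrite -/(hermite_poly n.+1); ring.
- by move=> x; apply: cvgB; apply: cvgM;
    [exact: continuous_gauss_poly|exact: cphi'|exact: continuous_gauss_poly|exact: cphi].
- exact: integrable_sub.
Qed.

Lemma gauss_int_hermiteS n s :
  gauss_int (fun x => cos (s * x)) (hermite_poly n.+1) =
    - s * gauss_int (fun x => sin (s * x)) (hermite_poly n) /\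
  gauss_int (fun x => sin (s * x)) (hermite_poly n.+1) =
    s * gauss_int (fun x => cos (s * x)) (hermite_poly n).
Proof.
have dl (x : R) : is_derive x 1 (fun y : R => s * y) s.
  by have := is_derive_cmul s (is_derive_id x 1); rewrite mulr1.
have dc (x : R) : is_derive x 1 (fun y : R => cos (s * y)) (- s * sin (s * x)).
  have := is_derive_chain (is_derive_cos (s * x)) (dl x).
  by move/is_derive_eq; apply; ring.
have ds (x : R) : is_derive x 1 (fun y : R => sin (s * y)) (s * cos (s * x)).
  have := is_derive_chain (is_derive_sin (s * x)) (dl x).
  by move/is_derive_eq; apply; ring.
have swap c f p : gauss_int (fun x => c * f x) p =
    \int[mu]_x (c * (gauss_poly p x * f x)).
  by apply: eq_Rintegral => x _; rewrite mulrCA.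
have iM c f p : L1 mu (fun x => gauss_poly p x * f x) ->
    L1 mu (fun x => gauss_poly p x * (c * f x)).
  move=> /(integrable_scale measurableT c); apply: eq_integrable => // x _ /=.
  by rewrite mulrCA.
have ic p := integrable_gauss_poly_bounded p (measurable_cosM s) (cosM s).
have is_ p := integrable_gauss_poly_bounded p (measurable_sinM s) (sinM s).
split.
- rewrite (gauss_int_derive dc _ (cosM s) (iM _ _ _ (is_ _))) ?swap ?RintegralZl//.
  by move=> x; apply: cvgMr; exact: continuous_of_derive ds x.
- rewrite (gauss_int_derive ds _ (sinM s) (iM _ _ _ (ic _))) ?swap ?RintegralZl//.
  by move=> x; apply: cvgMr; exact: continuous_of_derive dc x.
Qed.

Lemma Rintegral_gauss1 : \int[mu]_x gauss_poly 1 x = 1.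
Proof.
have <- : fine (\int[mu]_x (normal_pdf 0 1 x)%:E)%E = 1 by rewrite integral_normal_pdf.
congr fine; apply: eq_integral => x _; congr EFin.
rewrite /normal_pdf oner_eq0 /gauss_poly hornerC mul1r /normal_peak /normal_fun.
by rewrite expr1n mul1r subr0 mulNr mulr_natl.
Qed.

Lemma gauss_ode (u : R -> R) : (forall s : R, is_derive s 1 u (- s * u s)) ->
  forall s, u s = u 0 * gauss_exp s.
Proof.
move=> du s.
have dE (x : R) : is_derive x 1 (fun y => u y / gauss_exp y) 0.
  have g0 : gauss_exp x != 0 by rewrite gt_eqF// expR_gt0.
  have := is_derive_mul (du x) (is_derive_inv g0 (is_derive_gauss_exp x)).
  by move/is_derive_eq; apply; field.
have E : u s / gauss_exp s = u 0 / gauss_exp 0.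
  apply/eqP; rewrite -subr_eq0 -normr_le0.
  wlog : / True by move=> /(_ I).
  move=> _; have [s0|/ltW s0] := leP 0 s.
    have := @le_mean_value R (fun y => u y / gauss_exp y) (fun=> 0) 0 s 0 s0.
    by rewrite mul0r; apply => x _ //; rewrite normr0.
  have := @le_mean_value R (fun y => u y / gauss_exp y) (fun=> 0) s 0 0 s0.
  by rewrite mul0r distrC; apply => x _ //; rewrite normr0.
have -> : u 0 = u 0 / gauss_exp 0.
  by rewrite /gauss_exp expr0n /= mul0r oppr0 expR0 divr1.
by rewrite -E divfK// gt_eqF// expR_gt0.
Qed.

(** Differentiating under the integral multiplies the density by [x], that is by the first Hermite
    polynomial, and integration by parts turns this into a factor [s]. Both transforms thus solve
    [u' = - s u], and their values at 0 fix them. *)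
Lemma gauss_int_hermite0 s :
  gauss_int (fun x => cos (s * x)) 1 = gauss_exp s /\
  gauss_int (fun x => sin (s * x)) 1 = 0.
Proof.
have dl (x w : R) : is_derive (x : R) 1 (fun y : R => y * w) w.
  have := is_derive_cmul w (is_derive_id x 1).
  by under eq_fun do rewrite mulrC; rewrite mulr1.
have X1 x : gauss_poly (hermite_poly 1) x = x * gauss_poly 1 x.
  by rewrite /gauss_poly /= derivC subr0 mulr1 hornerX hornerC mul1r mulrCA.
have iG : L1 mu (fun x => `|gauss_poly (hermite_poly 1) x|).
  by apply: integrable_norm => //; exact: integrable_gauss_poly.
have dc (t : R) : is_derive t 1 (fun t => gauss_int (fun x => cos (t * x)) 1)
    (- t * gauss_int (fun x => cos (t * x)) 1).
  rewrite mulNr -(gauss_int_hermiteS 0 t).2 /gauss_int.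
  have -> : - (\int[mu]_x (gauss_poly (hermite_poly 1) x * sin (t * x))) =
      \int[mu]_x (- (gauss_poly (hermite_poly 1) x * sin (t * x))).
    rewrite -mulN1r -RintegralZl//; last first.
      exact: (integrable_gauss_poly_bounded _ (measurable_sinM t) (sinM t)).
    by apply: eq_Rintegral => x _; rewrite mulN1r.
  apply: (@is_derive_under_integral _ _ _ mu setT measurableT _
    (fun t x => - (gauss_poly (hermite_poly 1) x * sin (t * x)))
    (fun x => `|gauss_poly (hermite_poly 1) x|)) => //.
  - move=> x w _; have := is_derive_cmul (gauss_poly 1 w)
      (@is_derive_chain _ (@cos R) (fun x => x * w) x _ _ (is_derive_cos (x * w)) (dl x w)).
    by move/is_derive_eq; apply; rewrite X1; ring.
  - by move=> x; exact: (integrable_gauss_poly_bounded _ (measurable_cosM x) (cosM x)).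
  - by move=> x w _; rewrite normrN normrM ler_piMr.
have ds (t : R) : is_derive t 1 (fun t => gauss_int (fun x => sin (t * x)) 1)
    (- t * gauss_int (fun x => sin (t * x)) 1).
  rewrite -(gauss_int_hermiteS 0 t).1 /gauss_int.
  apply: (@is_derive_under_integral _ _ _ mu setT measurableT _
    (fun t x => gauss_poly (hermite_poly 1) x * cos (t * x))
    (fun x => `|gauss_poly (hermite_poly 1) x|)) => //.
  - move=> x w _; have := is_derive_cmul (gauss_poly 1 w)
      (@is_derive_chain _ (@sin R) (fun x => x * w) x _ _ (is_derive_sin (x * w)) (dl x w)).
    by move/is_derive_eq; apply; rewrite X1; ring.
  - by move=> x; exact: (integrable_gauss_poly_bounded _ (measurable_sinM x) (sinM x)).
  - by move=> x w _; rewrite normrM ler_piMr.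
rewrite (gauss_ode dc s) (gauss_ode ds s); split.
  rewrite [X in X * _](_ : _ = 1) ?mul1r// -[RHS]Rintegral_gauss1.
  by apply: eq_Rintegral => x _; rewrite mul0r cos0 mulr1.
rewrite [X in X * _](_ : _ = 0) ?mul0r// /gauss_int.
under eq_Rintegral do rewrite mul0r sin0 mulr0.
by rewrite Rintegral_cst// mul0r.
Qed.

Lemma gauss_int_hermite n s :
  Complex (gauss_int (fun x => cos (s * x)) (hermite_poly n))
          (gauss_int (fun x => sin (s * x)) (hermite_poly n)) =
  (Complex 0 1 * s%:C%C) ^+ n * (gauss_exp s)%:C%C.
Proof.
elim: n => [|n IH].
  by rewrite expr0 mul1r /= !(gauss_int_hermite0 s).1 (gauss_int_hermite0 s).2.
have [-> ->] := gauss_int_hermiteS n s.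
rewrite exprS -mulrA -IH; apply/eqP; rewrite eq_complex /=; apply/andP; split; apply/eqP; ring.
Qed.

Lemma gauss_int_cdf n x : \int[mu]_(y in `]-oo, x]) gauss_poly (hermite_poly n.+1) y =
  - gauss_poly (hermite_poly n) x.
Proof.
have one1 (y : R) : `|(cst 1 : R -> R) y| <= 1 by rewrite normr1.
have [C hC] := gauss_poly_decay (hermite_poly n) one1.
have h := @Rintegral_derive_Ny R (fun y => - gauss_poly (hermite_poly n) y)
  (gauss_poly (hermite_poly n.+1)) C _ _ _ _ x.
apply: h => [y||//|y].
- by have := is_derive_opp (is_derive_gauss_poly (hermite_poly n) y); rewrite opprK.
- exact: continuous_gauss_poly.
- exact: integrable_gauss_poly.
- by have := hC y; rewrite /= mulr1 normrN.
Qed.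

End Hermite.

Lemma Rintegral_indic d (T : measurableType d) (R : realType)
  (m : {measure set T -> \bar R}) (D : set T) (f : T -> R) :
  \int[m]_(x in D) f x = \int[m]_x (f x * \1_D x).
Proof. by rewrite Rintegral_mkcond patch_indic. Qed.

(** * The Edgeworth density and its distribution function *)

Section EdgeworthDensity.
Context {R : realType}.
Local Notation mu := (@lebesgue_measure R).
Variables (K : nat) (V : R) (gam : nat -> R).
Local Notation bcoef := (bcoef V gam).

Definition weight_coef nu (k : {ffun 'I_nu -> 'I_nu.+1}) : R :=
  \prod_(m < nu) ((k m)`!%:R^-1 * bcoef m ^+ k m).

(** The Hermite index is the total power of [i s] in a term of [epoly nu (uvar s)]: if
    [sum (m + 1) k_m = nu], then [sum (m + 3) k_m = nu + 2 sum k_m]. *)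
Definition edgeworth_poly nu : {poly R} :=
  \sum_(k : {ffun 'I_nu -> 'I_nu.+1} | is_weight_solution k)
     weight_coef k *: hermite_poly (nu + 2 * \sum_(m < nu) k m).

Definition edgeworth_density (tau : R) : {poly R} :=
  \sum_(nu < K.+1) tau ^+ nu *: edgeworth_poly nu.

Lemma big_weight_solution0 (W : nmodType) (F : {ffun 'I_0 -> 'I_1} -> W) :
  \sum_(k : {ffun 'I_0 -> 'I_1} | is_weight_solution k) F k = F [ffun=> ord0].
Proof.
apply: big_pred1 => k /=; rewrite /is_weight_solution big_ord0 eqxx.
by apply/esym/eqP/ffunP => -[].
Qed.

Lemma edgeworth_poly0 : edgeworth_poly 0 = 1.
Proof.
by rewrite /edgeworth_poly big_weight_solution0 /weight_coef !big_ord0 scale1r.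
Qed.

Lemma gauss_int_edgeworth_density tau s :
  Complex (gauss_int (fun x => cos (s * x)) (edgeworth_density tau))
          (gauss_int (fun x => sin (s * x)) (edgeworth_density tau)) =
  ghat K V gam tau s.
Proof.
have c1 x : `|cos (s * x)| <= 1 by exact: cos_max.
have s1 x : `|sin (s * x)| <= 1 by exact: sin_max.
rewrite !gauss_int_sum//; [|exact: measurable_sinM|exact: measurable_cosM].
have lin (I : finType) (Q : pred I) (a : I -> R) (x y : I -> R) :
    Complex (\sum_(i | Q i) a i * x i) (\sum_(i | Q i) a i * y i) =
    \sum_(i | Q i) (a i)%:C%C * Complex (x i) (y i).
  elim/big_rec3: _ => // i z1 z2 z3 _ <-.
  by apply/eqP; rewrite eq_complex /=; apply/andP; split; apply/eqP; ring.
rewrite lin /ghat mulr_sumr; apply: eq_bigr => nu _.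
rewrite [RHS]mulrCA; congr (_ * _); rewrite !gauss_int_sum//; [|exact: measurable_sinM|exact: measurable_cosM].
rewrite lin mulr_sumr; apply: eq_bigr => k /eqP kw.
rewrite gauss_int_hermite mulrA [RHS]mulrC; congr (_ * _).
rewrite /weight_coef rmorph_prod /=.
transitivity (\prod_(m < nu) (((k m)`!%:R^-1 * bcoef m ^+ k m)%:C%C *
    ((Complex 0 1 * s%:C%C) ^+ (m.+3 * k m)))).
  rewrite big_split /=; congr (_ * _).
  rewrite prodrXr; congr (_ ^+ _); rewrite -{1}kw mul2n -addnn -!big_split /=.
  by apply: eq_bigr => m _; rewrite addnC -addnA -!mulSn.
apply: eq_bigr => m _; rewrite /uvar exprM; move: (_ ^+ m.+3) (bcoef m) => z b.
by rewrite exprMn mulrA; congr (_ * _); rewrite -rmorphXn rmorphM /=; congr (_ * _);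
  rewrite fmorphV rmorph_nat.
Qed.

Lemma gauss_poly_sum I (r : seq I) (Q : pred I) (a : I -> R) (F : I -> {poly R}) x :
  gauss_poly (\sum_(i <- r | Q i) a i *: F i) x =
  \sum_(i <- r | Q i) a i * gauss_poly (F i) x.
Proof.
elim/big_rec2: _ => [|i y p _ <-]; last by rewrite gauss_polyD gauss_polyZ.
by rewrite /gauss_poly horner0 mul0r mulr0.
Qed.

Lemma Rintegral_cdf_gauss_poly p x : \int[mu]_(y in `]-oo, x]) gauss_poly p y =
  gauss_int (\1_`]-oo, x]) p.
Proof. exact: Rintegral_indic. Qed.

Lemma std_normal_cdfE x : std_normal_cdf x = gauss_int (\1_`]-oo, x]) (1 : {poly R}).
Proof.
rewrite -Rintegral_cdf_gauss_poly; congr fine; apply: eq_integral => y _; congr EFin.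
rewrite /normal_pdf oner_eq0 /gauss_poly hornerC mul1r /normal_peak /normal_fun.
by rewrite expr1n mul1r subr0 mulNr mulr_natl.
Qed.

Lemma edgeworth_density_cdf tau x :
  \int[mu]_(y in `]-oo, x]) gauss_poly (edgeworth_density tau) y =
  std_normal_cdf x + \sum_(1 <= nu < K.+1) tau ^+ nu *
    (- (Num.sqrt (2 * pi))^-1 * expR (- (x ^+ 2 / 2)) *
     \sum_(k : {ffun 'I_nu -> 'I_nu.+1} | is_weight_solution k)
       hermite (nu + 2 * (\sum_(m < nu) k m) - 1)%N x * weight_coef k).
Proof.
have mI : measurable_fun setT (\1_`]-oo, x] : R -> R) by exact: measurable_indic.
have I1 y : `|(\1_`]-oo, x] : R -> R) y| <= 1.
  by rewrite indicE ger0_norm// lern1 leq_b1.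
rewrite Rintegral_cdf_gauss_poly gauss_int_sum// -(big_mkord xpredT
  (fun nu => tau ^+ nu * gauss_int (\1_`]-oo, x]) (edgeworth_poly nu))).
rewrite big_nat_recl// edgeworth_poly0 expr0 mul1r -std_normal_cdfE.
rewrite big_add1 /=; congr (_ + _); apply: eq_big_nat => nu _; congr (_ * _).
rewrite gauss_int_sum// mulr_sumr; apply: eq_bigr => k _.
(* After the shift of the sum the order is a successor, so the truncated subtraction in the index is
   exact; integrating up to [x] lowers the Hermite index by one. *)
rewrite addSn subn1 /= hermiteE -Rintegral_cdf_gauss_poly gauss_int_cdf.
rewrite /gauss_poly /gauss_exp.
by move: (hermite_poly _).[x] (expR _) (_^-1) (weight_coef k) => a e c b; ring.
Qed.

Lemma edgeworth_density_bound : exists2 M : R, 0 < M & forall tau x,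
  0 <= tau <= 1 ->
  `|gauss_poly (edgeworth_density tau) x| * (1 + x ^+ 2) <= M * expR (- (x ^+ 2 / 4)).
Proof.
have [C hC] := choice (fun nu => let: ex_intro2 C C0 h := gauss_poly_le (edgeworth_poly nu) in
  ex_intro _ C (conj C0 h)).
exists (\sum_(nu < K.+1) C nu).
  rewrite big_ord_recl ltr_pwDl//; first by case: (hC 0%N).
  by apply: sumr_ge0 => i _; apply: ltW; case: (hC (lift ord0 i)).
move=> tau x /andP[t0 t1]; rewrite gauss_poly_sum mulr_suml.
apply: (@le_trans _ _ ((\sum_(nu < K.+1) `|gauss_poly (edgeworth_poly nu) x|) * (1 + x ^+ 2))).
  rewrite ler_wpM2r ?addr_ge0 ?sqr_ge0//; apply: le_trans (ler_norm_sum _ _ _) _.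
  apply: ler_sum => nu _; rewrite normrM normrX ger0_norm// ler_piMl//.
  exact: exprn_ile1.
by rewrite mulr_suml; apply: ler_sum => nu _; case: (hC nu).
Qed.

End EdgeworthDensity.

(** * Smoothing with the Fejer kernel *)

(* Up to normalisation [fejer_cdf] is the distribution function of the Fejer
   kernel [(1 - cos z) / z ^ 2], whose Fourier transform is supported in
   [[-1, 1]]. *)
Section Fejer.
Context {R : realType}.
Local Notation mu := (@lebesgue_measure R).
Implicit Types (s z : R).

Definition fejer_weight s : R := (1 - s) / s * \1_(`]0, 1]%classic) s.

Definition fejer_cdf z : R := \int[mu]_s (fejer_weight s * sin (s * z)).

Let fejer_cdf' z : R := \int[mu]_s ((1 - s) * \1_(`]0, 1]%classic) s * cos (s * z)).

Lemma measurable_fejer_weight : measurable_fun setT fejer_weight.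
Proof.
rewrite /fejer_weight (_ : (fun s => _) = (fun s : R => (1 - s) / s) \_ `]0, 1]); last first.
  by rewrite patch_indic.
apply/(measurable_restrictT _ _).1 => //.
apply: (@measurable_funS _ _ _ _ (`]0, +oo[%classic : set R)) => //.
  by move=> s /=; rewrite !in_itv/= => /andP[->].
apply: open_continuous_measurable_fun; first exact: interval_open.
move=> s; rewrite inE /= in_itv/= andbT => s0.
apply: cvgM; first by apply: cvgB; [exact: cvg_cst|exact: cvg_id].
by apply: cvgV; [rewrite gt_eqF|exact: cvg_id].
Qed.

Lemma fejer_weightM s : fejer_weight s * s = (1 - s) * \1_(`]0, 1]%classic) s.
Proof.
rewrite /fejer_weight indicE; case: (boolP (s \in _)) => [|_]; last by rewrite !mulr0 mul0r.
rewrite inE /= in_itv/= => /andP[s0 _]; rewrite !mulr1 divfK// gt_eqF//.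
Qed.

Lemma tent_bound s : `|(1 - s) * \1_(`]0, 1]%classic) s| <= \1_(`]0, 1]%classic) s.
Proof.
rewrite indicE; case: (boolP (s \in _)) => [|_]; last by rewrite mulr0 normr0.
rewrite inE /= in_itv/= => /andP[s0 s1]; rewrite mulr1 ger0_norm ?subr_ge0//.
by rewrite lerBlDr lerDl ltW.
Qed.

Lemma integrable_indic01 :
  L1 mu (\1_(`]0, 1]%classic) : R -> R).
Proof.
apply: integrable_indic_itv => //.
Qed.

(** The sine cancels the pole of the weight at 0, at the price of a factor [|z|]. This is why first
    moments are needed below for Fubini. *)
Lemma fejer_weight_sin_le s z : `|fejer_weight s * sin (s * z)| <= `|z| * \1_(`]0, 1]%classic) s.
Proof.
rewrite normrM; apply: (@le_trans _ _ (`|fejer_weight s| * `|s * z|)).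
  by rewrite ler_wpM2l// sin_le_abs.
by rewrite -normrM mulrA fejer_weightM normrM mulrC ler_wpM2l// tent_bound.
Qed.

Lemma integrable_fejer z :
  L1 mu (fun s => fejer_weight s * sin (s * z)).
Proof.
apply: (@integrable_dominated _ _ _ mu setT measurableT _ (fun s => `|z| * \1_(`]0, 1]%classic) s)).
- apply: measurable_funM; first exact: measurable_fejer_weight.
  by under eq_fun do rewrite mulrC; exact: measurable_sinM.
- by move=> s _; exact: fejer_weight_sin_le.
- exact: integrable_scale integrable_indic01.
Qed.

Lemma fejer_cdfN z : fejer_cdf (- z) = - fejer_cdf z.
Proof.
rewrite /fejer_cdf -[RHS]mulN1r -RintegralZl//; last exact: integrable_fejer.
by apply: eq_Rintegral => s _; rewrite mulrN sinN; ring.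
Qed.

Lemma is_derive_fejer_cdf z : is_derive z 1 fejer_cdf (fejer_cdf' z).
Proof.
apply: (@is_derive_under_integral _ _ _ mu setT measurableT
  (fun z s => fejer_weight s * sin (s * z))
  (fun z s => (1 - s) * \1_(`]0, 1]%classic) s * cos (s * z)) \1_(`]0, 1]%classic)) => //.
- move=> x s _.
  have dl : is_derive x 1 (fun y : R => s * y) s.
    by have := is_derive_cmul s (is_derive_id x 1); rewrite mulr1.
  have := is_derive_cmul (fejer_weight s)
    (@is_derive_chain _ (@sin R) (fun y => s * y) x _ _ (is_derive_sin (s * x)) dl).
  by move/is_derive_eq; apply; rewrite -fejer_weightM; ring.
- by move=> x; exact: integrable_fejer.
- exact: integrable_indic01.
- move=> x s _; rewrite normrM; apply: le_trans (tent_bound s).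
  by rewrite ler_piMr// cos_max.
Qed.

Lemma fejer_cdf'E z : z != 0 -> fejer_cdf' z = (1 - cos z) / z ^+ 2.
Proof.
move=> z0.
have -> : fejer_cdf' z = \int[mu]_(s in `]0, 1]) ((1 - s) * cos (s * z)).
  by rewrite Rintegral_indic; apply: eq_Rintegral => s _; ring.
have dl (x : R) : is_derive x 1 (fun y : R => y * z) z.
  have := is_derive_cmul z (is_derive_id x 1).
  by under eq_fun do rewrite mulrC; rewrite mulr1.
have dc (x : R) := @is_derive_chain _ (@cos R) (fun y => y * z) x _ _ (is_derive_cos (x * z)) (dl x).
have ds (x : R) := @is_derive_chain _ (@sin R) (fun y => y * z) x _ _ (is_derive_sin (x * z)) (dl x).
have cf : continuous (fun s : R => (1 - s) * cos (s * z)).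
  move=> x; apply: cvgM; first by apply: cvgB; [exact: cvg_cst|exact: cvg_id].
  exact: continuous_of_derive dc x.
have d1 (x : R) : is_derive x 1 (fun y : R => 1 - y) (0 - 1).
  exact: is_derive_sub (is_derive_cst (1 : R) x 1) (is_derive_id x 1).
rewrite Rintegral_itv_obnd_cbnd; last first.
  apply: (@integrableS _ _ _ mu `[0, 1]) => //.
    by move=> s /=; rewrite !in_itv/= => /andP[/ltW->].
  by apply: continuous_compact_integrable; [exact: segment_compact|exact: continuous_subspaceT].
have dF (x : R) : is_derive x 1
    (fun s => z^-1 * ((1 - s) * sin (s * z)) - z ^- 2 * cos (s * z)) ((1 - x) * cos (x * z)).
  have := is_derive_sub (is_derive_cmul z^-1 (is_derive_mul (d1 x) (ds x)))
    (is_derive_cmul (z ^- 2) (dc x)).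
  by move/is_derive_eq; apply; field.
rewrite (Rintegral_FTC ler01 dF cf).
by rewrite !mul0r !mul1r sin0 cos0; field.
Qed.

Lemma fejer_cdf'_ge0 z : 0 <= fejer_cdf' z.
Proof.
have [->|z0] := eqVneq z 0; last first.
  by rewrite fejer_cdf'E// divr_ge0 ?sqr_ge0// subr_ge0 cos_le1.
apply: Rintegral_ge0 => s _; rewrite mulr0 cos0 mulr1 indicE.
case: (boolP (s \in _)) => [|_]; last by rewrite mulr0.
by rewrite inE /= in_itv/= => /andP[_ s1]; rewrite mulr1 subr_ge0.
Qed.

Lemma fejer_cdf_nondecreasing a b : a <= b -> fejer_cdf a <= fejer_cdf b.
Proof.
move=> ab; apply: nondecreasing_of_derive ab _ _ => x _; first exact: is_derive_fejer_cdf.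
exact: fejer_cdf'_ge0.
Qed.

(** The derivative [(1 - cos x) / x ^ 2] is at most [2 / x ^ 2], so [fejer_cdf x + 2 / x] does not
    increase on the positive half line. *)
Lemma fejer_cdf_tail a b : 0 < a -> fejer_cdf b <= fejer_cdf a + 2 / a.
Proof.
move=> a0; have [ba|/ltW ab] := leP b a.
  by apply: le_trans (fejer_cdf_nondecreasing ba) _; rewrite lerDl divr_ge0// ltW.
have b0 : 0 < b by exact: lt_le_trans ab.
suff : - (fejer_cdf a + 2 / a) <= - (fejer_cdf b + 2 / b).
  rewrite lerN2; apply: le_trans; rewrite lerDl divr_ge0// ltW//.
apply: (@nondecreasing_of_derive _ (fun x => - (fejer_cdf x + 2 / x))
  (fun x => - (fejer_cdf' x + 2 * (- 1 * (x^-1 * x^-1)))) a b ab).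
  move=> x /andP[ax _]; have x0 : x != 0 by rewrite gt_eqF// (lt_le_trans a0).
  exact: is_derive_opp (is_derive_add (is_derive_fejer_cdf x)
    (is_derive_cmul 2 (@is_derive_inv _ id x 1 x0 (is_derive_id x 1)))).
move=> x /andP[ax _]; have x0 : 0 < x by exact: lt_le_trans ax.
rewrite fejer_cdf'E ?gt_eqF// oppr_ge0 -expr2 mulN1r mulrN subr_le0 exprVn.
by rewrite ler_wpM2r ?invr_ge0 ?sqr_ge0// lerBlDr; have := cos_geN1 x; lra.
Qed.

(** The constant is the supremum; oddness turns it into a two-sided bound. It is positive, since
    otherwise the function would vanish identically, whereas its derivative at [pi] is
    [2 / pi ^ 2]. *)
Lemma fejer_cdf_limit : exists2 c : R, 0 < c &
  (forall z, `|fejer_cdf z| <= c) /\ forall z, 0 < z -> c - fejer_cdf z <= 2 / z.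
Proof.
pose E := range fejer_cdf.
have hE : has_sup E.
  split; first by exists (fejer_cdf 0); exists 0.
  by exists (fejer_cdf 1 + 2 / 1) => _ [z _ <-]; exact: fejer_cdf_tail.
have ub z : fejer_cdf z <= sup E by apply: sup_upper_bound => //; exists z.
have ab z : `|fejer_cdf z| <= sup E.
  by rewrite ler_norml ub andbT lerNl -fejer_cdfN.
exists (sup E); last first.
  split=> // z z0; rewrite lerBlDr addrC; apply: sup_le_ub; first by exists (fejer_cdf 0); exists 0.
  by move=> _ [b _ <-]; exact: fejer_cdf_tail.
rewrite lt_neqAle (le_trans _ (ab 0))// andbT eq_sym; apply/eqP => s0.
have F0 : fejer_cdf = cst 0.
  by apply/funext => z; apply/eqP; rewrite -normr_le0 -s0.
have := is_derive_fejer_cdf pi; rewrite F0 => -[_]; rewrite derive_cst fejer_cdf'E ?gt_eqF ?pi_gt0//.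
rewrite cospi opprK => /esym/eqP; rewrite mulf_eq0 invr_eq0 sqrf_eq0 gt_eqF//= gt_eqF// pi_gt0//.
Qed.

End Fejer.

Section FejerTransform.
Context d (T : measurableType d) (R : realType) (m : {sigma_finite_measure set T -> \bar R}).
Local Notation mu := (@lebesgue_measure R).
Variables (Y w : T -> R).
Hypotheses (mY : measurable_fun setT Y) (iw : L1 m w).
Hypothesis iYw : L1 m (fun t => Y t * w t).

Let mw : measurable_fun setT w := integrable_measurable iw.

Lemma integrable_bounded_mul (f : T -> R) (B : R) : measurable_fun setT f ->
  (forall t, `|f t| <= B) -> L1 m (fun t => w t * f t).
Proof.
move=> mf fB; apply: (@integrable_dominated _ _ _ m setT measurableT _ (fun t => B * `|w t|)).
- exact: measurable_funM.
- by move=> t _; rewrite normrM mulrC ler_wpM2r.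
- by apply: integrable_scale => //; exact: integrable_norm.
Qed.

Definition fourier_cos (u : R) : R := \int[m]_t (w t * cos (u * Y t)).
Definition fourier_sin (u : R) : R := \int[m]_t (w t * sin (u * Y t)).

Lemma integrable_fourier_cos u : L1 m (fun t => w t * cos (u * Y t)).
Proof.
apply: (@integrable_bounded_mul (fun t => cos (u * Y t)) 1) => [|t]; last exact: cos_max.
by apply: (measurableT_comp (measurable_cosM u)).
Qed.

Lemma integrable_fourier_sin u : L1 m (fun t => w t * sin (u * Y t)).
Proof.
apply: (@integrable_bounded_mul (fun t => sin (u * Y t)) 1) => [|t]; last exact: sin_max.
by apply: (measurableT_comp (measurable_sinM u)).
Qed.

Let F (S x : R) (z : measurableTypeR R * T) : R :=
  fejer_weight z.1 * sin (z.1 * (S * (x - Y z.2))) * w z.2.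

Let mF S x : measurable_fun setT (F S x).
Proof.
apply: measurable_funM; last by apply: (measurableT_comp mw).
apply: measurable_funM.
  exact: (measurableT_comp (@measurable_fejer_weight R)).
apply: (measurableT_comp (continuous_measurable_fun (@continuous_sin R))).
apply: measurable_funM => //; apply: measurable_funM => //.
by apply: measurable_funB => //; apply: (measurableT_comp mY).
Qed.

Let innerE S x t : (\int[mu]_s (F S x (s, t))%:E)%E = (w t * fejer_cdf (S * (x - Y t)))%:E.
Proof.
rewrite /F /=; under eq_integral do rewrite EFinM.
rewrite integralZr//; last exact: integrable_fejer.
rewrite [RHS]EFinM muleC; congr (_ * _)%E; rewrite /fejer_cdf /Rintegral fineK//.
apply: integrable_fin_num => //; exact: integrable_fejer.
Qed.

(** The inner integral over [s] is at most [G t], because the indicator has integral 1; [G] is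
    integrable since [w] and [Y w] are. *)
Let iF S x : (mu \x m)%E.-integrable setT (EFin \o F S x).
Proof.
apply/integrable21ltyP; first exact/measurable_EFinP.
pose G (t : T) := `|S| * (`|x| * `|w t| + `|Y t * w t|).
have iG : L1 m G.
  apply: integrable_scale => //; apply: integrable_add => //.
    by apply: integrable_scale => //; exact: integrable_norm.
  exact: integrable_norm.
apply: (@le_lt_trans _ _ (\int[m]_t (G t)%:E)%E); last first.
  have /integrableP[_] := iG; apply: le_lt_trans; apply: ge0_le_integral => //.
  - by move=> t _; rewrite lee_fin mulr_ge0// addr_ge0// mulr_ge0.
  - by apply: (measurable_int m).
  - by apply: measurableT_comp => //; apply: (measurable_int m).
  - by move=> t _ /=; rewrite lee_fin ler_norm.
have mS : measurable_fun setT (fun t => (\int[mu]_s `|(EFin \o F S x) (s, t)|)%E).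
  apply: (@measurable_fun_fubini_tonelli_G _ _ _ _ _ mu (fun z => `|(EFin \o F S x) z|%E)) => //.
  by apply: measurableT_comp => //; exact/measurable_EFinP.
apply: ge0_le_integral => //.
- by move=> t _; exact: integral_ge0.
- by apply: (measurable_int m).
- move=> t _; apply: (@le_trans _ _ (\int[mu]_s (G t * \1_(`]0, 1]%classic) s)%:E)%E).
    apply: ge0_le_integral => //.
    + apply: measurableT_comp => //; apply/measurable_EFinP.
      by apply: (measurableT_comp (mF S x)).
    + by apply/measurable_EFinP; apply: measurable_funM => //; exact: measurable_indic.
    move=> s _ /=; rewrite lee_fin /F /= normrM.
    apply: le_trans (ler_wpM2r (normr_ge0 _) (fejer_weight_sin_le _ _)) _.
    rewrite mulrAC ler_wpM2r//.
    rewrite normrM -mulrA ler_wpM2l// (normrM (Y t)) -mulrDl ler_wpM2r//.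
    exact: ler_normB.
  under eq_integral do rewrite EFinM.
  rewrite integralZl//; last exact: integrable_indic01.
  rewrite integral_indic// setIT [X in (_ * X)%E](_ : _ = 1%E) ?mule1//.
  by rewrite /= lebesgue_measure_itv /= lte_fin ltr01 oppr0 adde0.
Qed.

Let outerE S x s : (\int[m]_t (F S x (s, t))%:E)%E =
  (fejer_weight s * (sin (s * S * x) * fourier_cos (s * S) -
    cos (s * S * x) * fourier_sin (s * S)))%:E.
Proof.
have ic := integrable_fourier_cos (s * S); have is_ := integrable_fourier_sin (s * S).
rewrite -RintegralZl// -[X in _ - X]RintegralZl// -RintegralB//; last 2 first.
- exact: integrable_scale.
- exact: integrable_scale.
have iD : L1 m (fun t => sin (s * S * x) * (w t * cos (s * S * Y t)) -
    cos (s * S * x) * (w t * sin (s * S * Y t))).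
  by apply: integrable_sub => //; exact: integrable_scale.
rewrite -RintegralZl// /Rintegral fineK; last first.
  by apply: integrable_fin_num => //; exact: integrable_scale.
apply: eq_integral => t _; congr EFin; rewrite /F /=.
rewrite (_ : s * (S * (x - Y t)) = s * S * x - s * S * Y t); last by ring.
by rewrite sinB; ring.
Qed.

Definition fourier_kernel (S x s : R) : R :=
  fejer_weight s * (sin (s * S * x) * fourier_cos (s * S) - cos (s * S * x) * fourier_sin (s * S)).

Lemma integrable_fourier_kernel S x : L1 mu (fourier_kernel S x).
Proof.
have := integrable_fubini_F (iF S x); apply: eq_integrable => // s _.
exact: outerE.
Qed.

(** Fubini. The measure and the weight are left general for two uses: the probability with weight 1,
    and Lebesgue measure with [Y] the identity and [w] the Edgeworth density. *)
Lemma fejer_transform S x :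
  \int[m]_t (w t * fejer_cdf (S * (x - Y t))) = \int[mu]_s fourier_kernel S x s.
Proof.
rewrite /Rintegral; congr fine.
under eq_integral do rewrite -innerE.
rewrite -(Fubini (iF S x)); apply: eq_integral => s _.
exact: outerE.
Qed.

End FejerTransform.

Lemma measurable_fejer_cdf (R : realType) : measurable_fun setT (@fejer_cdf R).
Proof.
exact: continuous_measurable_fun (continuous_of_derive (@is_derive_fejer_cdf R)).
Qed.

(** Here [p] is the probability, [i1] and [i2] its smoothed versions at [x + h] and [x - h], [j1]
    and [j2] those of the signed density, and [G] the integral of that density up to [x]. *)
Lemma smoothing_sandwich (R : realType) (p i1 j1 i2 j2 G W e k : R) :
  p <= i1 + e -> i2 <= p + e -> `|i1 - j1| <= W -> `|i2 - j2| <= W ->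
  `|j1 - G| <= k -> `|j2 - G| <= k -> `|p - G| <= W + e + k.
Proof.
move=> h1 h2; rewrite !ler_norml => /andP[p1 p2] /andP[p3 p4] /andP[p5 p6] /andP[p7 p8].
by apply/andP; split; lra.
Qed.

(** * The smoothing inequality *)

Section Smoothing.
Context d (T : measurableType d) (R : realType) (P : probability T R).
Local Notation mu := (@lebesgue_measure R).
Variables (Y : {RV P >-> R}) (g : R -> R) (M c : R).
Hypothesis iY : L1 P Y.
Hypotheses (ig : L1 mu g)
  (iyg : L1 mu (fun y => y * g y)).
Hypotheses (gM : forall y, `|g y| <= M) (g_L1 : \int[mu]_y `|g y| <= M)
  (g1 : \int[mu]_y g y = 1).
Hypotheses (c0 : 0 < c) (fejer_le : forall z : R, `|fejer_cdf z| <= c)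
  (fejer_lim : forall z : R, 0 < z -> c - fejer_cdf z <= 2 / z).

(** The Fejer distribution function, normalised to rise from 0 to 1: [A (S * (a - y))] is a smooth
    version of the indicator of [y < a] at scale [1 / S]. *)
Let A (z : R) : R := (fejer_cdf z + c) / (2 * c).

Let A01 z : 0 <= A z <= 1.
Proof.
have := fejer_le z; rewrite ler_norml => /andP[h1 h2].
have c2 : 0 < 2 * c by rewrite mulr_gt0.
apply/andP; split; first by rewrite divr_ge0 ?(ltW c2)// -lerBlDr sub0r.
by rewrite ler_pdivrMr// mul1r mulr2n mulrDl mul1r lerD2r.
Qed.

Let A_hi r z : 0 < r -> r <= z -> 1 - A z <= (c * r)^-1.
Proof.
move=> r0 rz; have z0 := lt_le_trans r0 rz.
have -> : 1 - A z = (c - fejer_cdf z) / (2 * c) by rewrite /A; field; rewrite gt_eqF.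
rewrite ler_pdivrMr ?mulr_gt0//; apply: le_trans (fejer_lim z0) _.
rewrite (_ : (c * r)^-1 * _ = 2 / r); last by field; rewrite !gt_eqF.
by rewrite ler_wpM2l// lef_pV2.
Qed.

Let A_lo r z : 0 < r -> z <= - r -> A z <= (c * r)^-1.
Proof.
move=> r0 zr; have -> : A z = 1 - A (- z).
  by rewrite /A fejer_cdfN; field; rewrite gt_eqF.
by apply: A_hi => //; rewrite lerNr.
Qed.

Let mA : measurable_fun setT A.
Proof.
apply: measurable_funM => //; apply: measurable_funD => //.
exact: measurable_fejer_cdf.
Qed.

Let mAY S a : measurable_fun setT (fun t => A (S * (a - Y t))).
Proof.
apply: (measurableT_comp mA); apply: measurable_funM => //.
by apply: measurable_funB.
Qed.

Let mAg S a : measurable_fun setT (fun y : R => A (S * (a - y))).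
Proof.
apply: (measurableT_comp mA); apply: measurable_funM => //.
exact: measurable_funB.
Qed.

Let iAY S a : L1 P (fun t => A (S * (a - Y t))).
Proof.
apply: (@bounded_integrable _ _ _ P _ 1) => [|t]; first exact: mAY.
by have /andP[h1 h2] := A01 (S * (a - Y t)); rewrite ger0_norm.
Qed.

Let iAg S a : L1 mu (fun y => g y * A (S * (a - y))).
Proof.
apply: (@integrable_bounded_mul _ _ _ mu g ig _ 1) => [|t]; first exact: mAg.
by have /andP[h1 h2] := A01 (S * (a - t)); rewrite ger0_norm.
Qed.

Let charg (u : R) : R[i] := Complex (fourier_cos mu id g u) (fourier_sin mu id g u).

(** Both integrals have total mass 1, so the constants in [A] cancel and a difference of Fejer
    transforms remains. At frequency [s] its kernel is at most [1 / s] times the distance of the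
    characteristic functions, which is why the hypothesis carries a factor [s]. *)
Lemma smoothed_difference (S a : R) (B : R -> R) :
  L1 mu (fun s => B s * \1_(`]0, 1]%classic) s) ->
  (forall s, 0 < s <= 1 -> normc (char_fun P Y (s * S) - charg (s * S)) <= s * B s) ->
  `|\int[P]_t A (S * (a - Y t)) - \int[mu]_y (g y * A (S * (a - y)))| <=
  (2 * c)^-1 * \int[mu]_s (B s * \1_(`]0, 1]%classic) s).
Proof.
move=> iB hB.
have i1 := integrable_cstT P 1.
have iY1 : L1 P (fun t => Y t * (cst 1 : T -> R) t).
  by rewrite (_ : (fun t => _) = Y)//; apply/funext => t; rewrite /= mulr1.
have mY : measurable_fun setT Y by exact: measurable_funPT.
have fP := @fejer_transform _ _ _ P Y (cst 1) mY i1 iY1 S a.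
have fg := @fejer_transform _ _ _ mu id g (@measurable_id _ _ _) ig iyg S a.
have kP := @integrable_fourier_kernel _ _ _ P Y (cst 1) mY i1 iY1 S a.
have kg := @integrable_fourier_kernel _ _ _ mu id g (@measurable_id _ _ _) ig iyg S a.
have c20 : 0 < (2 * c)^-1 by rewrite invr_gt0 mulr_gt0.
have fb : forall z : R, `|fejer_cdf z| <= c := fejer_le.
have iSY : L1 P (fun t => (cst 1 : T -> R) t * fejer_cdf (S * (a - Y t))).
  apply: (@integrable_bounded_mul _ _ _ P _ i1 _ c) => //.
  apply: (measurableT_comp (@measurable_fejer_cdf R)); apply: measurable_funM => //.
  exact: measurable_funB.
have iSg : L1 mu (fun y => g y * fejer_cdf (S * (a - y))).
  apply: (@integrable_bounded_mul _ _ _ mu _ ig _ c) => //.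
  apply: (measurableT_comp (@measurable_fejer_cdf R)); apply: measurable_funM => //.
  exact: measurable_funB.
have EP : \int[P]_t A (S * (a - Y t)) =
    (2 * c)^-1 * \int[P]_t ((cst 1 : T -> R) t * fejer_cdf (S * (a - Y t))) + 2^-1.
  rewrite -RintegralZl// -[2^-1](Rintegral_cstT P) -RintegralD//; last 2 first.
  - exact: integrable_scale.
  - exact: integrable_cstT.
  apply: eq_Rintegral => t _; rewrite /A mul1r; field; rewrite gt_eqF//.
have Eg : \int[mu]_y (g y * A (S * (a - y))) =
    (2 * c)^-1 * \int[mu]_y (g y * fejer_cdf (S * (a - y))) + 2^-1.
  have E2 : 2^-1 = 2^-1 * \int[mu]_y g y by rewrite g1 mulr1.
  rewrite -RintegralZl// [X in _ + X]E2 -RintegralZl// -RintegralD//; last 2 first.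
  - exact: integrable_scale.
  - exact: integrable_scale.
  apply: eq_Rintegral => t _; rewrite /A; field; rewrite gt_eqF//.
rewrite EP Eg fP fg opprD addrACA subrr addr0 -mulrBr normrM (gtr0_norm c20).
apply: ler_wpM2l; first exact: ltW.
rewrite -RintegralB//; apply: le_norm_Rintegral => //; first exact: integrable_sub.
move=> s _; rewrite /fourier_kernel -mulrBr.
have [s01|s01] := boolP (s \in (`]0, 1]%classic : set R)); last first.
  by rewrite /fejer_weight indicE (negbTE s01) !mulr0 mul0r normr0.
have s01' : 0 < s <= 1 by move: s01; rewrite inE /= in_itv.
have := hB _ s01'; rewrite indicE s01 mulr1 => hs.
have /andP[s0 s1] := s01'.
have fw : `|fejer_weight s| <= s^-1.
  rewrite /fejer_weight indicE s01 mulr1 normrM (gtr0_norm (x := s^-1)) ?invr_gt0//.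
  have h : `|1 - s| <= 1 by rewrite ger0_norm ?subr_ge0//; lra.
  by rewrite ler_piMl// invr_ge0 ltW.
rewrite normrM; apply: (@le_trans _ _ (s^-1 * (s * B s))); last first.
  by rewrite mulrA mulVf ?mul1r// gt_eqF.
apply: ler_pM => //; apply: le_trans hs.
rewrite char_funE [_ - charg _](_ : _ = Complex
  (fourier_cos P Y (cst 1) (s * S) - fourier_cos mu id g (s * S))
  (fourier_sin P Y (cst 1) (s * S) - fourier_sin mu id g (s * S))); last first.
  apply/eqP; rewrite eq_complex /=; apply/andP; split; apply/eqP; congr (_ - _).
    by apply: eq_Rintegral => t _; rewrite mul1r.
  by apply: eq_Rintegral => t _; rewrite mul1r.
have sc : sin (s * S * a) ^+ 2 + (- cos (s * S * a)) ^+ 2 = 1.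
  by rewrite sqrrN addrC cos2Dsin2.
apply: le_trans (rotation_le_normc _ sc).
by rewrite le_eqVlt; apply/orP; left; apply/eqP; congr `|_| => /=; ring.
Qed.

(** Outside a window of half-width [2 h] around [x], the points are at distance at least [h] from
    [a], where the smooth step is within [1 / (c S h)] of the sharp one. The window has length [4 h]
    and the density is at most [M] there; [M] bounds both its sup norm and its integral norm. *)
Lemma smoothed_density (S h a x : R) : 0 < S -> 0 < h -> `|a - x| <= h ->
  `|\int[mu]_y (g y * A (S * (a - y))) - \int[mu]_(y in `]-oo, x]) g y| <=
  M / (c * (S * h)) + M * (4 * h).
Proof.
move=> S0 h0 ax; have Sh0 : 0 < S * h by rewrite mulr_gt0.
pose I : set R := `]-oo, x]%classic; pose J : set R := `[x - 2 * h, x + 2 * h]%classic.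
have M0 : 0 <= M by apply: le_trans (gM 0).
have e0 : 0 < (c * (S * h))^-1 by rewrite invr_gt0 mulr_gt0.
rewrite [X in _ - X]Rintegral_indic -/I.
have iI : L1 mu (fun y => g y * \1_I y).
  apply: (@integrable_bounded_mul _ _ _ mu _ ig _ 1) => [|y].
    by apply: measurable_indic; exact: measurable_itv.
  by rewrite indicE ger0_norm// lern1 leq_b1.
have iJ : L1 mu (\1_J : R -> R) by exact: integrable_indic_itv.
have ng : L1 mu (fun y => `|g y|) by exact: integrable_norm.
rewrite -RintegralB//.
apply: (@le_trans _ _ (\int[mu]_y ((c * (S * h))^-1 * `|g y| + M * \1_J y))).
  apply: le_norm_Rintegral => //; first exact: integrable_sub.
    by apply: integrable_add => //; exact: integrable_scale.
  move=> y _; rewrite -mulrBr normrM.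
  have /andP[A0 A1] := A01 (S * (a - y)).
  have I01 : 0 <= (\1_I y : R) <= 1 by rewrite indicE ler0n lern1 leq_b1.
  have [yJ|yJ] := boolP (y \in J).
    rewrite [\1_J y]indicE yJ mulr1 ler_wpDl// ?mulr_ge0 ?(ltW e0)//.
    rewrite -[leRHS]mulr1; apply: ler_pM => //.
    by move: I01; move: (\1_I y) => e /andP[? ?]; rewrite ler_norml; apply/andP; split; lra.
  rewrite [\1_J y]indicE (negbTE yJ) mulr0 addr0 mulrC; apply: ler_wpM2r => //.
  move: ax; rewrite ler_norml => /andP[ax1 ax2].
  have [yx|xy] := leP y x.
    have yI : y \in I by rewrite inE /I /= in_itv.
    rewrite indicE yI distrC ger0_norm ?subr_ge0//; apply: A_hi => //.
    rewrite ler_pM2l// lerBrDr; move: yJ; rewrite notin_setE /J /= in_itv/= => /negP.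
    by rewrite negb_and -!ltNge => /orP[]; lra.
  have yI : y \notin I by rewrite notin_setE /I /= in_itv/=; apply/negP; rewrite -ltNge.
  rewrite indicE (negbTE yI) subr0 ger0_norm//; apply: A_lo => //.
  rewrite -mulrN ler_pM2l//; move: yJ; rewrite notin_setE /J /= in_itv/= => /negP.
  by rewrite negb_and -!ltNge => /orP[]; lra.
rewrite RintegralD//; last 2 first.
- exact: integrable_scale.
- exact: integrable_scale.
rewrite !RintegralZl//; apply: lerD.
  by rewrite mulrC ler_wpM2r// ltW.
have mJ : measurable (J : set (measurableTypeR R)) by exact: measurable_itv.
have -> : \int[mu]_y \1_J y = fine (mu J).
  by rewrite /Rintegral; congr fine; rewrite (integral_indic mu measurableT mJ) setIT.
apply: ler_wpM2l => //.
rewrite /J /= lebesgue_measure_itv /= lte_fin ifT; last by lra.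
by rewrite -EFinB /=; lra.
Qed.

(** Up to [eta], the indicator of [Y < x] lies between the smooth steps at [x - h] and [x + h]. The
    density may take negative values, so monotonicity is used for the probability only;
    [smoothed_density] handles the other side. *)
Lemma smoothing_inequality (S h x : R) (B : R -> R) : 0 < S -> 0 < h ->
  L1 mu (fun s => B s * \1_(`]0, 1]%classic) s) ->
  (forall s, 0 < s <= 1 -> normc (char_fun P Y (s * S) - charg (s * S)) <= s * B s) ->
  `|fine (P [set t | Y t < x]) - \int[mu]_(y in `]-oo, x]) g y| <=
  (2 * c)^-1 * \int[mu]_s (B s * \1_(`]0, 1]%classic) s) +
    (1 + M) / (c * (S * h)) + M * (4 * h).
Proof.
move=> S0 h0 iB hB; have Sh0 : 0 < S * h by rewrite mulr_gt0.
pose D : set T := [set t | Y t < x].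
have mD : measurable D.
  rewrite (_ : D = Y @^-1` `]-oo, x[); last by apply/seteqP; split=> t /=; rewrite in_itv.
  rewrite -[X in measurable X]setTI; exact: (measurable_funPT Y).
have PD : fine (P D) = \int[P]_t \1_D t by rewrite /Rintegral integral_indic// setIT.
have iD : L1 P (\1_D : T -> R).
  apply: (@bounded_integrable _ _ _ P _ 1) => [|t]; first exact: measurable_indic.
  by rewrite indicE ger0_norm// lern1 leq_b1.
have ic := integrable_cstT P.
set eta := (c * (S * h))^-1.
have e0 : 0 < eta by rewrite invr_gt0 mulr_gt0.
have hi : fine (P D) <= \int[P]_t A (S * (x + h - Y t)) + eta.
  rewrite PD -[X in _ <= _ + X](Rintegral_cstT P) -RintegralD//.
  apply: le_Rintegral => //; first by apply: integrable_add => //; exact: ic.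
  move=> t _; have /andP[A0 A1] := A01 (S * (x + h - Y t)).
  rewrite indicE; have [tD|tD] := boolP (t \in D); last by rewrite addr_ge0// ltW.
  rewrite -lerBlDl; apply: A_hi => //; rewrite ler_pM2l//.
  by move: tD; rewrite inE /D /=; lra.
have lo : \int[P]_t A (S * (x - h - Y t)) <= fine (P D) + eta.
  rewrite PD -[X in _ <= _ + X](Rintegral_cstT P) -RintegralD//.
  apply: le_Rintegral => //; first by apply: integrable_add => //; exact: ic.
  move=> t _; have /andP[A0 A1] := A01 (S * (x - h - Y t)).
  rewrite indicE; have [tD|tD] := boolP (t \in D).
    by apply: le_trans A1 _; rewrite lerDl ltW.
  rewrite add0r; apply: A_lo => //; rewrite -mulrN ler_pM2l//.
  by move: tD; rewrite notin_setE /D /= => /negP; rewrite -leNgt; lra.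
have dhi := smoothed_difference (x + h) iB hB.
have dlo := smoothed_difference (x - h) iB hB.
have ghi : `|x + h - x| <= h by rewrite addrC addKr ger0_norm// ltW.
have glo : `|x - h - x| <= h by rewrite addrC addKr normrN ger0_norm// ltW.
have {ghi} ghi := smoothed_density S0 h0 ghi.
have {glo} glo := smoothed_density S0 h0 glo.
rewrite -/eta in ghi glo; rewrite -/eta (_ : (1 + M) * eta = eta + M * eta); last by ring.
by rewrite (addrA _ eta) -[leRHS]addrA; exact: smoothing_sandwich hi lo dhi dlo ghi glo.
Qed.

End Smoothing.

(** * The Edgeworth expansion *)

Section Bounds.
Context {R : realType}.
Local Notation mu := (@lebesgue_measure R).

(** [exp y >= y ^ m / m!] at [y = b / tau ^ 2]. *)
Lemma expR_inv_sqr_le (b : R) (m : nat) : 0 < b -> exists2 C : R, 0 < C &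
  forall tau : R, 0 < tau -> expR (- (b / tau ^+ 2)) <= C * tau ^+ m.*2.
Proof.
move=> b0; have f0 : 0 < m`!%:R :> R by rewrite ltr0n fact_gt0.
have bm : 0 < b ^+ m by rewrite exprn_gt0.
exists (m`!%:R / b ^+ m); first exact: divr_gt0.
move=> tau t0; have t2 : 0 < tau ^+ 2 by rewrite exprn_gt0.
have x0 : 0 < b / tau ^+ 2 by rewrite divr_gt0.
have h : (b / tau ^+ 2) ^+ m / m`!%:R <= expR (b / tau ^+ 2).
  apply: le_trans (expR_sum_ge m.+1 (ltW x0)); rewrite big_ord_recr /= lerDr.
  by apply: sumr_ge0 => i _; rewrite divr_ge0// exprn_ge0// ltW.
have q0 : 0 < (b / tau ^+ 2) ^+ m / m`!%:R by rewrite divr_gt0// exprn_gt0.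
rewrite expRN; apply: (@le_trans _ _ ((b / tau ^+ 2) ^+ m / m`!%:R)^-1).
  by rewrite lef_pV2 ?posrE ?expR_gt0.
rewrite invf_div expr_div_n -exprM mul2n invf_div mulrA.
by rewrite mulrAC.
Qed.

(** The primitive is [atan (s S)], so the bound [pi / 2 <= 2] is uniform in the cutoff [S]: the
    local error costs [O(a)] however far the frequencies go. *)
Lemma Rintegral_cauchy_le (S : R) : 0 < S ->
  \int[mu]_s (S / (1 + (s * S) ^+ 2) * \1_(`]0, 1]%classic) s) <= 2 /\
  L1 mu (fun s => S / (1 + (s * S) ^+ 2) * \1_(`]0, 1]%classic) s).
Proof.
move=> S0.
have p (s : R) : 0 < 1 + (s * S) ^+ 2 by rewrite ltr_pwDl// sqr_ge0.
have dl (x : R) : is_derive x 1 (fun y : R => y * S) S.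
  have := is_derive_cmul S (is_derive_id x 1).
  by under eq_fun do rewrite mulrC; rewrite mulr1.
have dA (x : R) : is_derive x 1 (fun y => atan (y * S)) (S / (1 + (x * S) ^+ 2)).
  have := @is_derive_chain _ (@atan R) (fun y => y * S) x _ _ (is_derive1_atan (x * S)) (dl x).
  by move/is_derive_eq; apply; rewrite mulrC.
have cf : continuous (fun s : R => S / (1 + (s * S) ^+ 2)).
  move=> x; apply: cvgM; first exact: cvg_cst.
  apply: cvgV; first by rewrite gt_eqF.
  apply: cvgD; first exact: cvg_cst.
  apply: (@cvgM _ _ _ _ (fun s => s * S) (fun s => s * S)).
    by apply: cvgM; [exact: cvg_id|exact: cvg_cst].
  by apply: cvgM; [exact: cvg_id|exact: cvg_cst].
have icc : mu.-integrable `[0, 1] (EFin \o (fun s : R => S / (1 + (s * S) ^+ 2))).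
  by apply: continuous_compact_integrable; [exact: segment_compact|exact: continuous_subspaceT].
have ioc : mu.-integrable `]0, 1] (EFin \o (fun s : R => S / (1 + (s * S) ^+ 2))).
  apply: integrableS icc => //.
  by move=> s /=; rewrite !in_itv/= => /andP[/ltW->].
split.
  rewrite -Rintegral_indic Rintegral_itv_obnd_cbnd// (Rintegral_FTC ler01 dA cf).
  rewrite mul0r atan0 subr0; apply: (le_trans (ltW (atan_ltpi2 _))).
  by have [/andP[]] := pihalf_02_cos_pihalf R.
have mJ : measurable (`]0, 1]%classic : set (measurableTypeR R)) by exact: measurable_itv.
have := (integrable_mkcond _ mJ).1 ioc.
by rewrite restrict_EFin patch_indic.
Qed.

End Bounds.

Section EdgeworthBound.
Context d (T : measurableType d) (R : realType) (P : probability T R).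
Local Notation mu := (@lebesgue_measure R).
Variables (K : nat) (V : R) (gam : nat -> R).
Local Notation density tau := (gauss_poly (edgeworth_density K V gam tau)).

(** The constant depends only on the expansion, not on [Y], [tau] or [x]; this is the source of
    uniformity. *)
Lemma edgeworth_bound : exists2 C : R, 0 < C &
  forall (Y : {RV P >-> R}) (tau delta Q a : R), L1 P Y ->
  0 < tau <= 1 -> 0 < delta -> 0 <= a -> 0 <= Q ->
  (forall s, 0 <= s -> s * tau <= delta ->
    normc (char_fun P Y s - ghat K V gam tau s) <= a * (s / (1 + s ^+ 2))) ->
  (forall s, 0 <= s -> delta <= s * tau -> normc (char_fun P Y s) <= Q) ->
  forall x, `|fine (P [set t | Y t < x]) - \int[mu]_(y in `]-oo, x]) density tau y| <=
    C * (a + tau ^- (2 * K + 1) / delta * (Q + expR (- (delta ^+ 2 / 4 / tau ^+ 2))) +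
         tau ^+ K.+1).
Proof.
have [C1 C10 hC1] := @ghat_bound R K V gam.
have [M0 M00 hM0] := edgeworth_density_bound K V gam.
have [c c0 [hc1 hc2]] := @fejer_cdf_limit R.
have ig4 := @integrable_gauss4 R.
pose I4 : R := \int[mu]_x expR (- (x ^+ 2 / 4)).
have I40 : 0 <= I4 by apply: Rintegral_ge0 => x _; exact: expR_ge0.
pose M := M0 * (1 + I4).
have M_gt0 : 0 < M by rewrite mulr_gt0// ltr_pwDl.
have c2 : 0 < (2 * c)^-1 by rewrite invr_gt0 mulr_gt0.
exists (2 * (2 * c)^-1 + (2 * c)^-1 * (1 + C1) + (1 + M) / c + M * 4).
  have M1 : 0 < 1 + M by rewrite addr_gt0.
  have C11 : 0 < 1 + C1 by rewrite addr_gt0.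
  apply: addr_gt0; last exact: mulr_gt0.
  apply: addr_gt0; last exact: divr_gt0.
  by apply: addr_gt0; exact: mulr_gt0.
move=> Y tau delta Q a iY /andP[t0 t1] d0 a0 Q0 hloc htail x.
have tau01 : 0 <= tau <= 1 by rewrite (ltW t0).
pose g : R -> R := density tau.
have ig : L1 mu g := integrable_gauss_poly _.
have gb y : `|g y| <= M0 * expR (- (y ^+ 2 / 4)).
  apply: le_trans (hM0 tau y tau01); rewrite ler_peMr// lerDl sqr_ge0//.
have iyg : L1 mu (fun y => y * g y).
  have := @integrable_gauss_polyM R (edgeworth_density K V gam tau) id (@measurable_id _ _ _) (@le_1Dsqr R).
  by apply: eq_integrable => // y _ /=; rewrite mulrC.
have gM y : `|g y| <= M.
  apply: le_trans (gb y) _; rewrite ler_wpM2l ?(ltW M00)//.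
  apply: (@le_trans _ _ 1); last by rewrite lerDl.
  by rewrite -[leRHS]expR0 ler_expR oppr_le0 divr_ge0// sqr_ge0.
have gL1 : \int[mu]_y `|g y| <= M.
  apply: (@le_trans _ _ (\int[mu]_y (M0 * expR (- (y ^+ 2 / 4))))).
    apply: le_Rintegral => //; first exact: integrable_norm.
    exact: integrable_scale.
  rewrite RintegralZl// -/I4 ler_wpM2l ?(ltW M00)//; lra.
have chargE u : Complex (fourier_cos mu id g u) (fourier_sin mu id g u) = ghat K V gam tau u.
  exact: gauss_int_edgeworth_density.
(* [hloc] at [s = 0] forces [ghat tau 0 = 1]. *)
have g1 : \int[mu]_y g y = 1.
  have : normc (char_fun P Y 0 - ghat K V gam tau 0) <= 0.
    by have := hloc 0 (lexx _); rewrite !mul0r mulr0; apply; exact: ltW.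
  rewrite char_fun0 -chargE => h0.
  have /eqP : 1 - Complex (fourier_cos mu id g 0) (fourier_sin mu id g 0) = 0.
    by apply: Normc.eq0_normc; apply/eqP; rewrite eq_le h0 normc_ge0.
  rewrite subr_eq0 => /eqP/(congr1 (@complex.Re R)) /= E; rewrite [RHS]E.
  by apply: eq_Rintegral => y _; rewrite mul0r cos0 mulr1.
(* This choice gives [1 / (S h) = h = tau ^ (K + 1)]. The names are introduced opaquely, with an
   equation to rewrite when needed. *)
have [S SE'] : {S : R | S = tau ^- (2 * K + 2)} by eexists.
have [h hE] : {h : R | h = tau ^+ K.+1} by eexists.
have S0 : 0 < S by rewrite SE' invr_gt0 exprn_gt0.
have h0 : 0 < h by rewrite hE exprn_gt0.
have [e4 e4E] : {e : R | e = expR (- (delta ^+ 2 / 4 / tau ^+ 2))} by eexists.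
have e40 : 0 <= e4 by rewrite e4E expR_ge0.
(* The smoothing inequality wants an error of the form [s * B s]. In the range [delta <= s S tau]
   the constant tail bound is multiplied by [s S tau / delta >= 1] to acquire the factor [s]. *)
have [E EE] : {E : R | E = S * tau / delta * (Q + C1 * e4)} by eexists.
have E0 : 0 <= E.
  rewrite EE; apply: mulr_ge0; first by rewrite divr_ge0 ?mulr_ge0 ?(ltW S0) ?(ltW t0) ?(ltW d0).
  by rewrite addr_ge0// mulr_ge0// ltW.
pose B (s : R) : R := a * (S / (1 + (s * S) ^+ 2)) + E.
have [J2 iJ] := Rintegral_cauchy_le S0.
have BE : (fun s => B s * \1_(`]0, 1]%classic) s) =
    (fun s => a * (S / (1 + (s * S) ^+ 2) * \1_(`]0, 1]%classic) s) + E * \1_(`]0, 1]%classic) s).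
  by apply/funext => s; rewrite /B mulrDl -(mulrA a).
have i01 := @integrable_indic01 R.
have iB : L1 mu (fun s => B s * \1_(`]0, 1]%classic) s).
  by rewrite BE; apply: integrable_add => //; exact: integrable_scale.
have hB s : 0 < s <= 1 -> normc (char_fun P Y (s * S) -
    Complex (fourier_cos mu id g (s * S)) (fourier_sin mu id g (s * S))) <= s * B s.
  move=> /andP[s0 s1]; rewrite chargE; have sS : 0 <= s * S by rewrite mulr_ge0// ltW.
  have [small|/ltW large] := leP (s * S * tau) delta.
    apply: le_trans (hloc _ sS small) _.
    rewrite /B mulrDr ler_wpDr ?mulr_ge0 ?(ltW s0)//.
    by rewrite le_eqVlt; apply/orP; left; apply/eqP; ring.
  have gu := hC1 _ tau sS tau01.
  have : expR (- ((s * S) ^+ 2 / 4)) <= e4.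
    rewrite e4E ler_expR lerN2 mulrAC ler_wpM2r ?invr_ge0//.
    rewrite -expr_div_n ler_pXn2r ?nnegrE ?divr_ge0 ?(ltW d0) ?(ltW t0)//.
    by rewrite ler_pdivrMr.
  move=> he; apply: le_trans (le_normcD _ _) _; rewrite normcN.
  apply: le_trans (lerD (htail _ sS large) gu) _.
  apply: (@le_trans _ _ (Q + C1 * e4)); first by rewrite lerD2l ler_wpM2l// ltW.
  have W0 : 0 <= Q + C1 * e4 by rewrite addr_ge0// mulr_ge0// ltW.
  apply: (@le_trans _ _ (s * E)); last first.
    rewrite ler_wpM2l ?(ltW s0)// /B lerDr mulr_ge0// divr_ge0 ?(ltW S0)//.
    by rewrite addr_ge0// sqr_ge0.
  rewrite EE mulrA ler_peMl// mulrA ler_pdivlMr// mul1r mulrA; exact: large.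
have JB : \int[mu]_s (B s * \1_(`]0, 1]%classic) s) <= 2 * a + E.
  rewrite BE RintegralD//; [|exact: integrable_scale|exact: integrable_scale].
  rewrite !RintegralZl//; apply: lerD; first by rewrite mulrC ler_wpM2r.
  have mJ : measurable (`]0, 1]%classic : set (measurableTypeR R)) by exact: measurable_itv.
  have -> : \int[mu]_s \1_(`]0, 1]%classic) s = 1.
    rewrite /Rintegral (integral_indic mu measurableT mJ) setIT.
    by rewrite /= lebesgue_measure_itv /= lte_fin ltr01 oppr0 adde0.
  by rewrite mulr1.
have := smoothing_inequality iY ig iyg gM gL1 g1 c0 hc1 hc2 x S0 h0 iB hB.
move=> hsm; apply: le_trans hsm _.
have SE : S * tau = tau ^- (2 * K + 1).
  by rewrite SE' addnS exprS; field; rewrite expf_neq0 gt_eqF.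
have ShE : (c * (S * h))^-1 = c^-1 * h.
  rewrite SE' hE (_ : (2 * K + 2)%N = (K.+1 + K.+1)%N); last by rewrite mul2n -addnn !addnS !addSn addn0.
  rewrite exprD; move: (tau ^+ K.+1) (exprn_gt0 K.+1 t0) => y y0; field.
  by rewrite !gt_eqF.
rewrite ShE -e4E -hE; set W := Q + e4.
have EW : E <= (1 + C1) * (tau ^- (2 * K + 1) / delta * W).
  rewrite EE SE mulrCA; apply: ler_wpM2l.
    by rewrite divr_ge0 ?invr_ge0 ?exprn_ge0 ?(ltW t0) ?(ltW d0).
  by rewrite /W mulrDl mul1r mulrDr; have := mulr_ge0 (ltW C10) Q0; have := e40; lra.
set D := tau ^- (2 * K + 1) / delta * W in EW *.
have D0 : 0 <= D.
  by rewrite mulr_ge0 ?divr_ge0 ?invr_ge0 ?exprn_ge0 ?(ltW t0) ?(ltW d0)// addr_ge0.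
have J3 : (2 * c)^-1 * \int[mu]_s (B s * \1_(`]0, 1]%classic) s) <=
    (2 * c)^-1 * (2 * a + (1 + C1) * D).
  rewrite ler_wpM2l ?(ltW c2)//; apply: le_trans JB _; by rewrite lerD2l.
apply: le_trans (lerD (lerD J3 (lexx _)) (lexx _)) _.
move: (2 * c)^-1 c2 => i i0; rewrite -invr_gt0 in c0; move: c^-1 c0 => j j0.
clear -i0 j0 a0 D0 h0 M_gt0 C10; clearbody D M; rewrite -subr_ge0.
rewrite [leRHS](_ : _ = 2 * i * (D + h) + i * (1 + C1) * (a + h) +
  (1 + M) * j * (a + D) + M * 4 * (a + D)); last by ring.
have M1 : 0 <= 1 + M by rewrite addr_ge0// ltW.
have C11 : 0 <= 1 + C1 by rewrite addr_ge0// ltW.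
have aD : 0 <= a + D by rewrite addr_ge0.
have [ah Dh] : 0 <= a + h /\ 0 <= D + h by split; rewrite addr_ge0// ltW.
have [i1 j1] : 0 <= i /\ 0 <= j by split; exact: ltW.
by rewrite !addr_ge0// !mulr_ge0// ltW.
Qed.

End EdgeworthBound.

Section LevyEdgeworth.
Context d (T : measurableType d) (R : realType) (P : probability T R).
Local Notation mu := (@lebesgue_measure R).
Variables (X : R -> {RV P >-> R}) (K : nat).
Hypothesis hX : levy_process X.
Hypothesis Xk : L1 P (fun w => `|X 1 w| ^+ K.+2).
Hypothesis X10 : \int[P]_w X 1 w = 0.
Hypothesis hC : cramer_condition P (X 1).

Let gam (j : nat) : R := cumulant P (X 1) j.
Let V : R := Num.sqrt (gam 2).
Let K2 : (2 <= K.+2)%N. Proof. by []. Qed.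

Lemma integrable_levy_sqr t : 0 <= t -> L1 P (fun w => X t w ^+ 2).
Proof.
move=> t0; apply/integrableP; split.
  by apply/measurable_EFinP; apply: measurable_funX; exact: measurable_funPT.
under eq_integral do rewrite /= ger0_norm ?sqr_ge0//.
by rewrite (levy_second_moment hX K2 Xk X10 t0) ltry.
Qed.

Lemma integrable_levy t : 0 <= t -> L1 P (X t).
Proof.
move=> t0; apply: (@integrable_dominated _ _ _ P setT measurableT _ (fun w => 1 + X t w ^+ 2)).
- exact: measurable_funPT.
- by move=> w _; exact: le_1Dsqr.
- apply: integrable_add => //; last exact: integrable_levy_sqr.
  exact: integrable_cstT.
Qed.

(** If it were 0, integrating [cos x >= 1 - x ^ 2 / 2] would give [Re v_1(1) >= 1], against Cramer's
    bound at frequency 1. *)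
Lemma levy_variance_gt0 : 0 < gam 2.
Proof.
have i2 := integrable_levy_sqr (ler01 : 0 <= 1 :> R).
have E : \int[P]_w (X 1 w ^+ 2) = gam 2.
  by rewrite /Rintegral (levy_second_moment hX K2 Xk X10 ler01) mul1r.
rewrite lt_neqAle -[X in _ && (_ <= X)]E Rintegral_ge0 ?andbT; last first.
  by move=> w _; exact: sqr_ge0.
apply/eqP => g0.
have [q [/andP[q0 q1] hq]] := cramer_bound hC ltr01.
have := hq 1; rewrite normr1 => /(_ (lexx _)) h.
have : 1 <= cRe (char_fun P (X 1) 1).
  rewrite char_funE /=.
  have i1 := integrable_cstT P 1.
  rewrite [leLHS](_ : _ = \int[P]_w (1 - 2^-1 * X 1 w ^+ 2)); last first.
    rewrite RintegralB//; last exact: integrable_scale.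
    by rewrite RintegralZl// E -g0 mulr0 subr0 Rintegral_cstT.
  apply: le_Rintegral => //.
  - by apply: integrable_sub => //; exact: integrable_scale.
  - exact: integrable_cosM.
  - by move=> w _; have := cos_ge_quad (1 * X 1 w); rewrite mul1r; lra.
move=> /le_trans/(_ (ler_norm _))/le_trans/(_ (Re_le_normc _)).
by move=> /le_trans/(_ h); lra.
Qed.

Let V0 : 0 < V. Proof. by rewrite sqrtr_gt0 levy_variance_gt0. Qed.

Lemma levy_edgeworth (e : R) : 0 < e -> exists2 tau0 : R, 0 < tau0 &
  forall t tau x, 0 < tau <= tau0 -> t = tau ^- 2 ->
  `|fine (P [set w | X t w < x * (V / tau)]) -
    \int[mu]_(y in `]-oo, x]) gauss_poly (edgeworth_density K V gam tau) y| <= e * tau ^+ K.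
Proof.
move=> e0.
have [C C0 hE] := @edgeworth_bound _ T R P K V gam.
have e1 : 0 < e / (2 * C) by rewrite divr_gt0// mulr_gt0.
have gam2 : gam 2 = V ^+ 2 by rewrite sqr_sqrtr// ltW// levy_variance_gt0.
have [d1 [tau1 [d10 [tau10 hloc]]]] := @local_expansion R K V gam V0
  (fun s => plog (char_fun P (X 1) s)) (cumulant0 (X 1))
  (levy_cumulant1 K2 Xk X10) gam2 (plog_taylor Xk) _ e1.
have [d2 d20 hpl] := levy_char_fun_local hX.
pose delta := Num.min d1 (d2 * V).
have delta0 : 0 < delta by rewrite lt_min d10 mulr_gt0.
have dV : 0 < delta / V by rewrite divr_gt0.
have [q [/andP[q0 q1] hq]] := cramer_bound hC dV.
(* [q] may be 0; a positive base is needed for its logarithm. *)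
pose p := Num.max q 2^-1.
have p0 : 0 < p by rewrite lt_max invr_gt0 ltr0n orbT.
have p1 : p < 1 by rewrite gt_max q1 invf_lt1// ltr1n.
pose b1 := - ln p.
have b10 : 0 < b1 by rewrite oppr_gt0 ln_lt0// p0 p1.
pose b := Num.min b1 (delta ^+ 2 / 4).
have b0 : 0 < b by rewrite lt_min b10 divr_gt0// exprn_gt0.
(* The resulting power is [4 K + 4 = (2 K + 1) + (K + 1) + (K + 2)]: it cancels the factor
   [tau ^ (- 2 K - 1)] of [edgeworth_bound] and leaves at least [tau ^ (K + 1)]. *)
have [C2 C20 hC2] := @expR_inv_sqr_le R b (2 * K + 2) b0.
pose C3 := (expR b1 + 1) * C2 / delta.
have C30 : 0 < C3 by rewrite divr_gt0// mulr_gt0// addr_gt0// expR_gt0.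
(* The last bound makes the terms of order [tau ^ (K + 1)] at most [e / 2 * tau ^ K]; the local
   error takes the other half. *)
exists (Num.min 1 (Num.min tau1 (e / (2 * C * (C3 + 1))))).
  by rewrite !lt_min ltr01 tau10 divr_gt0// mulr_gt0 ?mulr_gt0// addr_gt0.
move=> t tau x /andP[t0]; rewrite !le_min => /and3P[t1 tt1 tC] tE.
have tpos : 0 < t by rewrite tE invr_gt0 exprn_gt0.
have mY : measurable_fun setT (fun w => X t w * (tau / V)).
  by apply: measurable_funM => //; exact: measurable_funPT.
pose Y : {RV P >-> R} := mfun_Sub (mem_set mY).
have iY : L1 P Y.
  have := integrable_scale measurableT (tau / V) (integrable_levy (ltW tpos)).
  by apply: eq_integrable => // w _ /=; rewrite mulrC.
have vY s : char_fun P Y s = char_fun P (X t) (s * tau / V).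
  rewrite !char_funE; congr Complex; apply: eq_Rintegral => w _ /=; congr (_ _).
    by move: (X t w) => y; ring.
  by move: (X t w) => y; ring.
(* [p] to the integer part of [t] is at most [p ^ (t - 1)], which is [Q] since [t = tau ^ (- 2)]. *)
pose Q := expR b1 * expR (- (b1 / tau ^+ 2)).
have Q0 : 0 <= Q by rewrite mulr_ge0// expR_ge0.
have a0 : 0 <= e / (2 * C) * tau ^+ K by rewrite mulr_ge0 ?exprn_ge0 ?(ltW t0) ?(ltW e1).
have loc s : 0 <= s -> s * tau <= delta ->
    normc (char_fun P Y s - ghat K V gam tau s) <= e / (2 * C) * tau ^+ K * (s / (1 + s ^+ 2)).
  move=> s0; rewrite le_min => /andP[sd1 sd2].
  have u0 : 0 <= s * tau / V by rewrite divr_ge0 ?mulr_ge0 ?(ltW t0) ?(ltW V0).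
  rewrite vY hpl ?(ltW tpos)//; last by rewrite ger0_norm// ler_pdivrMr.
  by rewrite tE; apply: hloc => //; rewrite t0.
have tail s : 0 <= s -> delta <= s * tau -> normc (char_fun P Y s) <= Q.
  move=> s0 sd; rewrite vY.
  have u0 : 0 <= s * tau / V by rewrite divr_ge0 ?mulr_ge0 ?(ltW t0) ?(ltW V0).
  have /andP[n1 n2] := truncn_itv (ltW tpos); set n := Num.truncn t in n1 n2.
  apply: le_trans (normc_levy_char_fun_le hX _ n1) _.
  have qs : normc (char_fun P (X 1) (s * tau / V)) <= p.
    apply: le_trans (hq _ _) _; first by rewrite ger0_norm// ler_pM2r ?invr_gt0.
    by rewrite le_max lexx.
  apply: (@le_trans _ _ (p ^+ n)); first by apply: lerXn2r; rewrite ?nnegrE ?normc_ge0// ltW.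
  rewrite -[p]lnK ?posrE// -expRM_natl /Q -expRD ler_expR.
  have -> : b1 / tau ^+ 2 = b1 * t by rewrite tE.
  rewrite /b1 in b10 *; move: (ln p) b10 => l b10; move: n2; rewrite -natr1.
  by nra.
have := hE Y tau delta Q _ iY _ delta0 a0 Q0 loc tail x.
rewrite t0 t1 => /(_ isT) hfin.
have -> : [set w | X t w < x * (V / tau)] = [set w | Y w < x].
  apply/seteqP; split=> w /=; rewrite -ltr_pdivlMr ?divr_gt0// invf_div//.
apply: le_trans hfin _.
have eb c : b <= c -> expR (- (c / tau ^+ 2)) <= expR (- (b / tau ^+ 2)).
  by move=> bc; rewrite ler_expR lerN2 ler_wpM2r// invr_ge0 exprn_ge0// ltW.
have hT : tau ^- (2 * K + 1) / delta * (Q + expR (- (delta ^+ 2 / 4 / tau ^+ 2))) <=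
    C3 * tau ^+ K.+1.
  have h1 : Q + expR (- (delta ^+ 2 / 4 / tau ^+ 2)) <= (expR b1 + 1) * (C2 * tau ^+ (2 * K + 2).*2).
    apply: (@le_trans _ _ ((expR b1 + 1) * expR (- (b / tau ^+ 2)))).
      rewrite mulrDl mul1r; apply: lerD; last by apply: eb; rewrite ge_min lexx orbT.
      by rewrite ler_wpM2l ?expR_ge0//; apply: eb; rewrite ge_min lexx.
    by rewrite ler_wpM2l ?addr_ge0 ?expR_ge0// hC2.
  have h2 : 0 <= tau ^- (2 * K + 1) / delta.
    by rewrite divr_ge0 ?(ltW delta0)// invr_ge0 exprn_ge0// ltW.
  apply: le_trans (ler_wpM2l h2 h1) _.
  have -> : tau ^+ (2 * K + 2).*2 = tau ^+ (2 * K + 1) * (tau ^+ K.+1 * tau ^+ K.+2).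
    by rewrite -!exprD; congr (_ ^+ _); rewrite mul2n -!addnn !addnS !addn0 !addSn.
  have tn : tau ^+ (2 * K + 1) != 0 by rewrite expf_neq0// gt_eqF.
  have t2 : tau ^+ K.+2 <= 1 by rewrite exprn_ile1// ltW.
  have t3 : 0 <= tau ^+ K.+1 by rewrite exprn_ge0// ltW.
  move: (tau ^+ (2 * K + 1)) tn (tau ^+ K.+1) t3 (tau ^+ K.+2) t2 => y y0 z z0 u u1.
  rewrite [leLHS](_ : _ = C3 * z * u); first by rewrite ler_piMr// mulr_ge0// ltW.
  by rewrite /C3; field; rewrite y0 gt_eqF.
have tK : 0 <= tau ^+ K by rewrite exprn_ge0// ltW.
apply: (@le_trans _ _ (C * (e / (2 * C) * tau ^+ K + C3 * tau ^+ K.+1 + tau ^+ K.+1))).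
  by rewrite ler_wpM2l ?(ltW C0)// lerD2r lerD2l.
have h4 : C * (C3 + 1) * tau <= e / 2.
  apply: (@le_trans _ _ (C * (C3 + 1) * (e / (2 * C * (C3 + 1))))).
    by rewrite ler_wpM2l// mulr_ge0 ?(ltW C0)// addr_ge0// ltW.
  rewrite le_eqVlt; apply/orP; left; apply/eqP; field.
  by rewrite !gt_eqF// addr_gt0.
rewrite exprSr; move: (tau ^+ K) tK => z z0.
rewrite [leLHS](_ : _ = e / 2 * z + C * (C3 + 1) * tau * z); last first.
  by field; rewrite gt_eqF.
have := ler_wpM2r z0 h4; lra.
Qed.

End LevyEdgeworth.

Lemma powR_half (R : realType) (t : R) n : 0 < t ->
  t `^ (- (n%:R / 2)) = (Num.sqrt t)^-1 ^+ n.
Proof.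
move=> t0; rewrite powRN mulrC powRrM powR12_sqrt ?(ltW t0)//.
by rewrite powR_mulrn ?sqrtr_ge0// exprVn.
Qed.

(** * From [tau] to [t], and scaling of the approximating functions *)

Section LevyExpansion.
Context d (T : measurableType d) (R : realType) (P : probability T R).
Local Notation mu := (@lebesgue_measure R).
Variables (X : R -> {RV P >-> R}) (K : nat).
Hypothesis hX : levy_process X.
Hypothesis Xk : L1 P (fun w => `|X 1 w| ^+ K.+2).
Hypothesis X10 : \int[P]_w X 1 w = 0.
Hypothesis hC : cramer_condition P (X 1).

Let V := Num.sqrt (cumulant P (X 1) 2).
Let V0 : 0 < V. Proof. by rewrite sqrtr_gt0 (levy_variance_gt0 hX Xk X10 hC). Qed.

Lemma levy_rms t : 0 <= t -> rms P (X t) = Num.sqrt t * V.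
Proof.
move=> t0; rewrite /rms unlock /= (levy_second_moment hX (isT : (2 <= K.+2)%N) Xk X10 t0).
by rewrite /= sqrtrM.
Qed.

(** The ratio of the cumulant of order [m + 3] to [rms ^ (m + 3)] scales as [t / t ^ ((m + 3) / 2) =
    t ^ (- (m + 1) / 2)]. Over a solution of weight [nu] these powers multiply to
    [t ^ (- nu / 2)]. *)
Lemma edgeworth_Q_levy t nu x : 0 < t -> (nu <= K)%N ->
  edgeworth_Q P (X t) nu x = edgeworth_Q P (X 1) nu x * (Num.sqrt t)^-1 ^+ nu.
Proof.
move=> t0 nuK; rewrite /edgeworth_Q -[RHS]mulrA; congr (_ * _); rewrite mulr_suml.
apply: eq_bigr => k /eqP kw; rewrite -[RHS]mulrA; congr (_ * _).
have -> : (Num.sqrt t)^-1 ^+ nu = \prod_(m < nu) (Num.sqrt t)^-1 ^+ (m.+1 * k m).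
  by rewrite prodrXr kw.
rewrite -big_split /=; apply: eq_bigr => m _.
rewrite -[RHS]mulrA; congr (_ * _); rewrite exprM -exprMn; congr (_ ^+ _).
have mK : (m.+3 <= K.+2)%N by rewrite !ltnS (leq_trans (ltn_ord m)).
rewrite (levy_cumulant hX Xk (ltW t0) mK) !levy_rms ?ler01 ?(ltW t0)// sqrtr1 mul1r.
rewrite exprMn; have s0 : 0 < Num.sqrt t by rewrite sqrtr_gt0.
have -> : t = Num.sqrt t ^+ 2 by rewrite sqr_sqrtr// ltW.
rewrite sqrtr_sqr ger0_norm ?(ltW s0)//.
move: (Num.sqrt t) s0 => s s0; have -> : s ^+ m.+3 = s ^+ m.+1 * s ^+ 2 by rewrite -exprD addn2.
rewrite exprVn; move: (V ^+ m.+3) (exprn_gt0 m.+3 V0) => v v0.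
move: (s ^+ m.+1) (exprn_gt0 m.+1 s0) => z z0; move: (cumulant _ _ _) => g.
by field; rewrite !gt_eqF// ltr0n fact_gt0.
Qed.

Lemma edgeworth_expansion_levy tau x :
  \int[mu]_(y in `]-oo, x])
     gauss_poly (edgeworth_density K V (fun j => cumulant P (X 1) j) tau) y =
  std_normal_cdf x + \sum_(1 <= nu < K.+1) edgeworth_Q P (X 1) nu x * tau ^+ nu.
Proof.
rewrite edgeworth_density_cdf; congr (_ + _); apply: eq_bigr => nu _; rewrite mulrC.
congr (_ * _); rewrite /edgeworth_Q; congr (_ * _); apply: eq_bigr => k _.
by congr (_ * _); apply: eq_bigr => m _; rewrite levy_rms// sqrtr1 mul1r.
Qed.

Lemma levy_unif_little_o : unif_little_o_powR (K%:R / 2) (fun t x =>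
    fine (P [set w | X t w < x * rms P (X t)]) -
    (std_normal_cdf x +
     \sum_(1 <= nu < K.+1) edgeworth_Q P (X 1) nu x * t `^ (- (nu%:R / 2)))).
Proof.
move=> e e0; have [tau0 tau00 h] := levy_edgeworth hX Xk X10 hC e0.
near=> t; have t0 : 0 < t by near: t; exact: nbhs_pinfty_gt.
have s0 : 0 < Num.sqrt t by rewrite sqrtr_gt0.
have tt : tau0 ^- 2 <= t by near: t; apply: nbhs_pinfty_ge; exact: num_real.
have st : (Num.sqrt t)^-1 <= tau0.
  rewrite -[leRHS]invrK lef_pV2 ?posrE ?invr_gt0//.
  rewrite -[leLHS]ger0_norm ?invr_ge0 ?(ltW tau00)// -sqrtr_sqr exprVn.
  by rewrite ler_wsqrtr.
move=> x; rewrite powR_half//.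
under eq_bigr do rewrite powR_half//.
have := h t (Num.sqrt t)^-1 x; rewrite edgeworth_expansion_levy => h'.
rewrite levy_rms ?(ltW t0)// (mulrC (Num.sqrt t)) -[X in V * X]invrK.
apply: h'; first by rewrite invr_gt0 s0.
by rewrite exprVn invrK sqr_sqrtr// ltW.
Unshelve. all: by end_near. Qed.

End LevyExpansion.

Theorem corollary3p5 (R : realType) (d : measure_display)
  (T : measurableType d) (P : probability T R) (X : R -> {RV P >-> R})
  (k : nat) (hX : levy_process X) (hk : (3 <= k)%N)
  (hmoment : ('E_P[fun w => (`|X 1 w| ^+ k)%R] < +oo)%E)
  (hcramer : cramer_condition P (X 1))
  (hmean : ('E_P[X 1%R] = 0)%E) :
  unif_little_o_powR ((k - 2)%:R / 2) (fun t x =>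
    fine (P [set w | X t w < x * rms P (X t)]) -
    (std_normal_cdf x +
     \sum_(1 <= nu < (k - 2).+1)
       edgeworth_Q P (X 1) nu x * t `^ (- (nu%:R / 2)))) /\
  unif_little_o_powR ((k - 2)%:R / 2) (fun t x =>
    fine (P [set w | X t w < x * rms P (X t)]) -
    (std_normal_cdf x +
     \sum_(1 <= nu < (k - 2).+1) edgeworth_Q P (X t) nu x)).
Proof.
case: k hk hmoment => [|[|K]]// _ hmoment; rewrite subn2 /=.
have Xk : L1 P (fun w => `|X 1 w| ^+ K.+2).
  apply/integrableP; split.
    apply/measurable_EFinP; apply: measurable_funX.
    by apply: measurableT_comp => //; exact: measurable_funPT.
  under eq_integral do rewrite /= ger0_norm ?exprn_ge0//.
  by move: hmoment; rewrite unlock.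
have X10 : \int[P]_w X 1 w = 0 by move: hmean; rewrite unlock /Rintegral => ->.
have main := levy_unif_little_o hX Xk X10 hcramer.
split=> // e e0; move: (main e e0) => he; near=> t => x.
have t0 : 0 < t by near: t; exact: nbhs_pinfty_gt.
rewrite (eq_big_nat _ _ (F2 := fun nu => edgeworth_Q P (X 1) nu x * t `^ (- (nu%:R / 2)))).
  by move: x; near: t.
move=> nu /andP[_ nuK]; rewrite (edgeworth_Q_levy hX Xk X10 hcramer)//.
by rewrite powR_half.
Unshelve. all: by end_near. Qed.
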